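(* Let $\mathfrak{g}$ be a reductive Lie algebra over $\mathbb{C}$ with Cartan subalgebra $\mathfrak{h}$. If $M\in\mathcal{M}(\mathfrak{g},\mathfrak{h})$ is simple, then its Dirac cohomology satisfies $H_{D(\mathfrak{g},\mathfrak{h})}(M)=0$ unless $M$ is a highest weight module.
   Context: A $(\mathfrak{g},\mathfrak{h})$-module (weight module) is a $\mathfrak{g}$-module $M$ which is the direct sum of its weight spaces $M_\mu=\{v\in M: hv=\mu(h)v\ \text{for all } h\in\mathfrak{h}\}$, $\mu\in\mathfrak{h}^*$. It is admissible if all $M_\mu$ are finite-dimensional. $\mathcal{M}(\mathfrak{g},\mathfrak{h})$ is the category of finitely generated admissible $(\mathfrak{g},\mathfrak{h})$-modules. A highest weight module means a module generated by a weight vector annihilated by the nilradical of some Borel subalgebra of $\mathfrak{g}$ containing $\mathfrak{h}$. Dirac cohomology for the pair $(\mathfrak{g},\mathfrak{h})$: let $\mathfrak{b}=\mathfrak{h}\oplus\mathfrak{u}$ be a Borel subalgebra with nilradical $\mathfrak{u}$, let $\bar{\mathfrak{u}}$ be the opposite nilradical, so $\mathfrak{g}=\mathfrak{u}\oplus\mathfrak{h}\oplus\bar{\mathfrak{u}}$, and put $\mathfrak{s}=\mathfrak{u}\oplus\bar{\mathfrak{u}}$. Let $(\,,)$ be the Killing form. The Clifford algebra $C(\mathfrak{s})$ is generated by $\mathfrak{s}$ with relations $vw+wv=2(v,w)$ for $v,w\in\mathfrak{s}$. Let $S_{\mathfrak{g},\mathfrak{h}}$ be the spin module (the simple $C(\mathfrak{s})$-module);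 as a vector space it is $\bigwedge\mathfrak{u}$, with $\mathfrak{u}$ acting by left exterior multiplication and $y\in\bar{\mathfrak{u}}$ acting by the odd derivation sending $x\in\mathfrak{u}$ to $2(x,y)$; as an $\mathfrak{h}$-module it is $\bigwedge\mathfrak{u}\otimes\mathbb{C}_{\rho(\bar{\mathfrak{u}})}$, with $\rho(\bar{\mathfrak{u}})$ the half sum of the roots of $\bar{\mathfrak{u}}$. Let $u_1,\dots,u_n$ be a basis of $\mathfrak{u}$ and $u_1^*,\dots,u_n^*$ the basis of $\bar{\mathfrak{u}}$ with $(u_i,u_j^* )=\delta_{ij}$. In $U(\mathfrak{g})\otimes C(\mathfrak{s})$ set $$C=\sum_{i}u_i^*\otimes u_i-\tfrac14\sum_{i,j}1\otimes u_iu_j[u_i^*,u_j^*],\qquad C^-=\sum_i u_i\otimes u_i^*-\tfrac14\sum_{i,j}1\otimes u_i^*u_j^*[u_i,u_j],$$ and $D(\mathfrak{g},\mathfrak{h})=C+C^-$; this does not depend on the choices made. For a $\mathfrak{g}$-module $M$, $D=D(\mathfrak{g},\mathfrak{h})$ acts on $M\otimes S_{\mathfrak{g},\mathfrak{h}}$, and $H_{D(\mathfrak{g},\mathfrak{h})}(M)=\operatorname{Ker}D/(\operatorname{Ker}D\cap\operatorname{Im}D)$. *)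

(* Defs.v *)
(* Lie algebras are finite-dimensional vector spaces (vectType) with a bilinear
   bracket; g-modules are arbitrary, possibly infinite-dimensional, lmodTypes
   with a bilinear action. *)
From mathcomp Require Export all_boot all_order all_algebra.
From mathcomp Require Export complex.
From mathcomp Require Export boolp classical_sets reals.

Set Implicit Arguments.
Unset Strict Implicit.
Unset Printing Implicit Defensive.

Import GRing.Theory.
Local Open Scope ring_scope.

Section LieAlgebra.
Variables (F : fieldType) (g : vectType F) (br : {bilinear g -> g -> g}).
Implicit Types a b c h : {vspace g}.

Definition lie_bracket : Prop :=
  (forall x, br x x = 0) /\
  (forall x y z, br x (br y z) + br y (br z x) + br z (br x y) = 0).

Definition bracket_space a b : {vspace g} :=
  <<[seq br x y | x <- vbasis a, y <- vbasis b]>>%VS.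

Definition subalgebra a : Prop :=
  forall x y, x \in a -> y \in a -> br x y \in a.

Definition ideal a : Prop := forall x y, y \in a -> br x y \in a.

Fixpoint derived_series a k : {vspace g} :=
  if k is k'.+1 then bracket_space (derived_series a k') (derived_series a k')
  else a.

Definition solvable_lie a : Prop := exists k, derived_series a k = 0%VS.

Fixpoint central_series a k : {vspace g} :=
  if k is k'.+1 then bracket_space a (central_series a k') else a.

Definition nilpotent_lie a : Prop := exists k, central_series a k = 0%VS.

(* The radical is the centre: every solvable ideal is central. *)
Definition reductive : Prop :=
  forall a, ideal a -> solvable_lie a -> forall x y, x \in a -> br x y = 0.

Definition cartan h : Prop :=
  [/\ subalgebra h, nilpotent_lie h &
      forall x, (forall y, y \in h -> br x y \in h) -> x \in h].

Definition borel b : Prop :=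
  [/\ subalgebra b, solvable_lie b &
      forall c, subalgebra c -> solvable_lie c -> (b <= c)%VS -> c = b].

(* For a Borel subalgebra b containing h this is the u with b = h (+) u, i.e.
   the sum of the root spaces in b.  The largest nilpotent ideal of b would
   also contain the centre of g. *)
Definition nilradical b : {vspace g} := bracket_space b b.

Definition opposite_borels h b b' : Prop :=
  [/\ borel b, borel b' & (b :&: b')%VS = h].

Definition lin_trace (f : g -> g) : F :=
  \sum_(i < \dim {:g}) coord (vbasis {:g}) i (f (vbasis {:g})`_i).

Definition killing (x y : g) : F := lin_trace (fun z => br x (br y z)).

End LieAlgebra.

Section Modules.
Variables (F : fieldType) (g : vectType F) (br : {bilinear g -> g -> g}).
Variables (h : {vspace g}) (M : lmodType F) (act : {bilinear g -> M -> M}).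

Definition lie_module : Prop :=
  forall x y v, act (br x y) v = act x (act y v) - act y (act x v).

Definition submodule (N : set M) : Prop :=
  [/\ N 0, forall k u v, N u -> N v -> N (k *: u + v)
    & forall x v, N v -> N (act x v)].

Definition simple_module : Prop :=
  (exists v : M, v != 0) /\
  forall N : set M, submodule N ->
    (forall v, N v -> v = 0) \/ (forall v, N v).

Definition generated_by (s : seq M) : Prop :=
  forall N : set M, submodule N -> (forall v, v \in s -> N v) ->
    forall v, N v.

Definition finitely_generated : Prop := exists s, generated_by s.

(* The dual space of h. *)
Definition weight := 'Hom(subvs_of h, F^o).

Definition weight_space (mu : weight) : set M :=
  fun v => forall x : subvs_of h, act (vsval x) v = mu x *: v.

(* M is the direct sum of its weight spaces. *)
Definition weight_module : Prop :=
  (forall v, exists (ms : seq weight) (f : weight -> M),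
     (forall mu, weight_space mu (f mu)) /\ v = \sum_(mu <- ms) f mu) /\
  (forall (ms : seq weight) (f : weight -> M), uniq ms ->
     (forall mu, weight_space mu (f mu)) -> \sum_(mu <- ms) f mu = 0 ->
     forall mu, mu \in ms -> f mu = 0).

Definition finite_dim (V : set M) : Prop :=
  exists (k : nat) (e : 'I_k -> M), (forall i, V (e i)) /\
    forall v, V v -> exists c : 'I_k -> F, v = \sum_i c i *: e i.

Definition admissible : Prop := forall mu, finite_dim (weight_space mu).

(* Objects of the category M(g, h). *)
Definition category_M : Prop :=
  [/\ lie_module, weight_module, admissible & finitely_generated].

Definition highest_weight_module : Prop :=
  exists (b : {vspace g}) (mu : weight) (v : M),
    [/\ borel br b, (h <= b)%VS, v != 0 /\ weight_space mu v,
        forall x, x \in nilradical br b -> act x v = 0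
      & generated_by [:: v]].

End Modules.

Section Spin.
(* u is a basis of U; the vector of S = /\U with coordinates s is
   \sum_J s J u_J, where u_J = u_j1 /\ ... /\ u_jk for
   J = {j1 < ... < jk}. *)
Variables (F : fieldType) (g : vectType F) (br : {bilinear g -> g -> g}).
Variables (n : nat) (u : n.-tuple g).

Definition spin := {ffun {set 'I_n} -> F}.

Definition spin_basis (I : {set 'I_n}) : spin := [ffun J => (J == I)%:R].

Definition sgn (i : 'I_n) (J : {set 'I_n}) : F :=
  (-1) ^+ #|[set j in J | (j < i)%N]|.

(* x in U acts by left exterior multiplication,
   u_i /\ u_J = sgn i J u_(i |: J) if i \notin J, and 0 otherwise. *)
Definition ext (x : g) (s : spin) : spin :=
  [ffun J : {set 'I_n} =>
     \sum_(i in J) coord u i x * sgn i (J :\ i)%SET * s (J :\ i)%SET].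

(* y in the opposite nilradical acts by the odd derivation sending x in U to
   2 (x, y): u_J |-> \sum_(i in J) 2 (u_i, y) sgn i J u_(J :\ i). *)
Definition ctr (y : g) (s : spin) : spin :=
  [ffun J : {set 'I_n} =>
     \sum_(i | i \notin J)
        2%:R * killing br u`_i y * sgn i J * s (i |: J)%SET].

End Spin.

Section Dirac.
Variables (F : fieldType) (g : vectType F) (br : {bilinear g -> g -> g}).
Variables (M : lmodType F) (act : {bilinear g -> M -> M}).
(* u is a basis of the nilradical and us the dual basis of the opposite one. *)
Variables (n : nat) (u us : n.-tuple g).

(* M (x) S; f stands for \sum_J f J (x) u_J. *)
Definition tensorS : lmodType F := {ffun {set 'I_n} -> M}.

(* The action of X (x) a on M (x) S, for linear X : M -> M and a : S -> S. *)
Definition tens (X : M -> M) (a : spin F n -> spin F n) (f : tensorS) :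
    tensorS :=
  [ffun J => \sum_I a (spin_basis F I) J *: X (f I)].

Definition dirac_C (f : tensorS) : tensorS :=
  \sum_(i < n) tens (act us`_i) (ext u u`_i) f
  - 4%:R^-1 *: \sum_(i < n) \sum_(j < n)
      tens id
        (fun s => ext u u`_i (ext u u`_j (ctr br u (br us`_i us`_j) s))) f.

Definition dirac_Cminus (f : tensorS) : tensorS :=
  \sum_(i < n) tens (act u`_i) (ctr br u us`_i) f
  - 4%:R^-1 *: \sum_(i < n) \sum_(j < n)
      tens id
        (fun s => ctr br u us`_i (ctr br u us`_j (ext u (br u`_i u`_j) s))) f.

Definition dirac (f : tensorS) : tensorS := dirac_C f + dirac_Cminus f.

Definition Ker_dirac : set tensorS := fun f => dirac f = 0.
Definition Im_dirac : set tensorS := fun f => exists f', f = dirac f'.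

(* The coset of f modulo Ker D `&` Im D. *)
Definition dirac_class (f : tensorS) : set tensorS :=
  fun f' => (Ker_dirac `&` Im_dirac)%classic (f' - f).

(* Ker D / (Ker D `&` Im D), as a set of cosets. *)
Definition dirac_cohomology : set (set tensorS) :=
  [set dirac_class f | f in Ker_dirac]%classic.

Definition dirac_cohomology_eq0 : Prop :=
  dirac_cohomology = [set dirac_class 0]%classic.

End Dirac.

(* Main.v *)
(* Suppose first that for some root al both e_al and e_(- al) act injectively on M.
   The weight spaces are finite-dimensional, so y = e_al acts bijectively.  Let
   a = c y be the Clifford action of y; then a^2 = 0, and A = D a + a D is twice
   the action of y plus an operator of weight al in the Clifford algebra.  The
   latter is locally nilpotent and commutes with y, so A is bijective.  A
   computation with the cubic term gives a R = 0 for R = D A - A D, and this forces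
   Ker D to lie in Im D.

   Otherwise let N be the set of roots whose root vectors act locally nilpotently
   on M; as M is simple, N contains al or - al for every root al.  By Fernando's
   argument N is closed under bracketing root vectors, so a positive system can be
   chosen inside N, and Engel's theorem for the corresponding nilradical, acting on
   weight vectors, yields a highest weight vector. *)
From HB Require Import structures.
Require Import Defs.
From mathcomp Require Import ring.
Import GRing.Theory Num.Theory.
Set Implicit Arguments.
Unset Strict Implicit.
Unset Printing Implicit Defensive.
Local Open Scope ring_scope.

(** * Linear endomorphisms *)

(** The Killing form may vanish on the centre, so nondegeneracy enters through the dual bases: they
    pair the two nilradicals U and U'. Together with the maximality of a Borel subalgebra among
    solvable ones, this pairing gives that h is abelian, that root spaces are lines and that g = U +
    h + U'. Until then ad h is not known to be diagonalisable, and weights are taken for generalised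
    eigenvectors. In the Dirac computation the obstacle is that projecting brackets of g to s = U +
    U' drops their h components, so half the anticommutator of the cubic term with c is not a
    representation. The defect is found by commuting it with all c x. This determines an operator
    only up to one commuting or anticommuting with every c x, and a nonzero weight excludes that
    ambiguity. In the remaining case exponentials carry the argument: local nilpotency of x and y
    says nothing formal about [x, y], but conjugating by exp x preserves local nilpotency. *)

Section EndoRing.
Variables (F : fieldType) (V : lmodType F).

Record endo := Endo { endo_fun :> V -> V; endo_linear : linear endo_fun }.

HB.instance Definition _ := gen_eqMixin endo.
HB.instance Definition _ := gen_choiceMixin endo.
HB.instance Definition _ (f : endo) :=
  GRing.isLinear.Build F V V *:%R (endo_fun f) (@endo_linear f).

Lemma endoP (f g : endo) : (forall v, f v = g v) -> f = g.
Proof.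
case: f g => [f lf] [g lg] /= fg; have e : f = g by apply/funext.
by case: g / e lg {fg} => lg; rewrite (Prop_irrelevance lf lg).
Qed.

Fact endo_zero_linear : linear (fun _ : V => 0 : V).
Proof. by move=> k u v; rewrite scaler0 addr0. Qed.
Fact endo_add_linear (f g : endo) : linear (fun v => f v + g v).
Proof. by move=> k u v; rewrite !linearP scalerDr addrACA. Qed.
Fact endo_opp_linear (f : endo) : linear (fun v => - f v).
Proof. by move=> k u v; rewrite linearP opprD scalerN. Qed.
Fact endo_one_linear : linear (fun v : V => v).
Proof. by []. Qed.
Fact endo_mul_linear (f g : endo) : linear (fun v => f (g v)).
Proof. by move=> k u v; rewrite !linearP. Qed.
Fact endo_scale_linear c (f : endo) : linear (fun v => c *: f v).
Proof. by move=> k u v; rewrite linearP scalerDr !scalerA mulrC. Qed.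

Definition endo_add f g := Endo (endo_add_linear f g).
Definition endo_opp f := Endo (endo_opp_linear f).
Definition endo_mul f g := Endo (endo_mul_linear f g).
Definition endo_scale c f := Endo (endo_scale_linear c f).

Fact endo_addA : associative endo_add.
Proof. by move=> f g k; apply: endoP => v /=; rewrite addrA. Qed.
Fact endo_addC : commutative endo_add.
Proof. by move=> f g; apply: endoP => v /=; rewrite addrC. Qed.
Fact endo_add0 : left_id (Endo endo_zero_linear) endo_add.
Proof. by move=> f; apply: endoP => v /=; rewrite add0r. Qed.
Fact endo_addN : left_inverse (Endo endo_zero_linear) endo_opp endo_add.
Proof. by move=> f; apply: endoP => v /=; rewrite addNr. Qed.
HB.instance Definition _ :=
  GRing.isZmodule.Build endo endo_addA endo_addC endo_add0 endo_addN.

Fact endo_mulA : associative endo_mul. Proof. by move=> f g k; apply: endoP. Qed.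
Fact endo_mul1 : left_id (Endo endo_one_linear) endo_mul.
Proof. by move=> f; apply: endoP. Qed.
Fact endo_1mul : right_id (Endo endo_one_linear) endo_mul.
Proof. by move=> f; apply: endoP. Qed.
Fact endo_mulDl : left_distributive endo_mul (@GRing.add endo).
Proof. by move=> f g k; apply: endoP. Qed.
Fact endo_mulDr : right_distributive endo_mul (@GRing.add endo).
Proof. by move=> f g k; apply: endoP => v /=; rewrite linearD. Qed.
HB.instance Definition _ := GRing.Zmodule_isPzRing.Build endo
  endo_mulA endo_mul1 endo_1mul endo_mulDl endo_mulDr.

Fact endo_scaleA a b f : endo_scale a (endo_scale b f) = endo_scale (a * b) f.
Proof. by apply: endoP => v /=; rewrite scalerA. Qed.
Fact endo_scale1 : left_id 1 endo_scale.
Proof. by move=> f; apply: endoP => v /=; rewrite scale1r. Qed.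
Fact endo_scaleDr : right_distributive endo_scale +%R.
Proof. by move=> a f g; apply: endoP => v /=; rewrite scalerDr. Qed.
Fact endo_scaleDl f : {morph endo_scale^~ f : a b / a + b}.
Proof. by move=> a b; apply: endoP => v /=; rewrite scalerDl. Qed.
HB.instance Definition _ := GRing.Zmodule_isLmodule.Build F endo
  endo_scaleA endo_scale1 endo_scaleDr endo_scaleDl.

Lemma endo0E v : (0 : endo) v = 0. Proof. by []. Qed.
Lemma endo1E v : (1 : endo) v = v. Proof. by []. Qed.
Lemma endoDE (f g : endo) v : (f + g) v = f v + g v. Proof. by []. Qed.
Lemma endoNE (f : endo) v : (- f) v = - f v. Proof. by []. Qed.
Lemma endoBE (f g : endo) v : (f - g) v = f v - g v. Proof. by []. Qed.
Lemma endoME (f g : endo) v : (f * g) v = f (g v). Proof. by []. Qed.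
Lemma endoZE c (f : endo) v : (c *: f) v = c *: f v. Proof. by []. Qed.
Lemma apply0 (f : endo) : f 0 = 0. Proof. exact: linear0. Qed.
Lemma applyD (f : endo) u v : f (u + v) = f u + f v. Proof. exact: linearD. Qed.
Lemma applyN (f : endo) v : f (- v) = - f v. Proof. exact: linearN. Qed.
Lemma applyB (f : endo) u v : f (u - v) = f u - f v. Proof. exact: linearB. Qed.
Lemma applyZ (f : endo) c v : f (c *: v) = c *: f v. Proof. exact: linearZ. Qed.
Lemma apply_sum (f : endo) I (r : seq I) (P : pred I) (E : I -> V) :
  f (\sum_(i <- r | P i) E i) = \sum_(i <- r | P i) f (E i).
Proof. exact: linear_sum. Qed.
Lemma endo_sumE I (r : seq I) (P : pred I) (f : I -> endo) v :
  (\sum_(i <- r | P i) f i) v = \sum_(i <- r | P i) f i v.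
Proof. by elim/big_rec2: _ => //= i y x _ <-. Qed.
Lemma endoXS (f : endo) k v : (f ^+ k.+1) v = f ((f ^+ k) v).
Proof. by rewrite exprS. Qed.
Lemma endoXSr (f : endo) k v : (f ^+ k.+1) v = (f ^+ k) (f v).
Proof. by rewrite exprSr. Qed.
Lemma endoZAl c (f g : endo) : c *: f * g = c *: (f * g).
Proof. by apply: endoP. Qed.
Lemma endoZAr c (f g : endo) : f * (c *: g) = c *: (f * g).
Proof. by apply: endoP => v /=; rewrite linearZ. Qed.
End EndoRing.

Local Notation "a %:E" := (a *: (1 : endo _)) (at level 2, left associativity, format "a %:E").

(** * Subspaces and generalised eigenspaces *)

Definition subspace (F : fieldType) (V : lmodType F) (W : V -> Prop) : Prop :=
  W 0 /\ forall k u v, W u -> W v -> W (k *: u + v).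

Definition fin_span (F : fieldType) (V : lmodType F) (W : V -> Prop) : Prop :=
  exists (k : nat) (e : 'I_k -> V),
    forall v, W v -> exists c : 'I_k -> F, v = \sum_i c i *: e i.

Section Subspaces.
Variables (F : fieldType) (V : lmodType F).
Implicit Types (W X : V -> Prop) (f g : endo V).

Lemma subspaceD W u v : subspace W -> W u -> W v -> W (u + v).
Proof. by move=> [_ Wl] Wu Wv; rewrite -[u]scale1r; apply: Wl. Qed.

Lemma subspaceZ W k u : subspace W -> W u -> W (k *: u).
Proof. by move=> [W0 Wl] Wu; rewrite -[_ *: _]addr0; apply: Wl. Qed.

Lemma subspaceB W u v : subspace W -> W u -> W v -> W (u - v).
Proof. by move=> [_ Wl] Wu Wv; rewrite addrC -scaleN1r; apply: Wl. Qed.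

Lemma subspaceN W u : subspace W -> W u -> W (- u).
Proof. by move=> sW Wu; rewrite -scaleN1r; apply: subspaceZ. Qed.

Lemma subspace_sum W I (r : seq I) (P : pred I) (E : I -> V) :
  subspace W -> (forall i, P i -> W (E i)) -> W (\sum_(i <- r | P i) E i).
Proof.
move=> sW WE; elim/big_rec: _ => [|i v Pi Wv]; first by case: sW.
by apply: subspaceD => //; apply: WE.
Qed.

Lemma subspaceX W f k v : (forall v, W v -> W (f v)) -> W v -> W ((f ^+ k) v).
Proof. by move=> Wf Wv; elim: k => // k IH; rewrite endoXS; apply: Wf. Qed.

Lemma fin_span_dep W k (e : 'I_k -> V) m (w : 'I_m -> V) :
  (forall v, W v -> exists c : 'I_k -> F, v = \sum_i c i *: e i) ->
  (forall i, W (w i)) -> (k < m)%N ->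
  exists2 c : 'I_m -> F, exists i, c i != 0 & \sum_i c i *: w i = 0.
Proof.
move=> We Ww ltkm.
have /choice[C Ce] i : exists c : 'I_k -> F, w i = \sum_j c j *: e j by exact: We.
pose A := \matrix_(i, j) C i j.
have kA0 : kermx A != 0.
  rewrite -mxrank_eq0 mxrank_ker subn_eq0 -ltnNge.
  exact: leq_ltn_trans (rank_leq_col A) ltkm.
have [i0 ri0] : exists i, row i (kermx A) != 0.
  apply/existsP; apply: contraNT kA0; rewrite negb_exists => /forallP r0.
  apply/eqP/row_matrixP => i; rewrite row0; apply/eqP.
  by have := r0 i; rewrite negbK.
exists (fun i => kermx A i0 i).
  have [i ci] : exists i, row i0 (kermx A) 0 i != 0.
    by apply/existsP; apply: contraNT ri0; rewrite negb_exists => /forallP r0;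
       apply/eqP/rowP => i; have := r0 i; rewrite negbK => /eqP ->; rewrite mxE.
  by exists i; move: ci; rewrite mxE.
transitivity (\sum_j (\sum_i kermx A i0 i * C i j) *: e j).
  under eq_bigr do rewrite Ce scaler_sumr.
  rewrite exchange_big; apply: eq_bigr => j _.
  by rewrite scaler_suml; apply: eq_bigr => i _; rewrite scalerA.
apply: big1 => j _.
have /matrixP/(_ i0 j) := mulmx_ker A; rewrite [LHS]mxE [RHS]mxE => kA.
suff -> : \sum_i kermx A i0 i * C i j = 0 by rewrite scale0r.
by rewrite -[RHS]kA; apply: eq_bigr => i _; rewrite [A i j]mxE.
Qed.
End Subspaces.

(** Choose s with P whose span has the largest dimension. The condition is on lists rather than on
    spans because chains such as [lie_chain] depend on the order of their entries. *)
Lemma maximal_seq (F : fieldType) (g : vectType F) (P : seq g -> Prop) : P [::] ->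
  exists s, P s /\ forall x, P (rcons s x) -> x \in <<s>>%VS.
Proof.
suff H n s : P s -> (\dim {:g} - \dim <<s>> <= n)%N ->
    exists s, P s /\ forall x, P (rcons s x) -> x \in <<s>>%VS.
  by move=> P0; apply: (H _ [::]) (leqnn _).
elim: n s => [|n IH] s Ps ds.
  exists s; split=> // x _; suff -> : <<s>>%VS = fullv by rewrite memvf.
  by apply/eqP; rewrite eqEdim subvf -subn_eq0 -leqn0.
have [smax|] := pselect (forall x, P (rcons s x) -> x \in <<s>>%VS); first by exists s.
move=> /existsNP[x /not_implyP[Px xs]]; apply: (IH (rcons s x)) => //.
have lt : (\dim <<s>> < \dim <<rcons s x>>)%N.
  have sub : (<<s>> <= <<rcons s x>>)%VS by rewrite -cats1 span_cat addvSl.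
  rewrite ltn_neqAle dimvS // andbT; apply/negP => /eqP e; apply: xs.
  have /eqP -> : <<s>>%VS == <<rcons s x>>%VS by rewrite eqEdim sub -e leqnn.
  by apply: memv_span; rewrite mem_rcons mem_head.
by rewrite leq_subLR in ds; rewrite leq_subLR; apply: (leq_trans ds); rewrite addnS -addSn leq_add2r.
Qed.

Lemma spanning_seq (F : fieldType) (g : vectType F) (P : g -> Prop) :
  exists s, {in s, forall x, P x} /\ forall x, P x -> x \in <<s>>%VS.
Proof.
have [//|s [sP smax]] := @maximal_seq _ g (fun s => {in s, forall x, P x}).
exists s; split=> // x Px; apply: smax => y; rewrite mem_rcons inE => /predU1P[->//|]; exact: sP.
Qed.

Lemma span_subspace (F : fieldType) (g : vectType F) (s : seq g) (P : g -> Prop) :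
  subspace P -> {in s, forall x, P x} -> forall x, x \in <<s>>%VS -> P x.
Proof.
move=> Psub sP x; rewrite -[s]in_tupleE => /coord_span ->; apply: subspace_sum => // i _.
by apply: subspaceZ => //; apply: sP; apply: mem_nth.
Qed.

Lemma subspace_vspace (F : fieldType) (g : vectType F) (P : g -> Prop) :
  subspace P -> exists U : {vspace g}, forall x, x \in U <-> P x.
Proof.
move=> Psub; have [s [sP Ps]] := spanning_seq P.
by exists <<s>>%VS => x; split; [apply: span_subspace | apply: Ps].
Qed.

(** Generalised eigenvectors, with an exponent depending on v since V may be infinite-dimensional;
    for a = 0 and all v this is local nilpotency. *)
Definition gen (F : fieldType) (V : lmodType F) (f : endo V) (a : F) (v : V) :=
  exists k, ((f - a%:E) ^+ k) v = 0.

Section Gen.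
Variables (F : fieldType) (V : lmodType F).
Implicit Types (W X : V -> Prop) (f g : endo V).

Lemma endoX0_le f k m v : (f ^+ k) v = 0 -> (k <= m)%N -> (f ^+ m) v = 0.
Proof. by move=> e /subnK <-; rewrite exprD endoME e apply0. Qed.

Lemma gen_subspace f a : subspace (gen f a).
Proof.
split; first by exists 0%N; rewrite apply0.
move=> c u v [k uk] [m vm]; exists (maxn k m); rewrite applyD applyZ.
by rewrite (endoX0_le uk) ?leq_maxl // (endoX0_le vm) ?leq_maxr // scaler0 addr0.
Qed.

Lemma comm_scalar f a : GRing.comm f a%:E.
Proof. by rewrite /GRing.comm endoZAl endoZAr mul1r mulr1. Qed.

Lemma comm_shift f g a b : GRing.comm f g -> GRing.comm (f - a%:E) (g - b%:E).
Proof.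
move=> fg; apply: commrB (comm_scalar _ b).
by apply: commr_sym; apply: commrB (comm_scalar _ a); apply: commr_sym.
Qed.

Lemma gen_comm f g a v : GRing.comm f g -> gen f a v -> gen f a (g v).
Proof.
move=> fg [k vk]; exists k.
have /(@commrX _ _ _ k) c : GRing.comm g (f - a%:E).
  by apply: commrB (comm_scalar _ a); apply: commr_sym.
by rewrite -endoME -c endoME vk apply0.
Qed.

Lemma gen_subE f a v : (f - a%:E) v = f v - a *: v. Proof. by []. Qed.

Lemma gen_stable f a v : gen f a v -> gen f a (f v).
Proof. exact: gen_comm. Qed.

Lemma eigen_gen f a v : f v = a *: v -> gen f a v.
Proof. by move=> e; exists 1%N; rewrite expr1 gen_subE e subrr. Qed.

Lemma gen_eigen f a b v : gen f a v -> f v = b *: v -> a != b -> v = 0.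
Proof.
move=> [k vk] fv ab; have: (b - a) ^+ k *: v = 0.
  rewrite -vk; elim: k {vk} => [|k IH]; first by rewrite scale1r.
  rewrite endoXS -IH applyZ gen_subE fv -scalerBl.
  by rewrite scalerA exprSr.
by move/eqP; rewrite scaler_eq0 expf_eq0 subr_eq0 eq_sym (negPf ab) andbF => /eqP.
Qed.

(** Induction on the exponent: f - b = (f - a) + (a - b), and (f - a) v, of smaller exponent,
    already has a preimage w under f - b; then (v - w) / (a - b) is a preimage of v. *)
Lemma gen_inv W f a b v : subspace W -> (forall v, W v -> W (f v)) ->
  a != b -> W v -> gen f a v ->
  exists w, [/\ W w, gen f a w & f w - b *: w = v].
Proof.
move=> sW Wf ab + [k]; elim: k v => [|k IH] v Wv vk.
  by exists 0; rewrite (_ : v = 0) //; split; rewrite ?apply0 ?scaler0 ?subrr //;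
    [case: sW | case: (gen_subspace f a)].
have W1 : W ((f - a%:E) v) by apply: subspaceB => //; [apply: Wf | apply: subspaceZ].
rewrite endoXSr in vk; have [w [Ww gw wE]] := IH _ W1 vk.
have gv : gen f a v by exists k.+1; rewrite endoXSr.
exists ((a - b)^-1 *: (v - w)); split.
- by apply: subspaceZ => //; apply: subspaceB.
- by apply: subspaceZ; [|apply: subspaceB]; try exact: gen_subspace.
have E : f (v - w) - b *: (v - w) = (a - b) *: v.
  have -> : f (v - w) - b *: (v - w) = (f v - b *: v) - (f w - b *: w).
    by rewrite applyB scalerBr !opprD !opprK addrACA.
  by rewrite wE gen_subE opprB addrC addrA subrK scalerBl.
rewrite applyZ scalerA mulrC -scalerA -scalerBr E scalerA mulVf ?scale1r //.
by rewrite subr_eq0.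
Qed.

Lemma gen_uniq f a b v : gen f a v -> gen f b v -> a != b -> v = 0.
Proof.
move=> + [k]; elim: k v => [|k IH] v ga vk ab //.
have ga' : gen f a ((f - b%:E) v).
  by apply: subspaceB (gen_subspace f a) (gen_stable ga) _; apply: subspaceZ ga; apply: gen_subspace.
rewrite endoXSr in vk; have /eqP := IH _ ga' vk ab.
by rewrite gen_subE subr_eq0 => /eqP e; apply: gen_eigen ga e ab.
Qed.

Lemma gen_indep f (I : eqType) (r : seq I) (a : I -> F) (v : I -> V) :
  uniq r -> {in r &, injective a} -> {in r, forall i, gen f (a i) (v i)} ->
  \sum_(i <- r) v i = 0 -> {in r, forall i, v i = 0}.
Proof.
elim: r v => [|i r IH] v //= /andP[ir ur] ainj gv.
rewrite big_cons => sum0.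
have gi : gen f (a i) (v i) by apply: gv; rewrite mem_head.
have [k vk] := gi.
have vr j : j \in r -> v j = 0.
  move=> jr; have gj : gen f (a j) (v j) by apply: gv; rewrite inE jr orbT.
  have aij : a j != a i.
    by apply: contra ir => /eqP/ainj <-; rewrite ?inE ?eqxx ?jr ?orbT.
  apply: (gen_uniq gj _ aij); exists k.
  apply: (IH (fun j => ((f - (a i)%:E) ^+ k) (v j))) => //.
  - by move=> x y xr yr; apply: ainj; rewrite inE ?xr ?yr orbT.
  - move=> l lr; apply: gen_comm; last by apply: gv; rewrite inE lr orbT.
    by apply: commrX; apply: commrB (comm_scalar _ _).
  - have /(congr1 ((f - (a i)%:E) ^+ k)) := sum0.
    by rewrite applyD vk add0r apply_sum apply0.
move=> j; rewrite inE => /predU1P[->|/vr //].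
by move: sum0; rewrite big_seq big1 ?addr0.
Qed.

Lemma gen_add f g a b v : GRing.comm f g -> gen f a v -> gen g b v ->
  gen (f + g) (a + b) v.
Proof.
move=> fg [k vk] [m vm]; exists (k + m)%N.
set f' := f - a%:E in vk *; set g' := g - b%:E in vm *.
have -> : f + g - (a + b)%:E = f' + g' by rewrite scalerDl opprD addrACA.
have fg' : GRing.comm f' g' by apply: comm_shift.
have [n e] := ubnP (k + m); elim: n k m v vk vm e => // n IH k m v.
case: k => [|k] vk vm e; first by rewrite (_ : v = 0) ?apply0.
case: m => [|m] in vm e *; first by rewrite (_ : v = 0) ?apply0.
rewrite addSn endoXSr endoDE applyD.
rewrite (IH k m.+1); first last.
- by rewrite -ltnS.
- by rewrite -endoME -(commrX _ fg') endoME vm apply0.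
- by rewrite -endoXSr.
rewrite -addSnnS add0r IH //; last by rewrite addSnnS -ltnS -addSn.
  have c := commrX k.+1 (commr_sym fg').
  by rewrite -endoME -c endoME vk apply0.
by rewrite -endoXSr.
Qed.

Lemma gen_scale c f a v : gen f a v -> gen (c *: f) (c * a) v.
Proof.
move=> [k vk]; exists k; have -> : c *: f - (c * a)%:E = c *: (f - a%:E).
  by rewrite scalerBr scalerA.
have -> : (c *: (f - a%:E)) ^+ k = c ^+ k *: (f - a%:E) ^+ k.
  elim: k {vk} => [|k IH]; first by rewrite !expr0 scale1r.
  by rewrite !exprS IH endoZAl endoZAr scalerA.
by rewrite endoZE vk scaler0.
Qed.

End Gen.

(** In (T - a - b)^(k + m) every term applies D1 - a at least k times or D2 - b at least m times. An
    arbitrary bilinear map covers module actions, the bracket and, with T = 0, the Killing form. *)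
Lemma gen_leibniz (F : fieldType) (U1 U2 V : lmodType F)
  (be : {bilinear U1 -> U2 -> V}) (D1 : endo U1) (D2 : endo U2) (T : endo V)
  a b x y : (forall x y, T (be x y) = be (D1 x) y + be x (D2 y)) ->
  gen D1 a x -> gen D2 b y -> gen T (a + b) (be x y).
Proof.
move=> leib [k xk] [m ym]; exists (k + m)%N.
have E u v : (T - (a + b)%:E) (be u v) =
    be ((D1 - a%:E) u) v + be u ((D2 - b%:E) v).
  rewrite !gen_subE leib linearBl linearBr linearZl_LR linearZr_LR scalerDl opprD.
  by rewrite addrACA.
have [n e] := ubnP (k + m); elim: n k m x y xk ym e => // n IH k m x y.
case: k => [|k] xk ym e; first by rewrite (_ : x = 0) ?linear0l ?linear0.
case: m => [|m] in ym e *; first by rewrite (_ : y = 0) ?linear0r ?linear0.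
rewrite addSn endoXSr E applyD (IH k m.+1) //; last by rewrite -endoXSr.
by rewrite -addSnnS add0r IH // -?endoXSr // addSnnS -ltnS -addSn.
Qed.

Section GenInd.
Variables (F : numClosedFieldType) (V : lmodType F).
Implicit Types (W X P : V -> Prop) (f g : endo V).

Definition peval (p : {poly F}) f v := \sum_(i < size p) p`_i *: (f ^+ i) v.

Lemma pevalE m (p : {poly F}) f v : (size p <= m)%N -> peval p f v = \sum_(i < m) p`_i *: (f ^+ i) v.
Proof.
move=> le; rewrite /peval (big_ord_widen m (fun i => p`_i *: (f ^+ i) v) le).
rewrite big_mkcond; apply: eq_bigr => i _; case: ltnP => // sz.
by rewrite nth_default ?scale0r.
Qed.

Lemma peval_mulXsubC (p : {poly F}) r f v :
  peval (p * ('X - r%:P)) f v = peval p f (f v - r *: v).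
Proof.
rewrite (@pevalE (size p).+1); last first.
  apply: leq_trans (size_polyMleq _ _) _; rewrite size_XsubC addn2 //.
rewrite /peval; set m := size p.
transitivity (\sum_(i < m.+1) (p * 'X)`_i *: (f ^+ i) v - \sum_(i < m.+1) (p`_i * r) *: (f ^+ i) v).
  by rewrite -sumrB; apply: eq_bigr => i _; rewrite mulrBr coefB coefMC scalerBl.
rewrite big_ord_recl coefMX eqxx scale0r add0r big_ord_recr /=.
rewrite [p`_m]nth_default // mul0r scale0r addr0 -sumrB; apply: eq_bigr => i _.
by rewrite coefMX /= applyB applyZ -endoXSr scalerBr scalerA.
Qed.

(** The decomposition into generalised eigenspaces, phrased as induction. The iterates of v are
    dependent, so p(f) v = 0 for some nonzero p; removing a root r of p, (f - r) v is a sum of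
    generalised eigenvectors. Those for eigenvalues other than r have preimages under f - r, and
    what remains of v is a generalised eigenvector for r. *)
Lemma gen_ind W f P : subspace W -> fin_span W -> (forall v, W v -> W (f v)) ->
  P 0 -> (forall u v, P u -> P v -> P (u + v)) ->
  (forall a w, W w -> gen f a w -> P w) -> forall v, W v -> P v.
Proof.
move=> sW [k [e We]] Wf P0 PD Pg.
pose dec v := exists s : seq (F * V),
  (forall p, p \in s -> W p.2 /\ gen f p.1 p.2) /\ v = \sum_(p <- s) p.2.
suff H v : W v -> dec v.
  move=> v /H[s [sg ->]]; rewrite big_seq; elim/big_rec: _ => // p w /sg[Wp gp].
  by apply: PD; apply: Pg gp.
move=> Wv.
have [c [i0 ci0] sum0] := fin_span_dep We (fun i : 'I_k.+1 => subspaceX i Wf Wv) (leqnn _).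
have [p p0 pv] : exists2 p : {poly F}, p != 0 & peval p f v = 0.
  exists (\poly_(i < k.+1) c (inord i)).
    by apply: contra ci0 => /eqP/polyP/(_ i0); rewrite coef_poly ltn_ord inord_val coef0 => ->.
  rewrite (@pevalE k.+1) ?size_poly // -[RHS]sum0; apply: eq_bigr => i _.
  by rewrite coef_poly ltn_ord inord_val.
move: p p0 v Wv pv {c i0 ci0 sum0} => p p0 v Wv pv.
have [n] := ubnP (size p); elim: n p p0 v Wv pv => // n IH p p0 v Wv pv szp.
have [/eqP/size_poly1P[c c0 pc]|szp1] := eqVneq (size p) 1%N.
  move: pv; rewrite (@pevalE 1) pc ?size_polyC ?c0 // big_ord1 coefC /= => /eqP.
  rewrite scaler_eq0 (negPf c0) => /eqP v0.
  by exists [::]; rewrite big_nil v0.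
have [r /factor_theorem[q pq]] := closed_rootP p szp1.
have q0 : q != 0 by apply: contra p0; rewrite pq => /eqP ->; rewrite mul0r.
have szq : (size q < n)%N.
  by move: szp; rewrite pq size_Mmonic ?monicXsubC // size_XsubC addn2.
rewrite pq peval_mulXsubC in pv.
have Wfv : W (f v - r *: v) by apply: subspaceB => //; [apply: Wf | apply: subspaceZ].
have [s [sg sE]] := IH q q0 _ Wfv pv szq.
have /choice[h hP] (x : F * V) : exists w, x \in s -> x.1 != r ->
    [/\ W w, gen f x.1 w & f w - r *: w = x.2].
  have [xs|] := boolP (x \in s); last by exists 0.
  have [_|xr] := boolP (x.1 == r); first by exists 0.
  have [w wP] := gen_inv sW Wf xr (sg x xs).1 (sg x xs).2; exists w => // _.
pose s' := [seq (x.1, h x) | x <- s & x.1 != r].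
pose u := \sum_(x <- s') x.2.
have Wh x : x \in s' -> W x.2 /\ gen f x.1 x.2.
  move=> /mapP[y]; rewrite mem_filter => /andP[yr ys] -> /=.
  by have [] := hP y ys yr.
have Wu : W u by rewrite /u big_seq; apply: subspace_sum => // x /Wh[].
have Wvu : W (v - u) by apply: subspaceB.
have gvu : gen f r (v - u).
  suff [k0 e0] : gen f r (f (v - u) - r *: (v - u)) by exists k0.+1; rewrite endoXSr.
  have -> : f (v - u) - r *: (v - u) = \sum_(x <- s | x.1 == r) x.2.
    have -> : f (v - u) - r *: (v - u) = (f v - r *: v) - (f u - r *: u).
      by rewrite applyB scalerBr !opprD !opprK addrACA.
    rewrite sE (bigID (fun x => x.1 == r)) /= [X in _ + X - _](_ : _ = f u - r *: u) ?addrK //.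
    rewrite /u big_map big_filter apply_sum scaler_sumr -sumrB big_seq_cond [RHS]big_seq_cond.
    by apply: eq_bigr => x /andP[xs xr] /=; have [] := hP x xs xr.
  rewrite big_seq_cond; apply: subspace_sum (gen_subspace f r) _ => x /andP[xs /eqP <-].
  by case: (sg x xs).
exists ((r, v - u) :: s'); split; last by rewrite big_cons /= subrK.
by move=> x; rewrite inE => /predU1P[->|/Wh].
Qed.

(** A generalised eigenspace of f is stable under operators commuting with f, so the list is treated
    one operator at a time. *)
Lemma joint_gen_ind W (fs : seq (endo V)) P :
  subspace W -> fin_span W -> {in fs, forall f v, W v -> W (f v)} ->
  {in fs &, forall f g, GRing.comm f g} ->
  P 0 -> (forall u v, P u -> P v -> P (u + v)) ->
  (forall w, W w -> {in fs, forall f, exists a, gen f a w} -> P w) ->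
  forall v, W v -> P v.
Proof.
move=> + + + + P0 PD; elim: fs W => [|f fs IH] W sW fW Wfs cfs PW v Wv.
  by apply: PW.
apply: (gen_ind sW fW (Wfs f (mem_head _ _)) P0 PD) Wv => a w Ww gw.
pose W' v := W v /\ gen f a v.
apply: (IH W') => //.
- split; first by split; [case: sW | case: (gen_subspace f a)].
  by move=> c x y [Wx gx] [Wy gy]; split; [apply: sW.2 | apply: (gen_subspace f a).2].
- by case: fW => k [e We]; exists k, e => x [/We].
- move=> g gfs x [Wx gx]; split; first by apply: Wfs => //; rewrite inE gfs orbT.
  by apply: gen_comm gx; apply: cfs; rewrite inE ?eqxx ?gfs ?orbT.
- by move=> x y xs ys; apply: cfs; rewrite inE ?xs ?ys orbT.
- move=> x [Wx gx] xfs; apply: PW => // y; rewrite inE => /predU1P[->|/xfs //].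
  by exists a.
Qed.

Lemma shift_nilpotent W (f q : endo V) (c a : F) v : fin_span W -> c != 0 ->
  (forall b w, gen f b w -> gen f (b + c) (q w)) ->
  gen f a v -> (forall k, W ((q ^+ k) v)) -> exists k, (q ^+ k) v = 0.
Proof.
move=> [k [e We]] c0 fq gv Wq.
have [C [i ci] sum0] := fin_span_dep We (fun i : 'I_k.+1 => Wq i) (leqnn _).
have gq m : gen f (a + c *+ m) ((q ^+ m) v).
  elim: m => [|m IH]; first by rewrite addr0.
  by rewrite endoXS mulrSr addrA; apply: fq.
exists i; have : C i *: (q ^+ i) v = 0.
  apply: (@gen_indep _ _ f _ (index_enum 'I_k.+1) (fun j => a + c *+ j)) sum0 _ (mem_index_enum i).
  - exact: index_enum_uniq.
  - by move=> x y _ _ /addrI/(mulrIn c0)/val_inj.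
  - by move=> j _; apply: subspaceZ (gq j); apply: gen_subspace.
by move/eqP; rewrite scaler_eq0 (negPf ci) => /eqP.
Qed.

End GenInd.

(* Jacobson's weakly closed sets: only the closure of Q under the operators is
   used, so the vector produced can be kept homogeneous. *)
Lemma engel_vector (F : fieldType) (V : lmodType F) (I : eqType)
    (rho : I -> endo V) (X Q : V -> Prop) (s : seq I) :
  subspace X ->
  {in s, forall q w, Q w -> Q (rho q w)} ->
  {in s, forall q w, X w -> X (rho q w)} ->
  {in s, forall q w, Q w -> exists k, X ((rho q ^+ k) w)} ->
  (forall s1 q s2, s = s1 ++ q :: s2 -> forall p w, p \in s1 ->
     (forall p', p' \in s1 -> X (rho p' w)) ->
     X (rho p (rho q w) - rho q (rho p w))) ->
  forall w, Q w -> ~ X w ->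
  exists w', [/\ Q w', ~ X w' & {in s, forall q, X (rho q w')}].
Proof.
move=> sX; elim/last_ind: s => [|s q IH] Qs Xs nil chain w Qw Xw.
  by exists w.
have ss p : p \in s -> p \in rcons s q by rewrite mem_rcons inE orbC => ->.
have qs : q \in rcons s q by rewrite mem_rcons mem_head.
have [||||w1 [Qw1 Xw1 sw1]] := IH _ _ _ _ w Qw Xw.
- by move=> p /ss; apply: Qs.
- by move=> p /ss; apply: Xs.
- by move=> p /ss; apply: nil.
- by move=> s1 p s2 e; apply: (chain s1 p (rcons s2 q)); rewrite e rcons_cat.
have [k] := nil q qs w1 Qw1.
elim: k w1 Qw1 Xw1 sw1 => [|k IHk] w1 Qw1 Xw1 sw1 // qk.
have [Xq|Xq] := pselect (X (rho q w1)).
  exists w1; split=> // p; rewrite mem_rcons inE => /predU1P[->//|]; exact: sw1.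
apply: (IHk (rho q w1)) => //; [exact: Qs | | by rewrite -endoXSr].
move=> p ps; rewrite -[rho p _](subrK (rho q (rho p w1))); apply: subspaceD => //.
  by apply: (chain s q [::]) => //; rewrite cats1.
by apply: Xs => //; apply: sw1.
Qed.

(** * Traces *)

(** All eigenvalues vanish, so [char_poly A] is a power of X, and the trace is, up to sign, one of
    its lower coefficients. *)
Lemma mxtrace_nilpotent (F : closedFieldType) n (A : 'M[F]_n) k : A ^+ k = 0 -> \tr A = 0.
Proof.
case: n A => [|n] A Ak; first by rewrite /mxtrace big_ord0.
have [r cpA] := closed_field_poly_normal (char_poly A).
rewrite (monicP (char_poly_monic A)) scale1r in cpA.
have r0 z : z \in r -> z = 0.
  move=> zr; have /eigenvalueP[v vA v0] : eigenvalue A z.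
    by rewrite eigenvalue_root_char cpA root_prod_XsubC.
  have : z ^+ k *: v = 0.
    rewrite -[RHS](mulmx0 _ v) -Ak; elim: k {Ak} => [|k IH].
      by rewrite scale1r mulmx1.
    by rewrite exprS -scalerA IH exprS mulmxA vA scalemxAl.
  by move/eqP; rewrite scaler_eq0 (negPf v0) orbF expf_eq0 => /andP[_ /eqP].
have cX : char_poly A = 'X^(n.+1).
  have := size_char_poly A; rewrite cpA size_prod_XsubC => -[<-].
  elim: r r0 {cpA} => [|z r IH] r0; first by rewrite big_nil.
  rewrite big_cons exprS IH => [|y yr]; last by apply: r0; rewrite inE yr orbT.
  by rewrite (r0 z) ?mem_head // subr0.
have := @char_poly_trace _ n.+1 A (ltn0Sn _); rewrite cX coefXn /= ltn_eqF //.
by move=> /esym/eqP; rewrite oppr_eq0 => /eqP.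
Qed.

Section Trace.
Variables (F : fieldType) (V : vectType F).
Implicit Types f : endo V.
Local Notation e := (vbasis {:V}).

Definition endo_mx f : 'M[F]_(\dim {:V}) := \matrix_(i, j) coord e j (f e`_i).

Lemma coord_fullv v : v = \sum_i coord e i v *: e`_i.
Proof. by apply: coord_vbasis; rewrite memvf. Qed.

Lemma endo_mxM f f' : endo_mx (f * f') = endo_mx f' *m endo_mx f.
Proof.
apply/matrixP => i j; rewrite !mxE endoME [f' _]coord_fullv apply_sum linear_sum /=.
by apply: eq_bigr => l _; rewrite !mxE applyZ linearZ.
Qed.

Lemma endo_mxD f f' : endo_mx (f + f') = endo_mx f + endo_mx f'.
Proof. by apply/matrixP => i j; rewrite !mxE endoDE linearD. Qed.

Lemma endo_mxZ c f : endo_mx (c *: f) = c *: endo_mx f.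
Proof. by apply/matrixP => i j; rewrite !mxE endoZE linearZ. Qed.

Lemma endo_mx1 : endo_mx 1 = 1%:M.
Proof.
by apply/matrixP => i j; rewrite !mxE endo1E coord_free ?(basis_free (vbasisP _)).
Qed.

Lemma lin_traceE f : lin_trace f = \tr (endo_mx f).
Proof. by apply: eq_bigr => i _; rewrite mxE. Qed.

Lemma lin_traceC f f' : lin_trace (f * f') = lin_trace (f' * f).
Proof. by rewrite !lin_traceE !endo_mxM mxtrace_mulC. Qed.

Lemma lin_traceD f f' : lin_trace (f + f') = lin_trace f + lin_trace f'.
Proof. by rewrite !lin_traceE endo_mxD mxtraceD. Qed.

Lemma lin_traceZ c f : lin_trace (c *: f) = c * lin_trace f.
Proof. by rewrite !lin_traceE endo_mxZ mxtraceZ. Qed.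

Lemma lin_traceB f f' : lin_trace (f - f') = lin_trace f - lin_trace f'.
Proof. by rewrite -scaleN1r lin_traceD lin_traceZ mulN1r. Qed.

Lemma lin_trace_sum I (r : seq I) (E : I -> endo V) :
  lin_trace (\sum_(i <- r) E i) = \sum_(i <- r) lin_trace (E i).
Proof.
elim: r => [|i r IH]; last by rewrite !big_cons lin_traceD IH.
by rewrite !big_nil -[0 in LHS](scale0r (1 : endo V)) lin_traceZ mul0r.
Qed.

Lemma lin_trace1 : lin_trace (1 : endo V) = (\dim {:V})%:R.
Proof. by rewrite lin_traceE endo_mx1 mxtrace1. Qed.

Lemma endo_nilpotent f : (forall v, gen f 0 v) -> exists k, f ^+ k = 0.
Proof.
move=> nf; have /choice[k kP] (i : 'I_(\dim {:V})) : exists k, (f ^+ k) e`_i = 0.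
  by have [k] := nf e`_i; rewrite scale0r subr0; exists k.
exists (\max_i k i)%N; apply: endoP => v; rewrite [v]coord_fullv apply_sum big1 // => i _.
by rewrite applyZ (endoX0_le (kP i)) ?scaler0 // leq_bigmax.
Qed.
End Trace.

Section TraceClosed.
Variables (F : numClosedFieldType) (V : vectType F).
Implicit Types f : endo V.

Lemma lin_trace_gen f c : (forall v, gen f c v) -> lin_trace f = c * (\dim {:V})%:R.
Proof.
move=> gf; have [v|k fk] := @endo_nilpotent _ _ (f - c%:E).
  by rewrite /gen scale0r subr0; apply: gf.
have : lin_trace (f - c%:E) = 0.
  rewrite lin_traceE; apply: (@mxtrace_nilpotent _ _ _ k).
  have -> m : endo_mx (f - c%:E) ^+ m = endo_mx ((f - c%:E) ^+ m).
    by elim: m => [|m IH]; rewrite ?expr0 ?endo_mx1 // exprS IH exprSr endo_mxM.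
  by rewrite fk; apply/matrixP => i j; rewrite !mxE linear0.
by rewrite lin_traceB lin_traceZ lin_trace1 => /eqP; rewrite subr_eq0 => /eqP.
Qed.

Lemma lin_trace_nil f : (forall v, gen f 0 v) -> lin_trace f = 0.
Proof. by move/lin_trace_gen; rewrite mul0r. Qed.

End TraceClosed.

(* The trace on U is zero, and it is c times the dimension of U. *)
Lemma commutator_gen_eq0 (F : numClosedFieldType) (V : vectType F) (U : {vspace V}) I (r : seq I) (A B : I -> endo V) c x :
  (forall i v, v \in U -> A i v \in U) -> (forall i v, v \in U -> B i v \in U) ->
  (forall v, v \in U -> gen (\sum_(i <- r) (A i * B i - B i * A i)) c v) ->
  x \in U -> x != 0 -> c = 0.
Proof.
move=> AU BU gT xU x0; set T := \sum_(i <- r) _ in gT.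
(* Restriction to U: the projection [vsproj] makes it an endomorphism for every f, and it is the
   true restriction when f preserves U. *)
pose rs (f : endo V) : endo (subvs_of U) :=
  Endo (fun k u v => etrans (congr1 (vsproj U) (etrans (congr1 f (linearP vsval k u v))
    (linearP f k (vsval u) (vsval v)))) (linearP (vsproj U) k _ _)).
have rsE f v : rs f v = vsproj U (f (vsval v)) by [].
have val_rs (f : endo V) : (forall v, v \in U -> f v \in U) -> forall v, vsval (rs f v) = f (vsval v).
  by move=> fU v; rewrite rsE vsprojK // fU // subvsP.
have TU v : v \in U -> T v \in U.
  move=> vU; rewrite endo_sumE; apply: memv_suml => i _.
  by apply: memvB; rewrite endoME; [apply/AU/BU | apply/BU/AU].
have TrE : rs T = \sum_(i <- r) (rs (A i) * rs (B i) - rs (B i) * rs (A i)).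
  apply: endoP => v; apply: val_inj => /=; rewrite val_rs // !endo_sumE linear_sum /=.
  apply: eq_bigr => i _; have vU := subvsP v.
  by rewrite (vsprojK (BU i _ vU)) (vsprojK (AU i _ vU)) !vsprojK //; [apply/BU/AU | apply/AU/BU].
have : lin_trace (rs T) = 0.
  by rewrite TrE lin_trace_sum big1 // => i _; rewrite lin_traceB lin_traceC subrr.
have gr : forall v, gen (rs T) c v.
  move=> v; have [k vk] := gT (vsval v) (subvsP v); exists k; apply: val_inj.
  suff E m : vsval (((rs T - c%:E) ^+ m) v) = ((T - c%:E) ^+ m) (vsval v) by rewrite /= E vk.
  elim: m => // m IH; rewrite !endoXS -IH; move: (((rs T - c%:E) ^+ m) v) => w.
  rewrite !gen_subE -val_rs //; exact: etrans (linearB _ _ _) (congr1 _ (linearZ _ _)).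
rewrite (@lin_trace_gen F (subvs_of U) (rs T) c gr).
move/eqP; rewrite mulf_eq0 pnatr_eq0 => /predU1P[//|].
rewrite dimv_eq0 => /eqP U0; have := memvf (vsproj U x).
rewrite U0 memv0 => /eqP/(congr1 vsval); rewrite vsprojK // linear0 => xx.
by rewrite xx eqxx in x0.
Qed.

(** * Lie modules and the Killing form *)

Definition actE (F : fieldType) (g : vectType F) (V : lmodType F)
  (act : {bilinear g -> V -> V}) (x : g) : endo V := Endo (linearPr act x).

Section LieBasics.
Variables (F : numClosedFieldType) (g : vectType F) (br : {bilinear g -> g -> g}).
Hypothesis g_lie : lie_bracket br.
Local Notation ad := (actE br).
Implicit Types x y z t : g.

Lemma brxx x : br x x = 0. Proof. exact: g_lie.1. Qed.

Lemma brC x y : br x y = - br y x.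
Proof.
have := brxx (x + y); rewrite linearDl /= !linearDr /= !brxx add0r addr0.
by move/eqP; rewrite addr_eq0 => /eqP.
Qed.

Lemma jacobi x y z : br x (br y z) = br (br x y) z + br y (br x z).
Proof.
have := g_lie.2 x y z; rewrite [br (br x y) z]brC [br x z]brC linearNr.
by move/eqP; rewrite -addrA addr_eq0 opprD addrC => /eqP.
Qed.

Lemma jacobi_ad x y z : br (br x y) z = br x (br y z) - br y (br x z).
Proof. by rewrite jacobi addrK. Qed.

Lemma ad_lie_module : lie_module br br.
Proof. by move=> x y v; rewrite jacobi_ad. Qed.

Section Module.
Variables (V : lmodType F) (act : {bilinear g -> V -> V}).

Lemma actE_linear k x y : actE act (k *: x + y) = k *: actE act x + actE act y.
Proof. by apply: endoP => v; rewrite /= linearDl linearZl_LR. Qed.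

Lemma actEZ k x : actE act (k *: x) = k *: actE act x.
Proof. by apply: endoP => v; rewrite /= linearZl_LR. Qed.

Lemma actED x y : actE act (x + y) = actE act x + actE act y.
Proof. by apply: endoP => v; rewrite /= linearDl. Qed.

Hypothesis V_mod : lie_module br act.

Lemma actE_br x y :
  actE act (br x y) = actE act x * actE act y - actE act y * actE act x.
Proof. by apply: endoP => v; rewrite /= V_mod. Qed.

Lemma act_swap x y v : act x (act y v) = act (br x y) v + act y (act x v).
Proof. by rewrite V_mod subrK. Qed.

Lemma gen_act t a b x v : gen (ad t) a x -> gen (actE act t) b v ->
  gen (actE act t) (a + b) (act x v).
Proof. by apply: gen_leibniz => {}x {}v /=; rewrite act_swap. Qed.

Lemma actE_comm x y : br x y = 0 -> GRing.comm (actE act x) (actE act y).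
Proof. by move=> e; apply/eqP; rewrite -subr_eq0 -actE_br e; apply/eqP/endoP => v; rewrite /= linear0l. Qed.
End Module.

Lemma gen_br t a b x y : gen (ad t) a x -> gen (ad t) b y ->
  gen (ad t) (a + b) (br x y).
Proof. exact: (gen_act ad_lie_module). Qed.

Local Notation B := (killing br).

Lemma killingE x y : B x y = lin_trace (ad x * ad y). Proof. by []. Qed.

Lemma killing_bilinear : bilinear_for
  (GRing.Scale.Law.clone _ _ ( *:%R ) _) (GRing.Scale.Law.clone _ _ ( *:%R ) _)
  (B : g -> g -> F^o).
Proof.
split=> x k u v; rewrite !killingE actE_linear.
  by rewrite mulrDl endoZAl lin_traceD lin_traceZ.
by rewrite mulrDr endoZAr lin_traceD lin_traceZ.
Qed.

HB.instance Definition _ := bilinear_isBilinear.Build F g g F^o _ _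
  (B : g -> g -> F^o) killing_bilinear.

Lemma killingC x y : B x y = B y x.
Proof. by rewrite !killingE lin_traceC. Qed.

Lemma killing_inv x y z : B (br x y) z = B x (br y z).
Proof.
rewrite !killingE !(actE_br ad_lie_module) mulrBl mulrBr !lin_traceB !mulrA.
by rewrite -(mulrA (ad y)) (lin_traceC (ad y)).
Qed.

Lemma killingDl x y z : B (x + y) z = B x z + B y z.
Proof. exact: (linearDl (B : {bilinear g -> g -> F^o})). Qed.
Lemma killingDr x y z : B z (x + y) = B z x + B z y.
Proof. exact: (linearDr (B : {bilinear g -> g -> F^o})). Qed.
Lemma killingZl k x z : B (k *: x) z = k * B x z.
Proof. exact: (linearZl_LR (B : {bilinear g -> g -> F^o})). Qed.
Lemma killingZr k x z : B z (k *: x) = k * B z x.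
Proof. exact: (linearZr_LR (B : {bilinear g -> g -> F^o})). Qed.
Lemma killing0l x : B 0 x = 0.
Proof. exact: (linear0l (B : {bilinear g -> g -> F^o})). Qed.
Lemma killing0r x : B x 0 = 0.
Proof. exact: (linear0r (B : {bilinear g -> g -> F^o})). Qed.
Lemma killingNl x z : B (- x) z = - B x z.
Proof. exact: (linearNl (B : {bilinear g -> g -> F^o})). Qed.
Lemma killing_suml I (r : seq I) (P : pred I) (E : I -> g) z :
  B (\sum_(i <- r | P i) E i) z = \sum_(i <- r | P i) B (E i) z.
Proof. exact: (linear_sumlz (B : {bilinear g -> g -> F^o})). Qed.
Lemma killing_sumr I (r : seq I) (P : pred I) (E : I -> g) z :
  B z (\sum_(i <- r | P i) E i) = \sum_(i <- r | P i) B z (E i).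
Proof. exact: (linear_sumr (B : {bilinear g -> g -> F^o})). Qed.

Lemma killing1_neq0 x z : B x z = 1 -> z != 0.
Proof. by move=> e; apply: contra_eq_neq e => ->; rewrite killing0r eq_sym oner_neq0. Qed.

Lemma killing_orth_subspace z : subspace (fun x => B x z = 0).
Proof. by split; [exact: killing0l | move=> k u v e1 e2; rewrite killingDl killingZl e1 e2 mulr0 addr0]. Qed.

(** Invariance makes ad t act on the values of B by the derivation 0, so B x y is a generalised
    eigenvector of 0 for a + b. *)
Lemma killing_gen_eq0 t a b x y : gen (ad t) a x -> gen (ad t) b y ->
  a + b != 0 -> B x y = 0.
Proof.
move=> gx gy ab.
have : gen (0 : endo F^o) (a + b) (B x y).
  apply: (gen_leibniz (be := (B : {bilinear g -> g -> F^o}))) gx gy => {}x {}y /=.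
  by rewrite -killing_inv [br t x]brC killingNl addNr.
by move=> gB; apply: (gen_eigen gB (b := 0) _ ab); rewrite endo0E scale0r.
Qed.

(** The nilpotent ad x commutes with ad y, so their product is nilpotent. *)
Lemma killing_nil_eq0 x y : br x y = 0 -> (forall v, gen (ad x) 0 v) -> B x y = 0.
Proof.
move=> xy nx; have [k xk] := endo_nilpotent nx.
rewrite killingE lin_trace_nil // => v; exists k.
by rewrite scale0r subr0 exprMn_comm ?xk ?mul0r //; apply: actE_comm => //; apply: ad_lie_module.
Qed.

End LieBasics.

(** * Engel chains and Cartan subalgebras *)

Lemma fin_span_vect (F : fieldType) (g : vectType F) (W : g -> Prop) : fin_span W.
Proof.
exists (\dim {:g}), (fun i => (vbasis {:g})`_i) => v _.
by exists (fun i => coord (vbasis {:g}) i v); apply: coord_fullv.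
Qed.

Lemma subspace_mem (F : fieldType) (g : vectType F) (U : {vspace g}) :
  subspace (fun x => x \in U).
Proof. by split; [exact: mem0v | move=> k u v uU vU; apply: memvD => //; apply: memvZ]. Qed.

Section LieStructure.
Variables (F : numClosedFieldType) (g : vectType F) (br : {bilinear g -> g -> g}).
Hypothesis g_lie : lie_bracket br.
Local Notation ad := (actE br).
Local Notation B := (killing br).
Implicit Types (x y z t : g) (a b c h : {vspace g}).

Lemma mem_bracket a b x y : x \in a -> y \in b -> br x y \in bracket_space br a b.
Proof.
move=> /coord_vbasis -> /coord_vbasis ->; rewrite linear_sumlz.
apply: memv_suml => i _; rewrite linear_sumr; apply: memv_suml => j _.
rewrite linearZl_LR linearZr_LR; do 2!apply: memvZ; apply/memv_span/allpairsP.
by exists ((vbasis a)`_i, (vbasis b)`_j); rewrite !mem_nth ?size_tuple.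
Qed.

Lemma bracket_ind a b (P : g -> Prop) : subspace P ->
  (forall x y, x \in a -> y \in b -> P (br x y)) ->
  forall z, z \in bracket_space br a b -> P z.
Proof.
move=> sP Pbr; apply: span_subspace => // z /allpairsP[[x y] [/= xa yb ->]].
by apply: Pbr; apply: vbasis_mem.
Qed.

Lemma bracket_sum a b z : z \in bracket_space br a b ->
  exists r : seq (g * g), {in r, forall p, p.1 \in a /\ p.2 \in b} /\
    z = \sum_(p <- r) br p.1 p.2.
Proof.
move: z; apply: bracket_ind; last first.
  by move=> x y xa yb; exists [:: (x, y)]; rewrite big_seq1; split=> // p; rewrite inE => /eqP ->.
split; first by exists [::]; rewrite big_nil.
move=> k _ _ [r1 [m1 ->]] [r2 [m2 ->]].
exists ([seq (k *: p.1, p.2) | p <- r1] ++ r2); rewrite big_cat big_map; split.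
  move=> p; rewrite mem_cat => /orP[/mapP[q /m1[qa qb] -> /=]|/m2 //].
  by split=> //; apply: memvZ.
by congr (_ + _); rewrite scaler_sumr; apply: eq_bigr => p _; rewrite linearZl_LR.
Qed.

Lemma bracket_line_sub a c x : (forall y z, y \in a -> z \in a -> br y z \in c) ->
  (forall y, y \in a -> br y x \in c) ->
  (bracket_space br (a + <[x]>)%VS (a + <[x]>)%VS <= c)%VS.
Proof.
move=> aa ax; apply/subvP; apply: bracket_ind; first exact: subspace_mem.
move=> _ _ /memv_addP[y ya [_ /vlineP[k ->] ->]] /memv_addP[z za [_ /vlineP[l ->] ->]].
rewrite linearDl /= !linearDr /= !linearZl_LR !linearZr_LR /= brxx // !scaler0 addr0.
apply: memvD; first by apply: memvD; [apply: aa | apply: memvZ; apply: ax].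
by rewrite brC //; apply: memvZ; rewrite memvN; apply: ax.
Qed.

Lemma bracketS a b a' b' : (a <= a')%VS -> (b <= b')%VS ->
  (bracket_space br a b <= bracket_space br a' b')%VS.
Proof.
move=> /subvP aa /subvP bb; apply/subvP; apply: bracket_ind => [|x y xa yb].
  exact: subspace_mem.
by apply: mem_bracket; [apply: aa | apply: bb].
Qed.

Lemma derivedS a b k : (a <= b)%VS -> (derived_series br a k <= derived_series br b k)%VS.
Proof. by move=> ab; elim: k => //= k IH; apply: bracketS. Qed.

Lemma derived_add a k m :
  derived_series br (derived_series br a k) m = derived_series br a (k + m).
Proof. by elim: m => [|m IH]; rewrite ?addn0 //= IH addnS. Qed.

Lemma solvableS a b : (a <= b)%VS -> solvable_lie br b -> solvable_lie br a.
Proof.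
by move=> ab [k bk]; exists k; apply/eqP; rewrite -subv0 -bk derivedS.
Qed.

Lemma solvable_derived a k : solvable_lie br (derived_series br a k) -> solvable_lie br a.
Proof. by move=> [m e]; exists (k + m)%N; rewrite -derived_add. Qed.

(** X lies in every term of the derived series. It is only a set, so that sl2-triples can be fed in
    without forming their span. *)
Lemma perfect_in_solvable a (X : g -> Prop) : solvable_lie br a ->
  (forall x, X x -> x \in a) ->
  (forall x, X x -> exists y z, [/\ X y, X z & x = br y z]) ->
  forall x, X x -> x = 0.
Proof.
move=> [k ak] Xa Xbr x Xx; apply/eqP; rewrite -memv0 -ak.
elim: k {ak} x Xx => [|k IH] x Xx /=; first exact: Xa.
by have [y [z [Xy Xz ->]]] := Xbr x Xx; apply: mem_bracket; apply: IH.
Qed.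

(** The initial segments span subalgebras, each an ideal of the next: the flag along which Engel's
    theorem is proved by induction. *)
Definition lie_chain (s : seq g) := forall s1 q s2, s = s1 ++ q :: s2 ->
  {in s1, forall p, br p q \in <<s1>>%VS}.

Lemma lie_chain_rcons s q :
  lie_chain (rcons s q) <-> lie_chain s /\ {in s, forall p, br p q \in <<s>>%VS}.
Proof.
split=> [cs|[cs sq] s1 q' s2].
  split; last by apply: (cs s q [::]); rewrite cats1.
  by move=> s1 q' s2 e; apply: (cs s1 q' (rcons s2 q)); rewrite e rcons_cat.
case/lastP: s2 => [|s2 q'']; first by rewrite cats1 => /rcons_inj[<- <-].
by rewrite -rcons_cons -rcons_cat => /rcons_inj[e _]; apply: (cs _ _ _ e).
Qed.

Lemma lie_chain_br s q : lie_chain (rcons s q) -> forall x y,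
  x \in <<rcons s q>>%VS -> y \in <<rcons s q>>%VS -> br x y \in <<s>>%VS.
Proof.
elim/last_ind: s q => [|s p IH] q /lie_chain_rcons[cs sq] x y xs ys;
  apply: (subvP _ _ (mem_bracket xs ys)); rewrite -cats1 span_cat span_seq1;
  apply: bracket_line_sub => [y' z'|w].
- by rewrite span_nil !memv0 => /eqP -> _; rewrite linear0l.
- by rewrite span_nil !memv0 => /eqP ->; rewrite linear0l.
- by move=> y's z's; rewrite -cats1 span_cat; apply: (subvP (addvSl _ _)); apply: (IH p).
apply: (span_subspace (P := fun w => br w q \in <<rcons s p>>%VS)) => //.
split; first by rewrite linear0l mem0v.
by move=> j u v; rewrite linearDl linearZl_LR => uS vS; apply: memvD => //; apply: memvZ.
Qed.

Lemma lie_chain_solvable s a : lie_chain s -> (a <= <<s>>)%VS -> solvable_lie br a.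
Proof.
elim/last_ind: s a => [|s q IH] a cs aS.
  by exists 0%N; apply/eqP; rewrite -subv0 -span_nil.
apply: (@solvable_derived a 1); apply: IH; first by case/lie_chain_rcons: cs.
apply/subvP; apply: bracket_ind => [|x y xa ya]; first exact: subspace_mem.
by apply: (lie_chain_br cs); apply: (subvP aS).
Qed.

Lemma lie_chain_subalgebra s : lie_chain s -> forall x y,
  x \in <<s>>%VS -> y \in <<s>>%VS -> br x y \in <<s>>%VS.
Proof.
case/lastP: s => [|s q] cs x y xs ys.
  by move: xs; rewrite span_nil !memv0 => /eqP ->; rewrite linear0l.
have sub : (<<s>> <= <<rcons s q>>)%VS by rewrite -cats1 span_cat addvSl.
by apply: (subvP sub); apply: (lie_chain_br cs).
Qed.

(** Engel's theorem on V / X without forming the quotient: zero there is membership in X. X = 0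
    gives common null vectors, and a subalgebra X of g gives vectors bracketed into it. *)
Lemma engel_module (V : lmodType F) (act : {bilinear g -> V -> V})
    (s : seq g) (X Q : V -> Prop) :
  lie_module br act -> lie_chain s -> subspace X ->
  {in s, forall q w, Q w -> Q (act q w)} ->
  {in s, forall q w, X w -> X (act q w)} ->
  {in s, forall q w, Q w -> exists k, X ((actE act q ^+ k) w)} ->
  forall w, Q w -> ~ X w ->
  exists w', [/\ Q w', ~ X w' & forall q, q \in <<s>>%VS -> X (act q w')].
Proof.
move=> Vm cs sX Qs Xs ns w Qw Xw.
have [||||w' [Qw' Xw' sw']] := @engel_vector _ _ _ (actE act) X Q s sX _ _ _ _ w Qw Xw => //.
  move=> s1 q s2 e p v ps1 sv /=; rewrite -Vm.
  apply: (@span_subspace _ _ s1 (fun y => X (act y v))) => //; last exact: (cs _ _ _ e).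
  split; first by rewrite linear0l; case: sX.
  by move=> k u1 u2 Xu Xv; rewrite linearDl linearZl_LR; apply: sX.2.
exists w'; split=> //; apply: (span_subspace (P := fun y => X (act y w'))) => //.
split; first by rewrite linear0l; case: sX.
by move=> k u v Xu Xv; rewrite linearDl linearZl_LR; apply: sX.2.
Qed.

(** Take a maximal chain in S. If some x in S were outside its span, Engel's theorem on the quotient
    of g by that span would give y in S outside the span and bracketed into it, which prolongs the
    chain. *)
Lemma engel_chain (S : g -> Prop) :
  (forall x y, S x -> S y -> S (br x y)) ->
  (forall x y, S x -> S y -> exists k, (ad x ^+ k) y = 0) ->
  exists s, [/\ lie_chain s, {in s, forall x, S x} & forall x, S x -> x \in <<s>>%VS].
Proof.
move=> Sbr Snil.
have [|s [[cs sS] smax]] := @maximal_seq _ g (fun s => lie_chain s /\ {in s, forall x, S x}).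
  by split=> // - [].
exists s; split=> // x Sx; apply: contrapT => xs.
have [|||y [Sy ys sy]] := @engel_module _ br s (fun y => y \in <<s>>%VS) S
  (ad_lie_module g_lie) cs (subspace_mem _) _ _ _ x Sx xs.
- by move=> q qs w Sw; apply: Sbr => //; apply: sS.
- by move=> q qs w ws; apply: lie_chain_subalgebra => //; apply: memv_span.
- by move=> q qs w Sw; have [k e] := Snil q w (sS q qs) Sw; exists k; rewrite e mem0v.
apply: ys; apply: smax; split.
- by apply/lie_chain_rcons; split=> // p ps; apply: sy; apply: memv_span.
- by move=> p; rewrite mem_rcons inE => /predU1P[->|/sS].
Qed.

Section Cartan.
Variable h : {vspace g}.
Hypothesis h_cartan : cartan br h.

Lemma cartan_subalgebra : subalgebra br h. Proof. by case: h_cartan. Qed.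

Lemma central_series_sub k : (central_series br h k <= h)%VS.
Proof.
elim: k => [|k IH] /=; first exact: subvv.
apply/subvP; apply: bracket_ind => [|x y xh yh]; first exact: subspace_mem.
by apply: cartan_subalgebra => //; apply: (subvP IH).
Qed.

Lemma cartan_ad_nil x y : x \in h -> y \in h -> exists k, (ad x ^+ k) y = 0.
Proof.
move=> xh yh; have [_ [k hk] _] := h_cartan.
exists k; apply/eqP; rewrite -memv0 -hk; elim: k {hk} => [|k IH] //.
by rewrite endoXS /=; apply: mem_bracket.
Qed.

Lemma cartan_chain : exists s, [/\ lie_chain s, {subset s <= h} & (h <= <<s>>)%VS].
Proof.
have [|s [cs sh hs]] := engel_chain (S := fun x => x \in h) _ cartan_ad_nil.
  exact: cartan_subalgebra.
by exists s; split=> //; apply/subvP.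
Qed.

(** Otherwise Engel's theorem on V / h gives a vector outside h that normalises h, which a Cartan
    subalgebra excludes. *)
Lemma cartan_nil_eq (V : {vspace g}) : (h <= V)%VS ->
  (forall x v, x \in h -> v \in V -> br x v \in V) ->
  (forall x v, x \in h -> v \in V -> exists k, (ad x ^+ k) v = 0) -> (V <= h)%VS.
Proof.
move=> hV Vst Vnil; apply/subvP => w wV; apply: contrapT => wh.
have [s [cs sh hs]] := cartan_chain.
have [|||w' [w'V w'h sw']] := @engel_module _ br s (fun y => y \in h) (fun y => y \in V)
  (ad_lie_module g_lie) cs (subspace_mem _) _ _ _ w wV wh.
- by move=> q /sh qh v vV; apply: Vst.
- by move=> q /sh qh v vh; apply: cartan_subalgebra.
- by move=> q /sh qh v vV; have [k e] := Vnil q v qh vV; exists k; rewrite e mem0v.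
have [_ _ hN] := h_cartan; apply: w'h; apply: hN => y yh.
by rewrite brC // memvN; apply: sw'; apply: (subvP hs).
Qed.

(* g = h + [h, g], in the form of an induction principle. *)
Lemma cartan_fitting (P : g -> Prop) : subspace P ->
  (forall x, x \in h -> P x) -> (forall x y, x \in h -> P (br x y)) -> forall v, P v.
Proof.
move=> sP Ph Pbr v.
suff H n (V : {vspace g}) : (\dim V < n)%N -> (h <= V)%VS ->
    (forall x w, x \in h -> w \in V -> br x w \in V) -> forall w, w \in V -> P w.
  apply: (H (\dim {:g}).+1 fullv) => //; rewrite ?subvf ?memvf // => *; exact: memvf.
elim: n V => // n IH V dV hV Vst.
(* Either all of h acts nilpotently on V and V = h, or some x does not. Then V splits under ad x
   into a smaller null part, still containing h, and generalised eigenvectors for nonzero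
   eigenvalues, which are in the image of ad x. *)
have [nil|] := pselect (forall x w, x \in h -> w \in V -> exists k, (ad x ^+ k) w = 0).
  by move=> w wV; apply: Ph; apply: (subvP (cartan_nil_eq hV Vst nil)).
move=> /existsNP[x /existsNP[w0 /not_implyP[xh /not_implyP[w0V nx]]]].
have [V0 V0P] : exists V0 : {vspace g}, forall w, w \in V0 <-> w \in V /\ gen (ad x) 0 w.
  apply: subspace_vspace; split; first by split; [exact: mem0v | case: (gen_subspace (ad x) 0)].
  by move=> k u w [uV gu] [wV gw]; split; [apply: (subspace_mem V).2 | apply: (gen_subspace _ _).2].
have hgen y : y \in h -> gen (ad x) 0 y.
  by move=> yh; have [k e] := cartan_ad_nil xh yh; exists k; rewrite scale0r subr0.
have PV0 w : w \in V0 -> P w.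
  apply: IH; last 2 first.
  - by apply/subvP => y yh; apply/V0P; split; [apply: (subvP hV) | apply: hgen].
  - move=> y z yh /V0P[zV gz]; apply/V0P; split; first exact: Vst.
    by rewrite -[0]addr0; apply: gen_br => //; apply: hgen.
  apply: (@leq_trans (\dim V)); last by [].
  rewrite ltn_neqAle dimvS ?andbT; last by apply/subvP => z /V0P[].
  apply/negP => /eqP e; apply: nx.
  have /eqP VE : V0 == V by rewrite eqEdim e leqnn andbT; apply/subvP => z /V0P[].
  have /V0P[_ [k]] : w0 \in V0 by rewrite VE.
  by rewrite scale0r subr0; exists k.
apply: (gen_ind (f := ad x) (subspace_mem V) (fin_span_vect _)).
- by move=> w wV; apply: Vst.
- by case: sP.
- by move=> u w; apply: subspaceD.
move=> c w wV gw; have [c0|c0] := eqVneq c 0.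
  by apply: PV0; apply/V0P; rewrite -c0.
have [z [_ _ <-]] := gen_inv (f := ad x) (subspace_mem V) (fun w wV => Vst x w xh wV) c0 wV gw.
by rewrite scale0r subr0; apply: Pbr.
Qed.

(* A central element t of h lying in [h, h] has trace zero on each of its
   generalised eigenspaces, hence is nilpotent and orthogonal to h + [h, g]. *)
Lemma cartan_abelian : (forall t, t \in bracket_space br h h -> (forall z, B t z = 0) -> t = 0) ->
  forall x y, x \in h -> y \in h -> br x y = 0.
Proof.
move=> nd; have [_ [k hk] _] := h_cartan.
suff C1 : central_series br h 1 = 0%VS.
  by move=> x y xh yh; apply/eqP; rewrite -memv0 -C1; apply: mem_bracket.
have : central_series br h k.+1 = 0%VS.
  apply/eqP; rewrite /= hk -subv0; apply/subvP; apply: bracket_ind => [|x y _].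
    exact: subspace_mem.
  by rewrite !memv0 => /eqP ->; rewrite linear0r.
(* Here the term of index k + 2 vanishes, so an element t of the term k + 1 commutes with h; it also
   lies in [h, h]. *)
elim: k {hk} => // k IH hk; apply: IH; apply/eqP; rewrite -subv0; apply/subvP => t tC.
have th : t \in h by apply: (subvP (central_series_sub k.+1)).
have tz x : x \in h -> br x t = 0.
  by move=> xh; apply/eqP; rewrite -memv0 -hk; apply: mem_bracket.
have thh : t \in bracket_space br h h.
  by apply: (subvP _ _ tC); apply: bracketS (subvv _) (central_series_sub k).
have [r [rh tE]] := bracket_sum thh.
have tnil v : gen (ad t) 0 v.
  apply: (@gen_ind _ _ (fun=> True) (ad t)) => //; first exact: fin_span_vect.
  - by case: (gen_subspace (ad t) 0).
  - by move=> u w; apply: subspaceD; apply: gen_subspace.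
  move=> c w _ gw; have [->|w0] := eqVneq w 0; first by case: (gen_subspace (ad t) 0).
  have [U UP] := subspace_vspace (gen_subspace (ad t) c).
  have st x v' : v' \in U -> x \in h -> br x v' \in U.
    move=> /UP gv xh; apply/UP; apply: (gen_comm (g := ad x)) gv.
    by apply: (actE_comm (ad_lie_module g_lie)); rewrite brC // tz // oppr0.
  (* [commutator_gen_eq0] asks for stability at every index, so entries outside h are replaced by
     0. *)
  pose h' x := if x \in h then x else 0.
  have h'h x : h' x \in h by rewrite /h'; case: ifP => // _; rewrite mem0v.
  suff c0 : c = 0 by rewrite -c0.
  apply: (@commutator_gen_eq0 _ _ U _ r (fun p => ad (h' p.1)) (fun p => ad (h' p.2)) c w) => //.
  - by move=> i v' v'U; apply: st.
  - by move=> i v' v'U; apply: st.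
  - move=> v' /UP; suff -> : \sum_(i <- r) (ad (h' i.1) * ad (h' i.2) - ad (h' i.2) * ad (h' i.1)) = ad t by [].
    apply: endoP => z; rewrite endo_sumE /= tE linear_sumlz big_seq [RHS]big_seq.
    apply: eq_bigr => p /rh[p1 p2]; rewrite /h' p1 p2 /=.
    by rewrite jacobi_ad.
  - exact/UP.
have tx x : x \in h -> B t x = 0.
  by move=> xh; apply: killing_nil_eq0 => //; rewrite brC // tz // oppr0.
have sB : subspace (fun z => B t z = 0).
  split; first exact: killing0r.
  by move=> l u v e1 e2; rewrite killingDr killingZr e1 e2 mulr0 addr0.
have /nd -> // : forall z, B t z = 0; rewrite ?mem0v //.
apply: (cartan_fitting sB tx) => x y xh.
by rewrite -killing_inv // brC // tz // oppr0 killing0l.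
Qed.

End Cartan.
End LieStructure.

(** * Weights *)

Section Weights.
Variables (F : numClosedFieldType) (g : vectType F) (br : {bilinear g -> g -> g}).
Hypothesis g_lie : lie_bracket br.
Variable h : {vspace g}.
Hypothesis h_cartan : cartan br h.
Hypothesis h_abel : forall x y, x \in h -> y \in h -> br x y = 0.
Local Notation ad := (actE br).
Local Notation B := (killing br).
Local Notation weight := (weight h).
Implicit Types (x y z t : g) (al be : weight).

(** The projection onto h extends al to g and avoids a dependent argument; only the values on h are
    meaningful. *)
Definition ev al t : F := al (vsproj h t).

(** Generalised weight vectors of ad h; that they are true eigenvectors is only reached in
    [gw_eigen], once root spaces are lines. *)
Definition gw al v := forall t, t \in h -> gen (ad t) (ev al t) v.

Lemma evD al be t : ev (al + be) t = ev al t + ev be t.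
Proof. by rewrite /ev add_lfunE. Qed.
Lemma evN al t : ev (- al) t = - ev al t.
Proof. by rewrite /ev opp_lfunE. Qed.
Lemma ev0 t : ev 0 t = 0.
Proof. by rewrite /ev zero_lfunE. Qed.
Lemma ev_linear al k t s : ev al (k *: t + s) = k * ev al t + ev al s.
Proof. by rewrite /ev !linearP. Qed.
Lemma evt0 al : ev al 0 = 0.
Proof. by rewrite /ev !linear0. Qed.
Lemma evZ al k t : ev al (k *: t) = k * ev al t.
Proof. by rewrite -[_ *: _]addr0 ev_linear evt0 addr0. Qed.

Lemma ev_sum al I (r : seq I) (E : I -> g) : ev al (\sum_(i <- r) E i) = \sum_(i <- r) ev al (E i).
Proof. by rewrite /ev !linear_sum. Qed.

Lemma ev_neq0 al : al != 0 -> exists2 t, t \in h & ev al t != 0.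
Proof.
move=> a0; apply: contrapT => H; move/eqP: a0; apply; apply/lfunP => s.
rewrite zero_lfunE; apply/eqP/negPn/negP => as0; apply: H; exists (vsval s).
  exact: subvsP.
by rewrite /ev vsvalK.
Qed.

Lemma gw_subspace al : subspace (gw al).
Proof.
split; first by move=> t _; case: (gen_subspace (ad t) (ev al t)).
by move=> k u v gu gv t th; apply: (gen_subspace _ _).2; [apply: gu | apply: gv].
Qed.

Lemma gw_br al be x y : gw al x -> gw be y -> gw (al + be) (br x y).
Proof. by move=> gx gy t th; rewrite evD; apply: gen_br => //; [apply: gx | apply: gy]. Qed.

Lemma gw_uniq al be v : gw al v -> gw be v -> al != be -> v = 0.
Proof.
rewrite -subr_eq0 => ga gb /ev_neq0[t th]; rewrite evD evN subr_eq0.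
by apply: gen_uniq; [apply: ga | apply: gb].
Qed.

Lemma gw_h v : v \in h -> gw 0 v.
Proof. by move=> vh t th; apply: eigen_gen; rewrite ev0 scale0r /= h_abel. Qed.

(** h acts nilpotently on the generalised zero weight space, so [cartan_nil_eq] applies to it. *)
Lemma gw0_h v : gw 0 v -> v \in h.
Proof.
move=> gv; have [V VP] := subspace_vspace (gw_subspace 0).
apply: (subvP (cartan_nil_eq g_lie h_cartan _ _ _)); last by apply/VP.
- by apply/subvP => x /gw_h gx; apply/VP.
- by move=> x w xh /VP gw'; apply/VP; rewrite -[0]addr0; apply: gw_br => //; apply: gw_h.
- by move=> x w xh /VP /(_ x xh); rewrite ev0 => -[k]; rewrite scale0r subr0; exists k.
Qed.

Lemma gw_neq_h al v : gw al v -> v \in h -> al != 0 -> v = 0.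
Proof. by move=> ga /gw_h; apply: gw_uniq. Qed.

(** Generalised eigenvalues of commuting operators add ([gen_add]), so the values a i on a basis of
    h extend to a linear form. *)
Lemma gw_basis w (a : 'I_(\dim h) -> F) :
  (forall i : 'I_(\dim h), gen (ad (vbasis h)`_i) (a i) w) ->
  exists al, gw al w /\ forall i : 'I_(\dim h), ev al (vbasis h)`_i = a i.
Proof.
move=> ga.
have lin : linear (fun s : subvs_of h => \sum_i coord (vbasis h) i (vsval s) * a i : F^o).
  move=> k u v; rewrite scaler_sumr -big_split; apply: eq_bigr => i _.
  by rewrite (linearP vsval) linearP /= mulrDl -mulrA.
pose L : {linear subvs_of h -> F^o} := HB.pack (fun s : subvs_of h => \sum_i coord (vbasis h) i (vsval s) * a i : F^o) (GRing.isLinear.Build _ _ _ _ _ lin).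
have evE t : t \in h -> ev (linfun L) t = \sum_i coord (vbasis h) i t * a i.
  by move=> th; rewrite /ev lfunE /= vsprojK.
exists (linfun L); split; last first.
  move=> i; rewrite evE ?vbasis_mem ?mem_nth ?size_tuple // (bigD1 i) //=.
  rewrite big1 ?addr0 => [|j ji]; rewrite coord_free ?(basis_free (vbasisP _)) //.
    by rewrite eqxx mul1r.
  by rewrite eq_sym (negPf ji) mul0r.
move=> t th; rewrite evE // [in ad t](coord_vbasis th).
have vh (i : 'I_(\dim h)) : (vbasis h)`_i \in h by rewrite vbasis_mem ?mem_nth ?size_tuple.
elim: (index_enum _) => [|i r IH].
  by rewrite !big_nil; apply: eigen_gen; rewrite scale0r /= linear0l.
rewrite !big_cons actED actEZ; apply: gen_add IH; last exact: gen_scale.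
rewrite -actEZ; apply: (actE_comm (ad_lie_module g_lie)); apply: h_abel.
  exact: memvZ.
by apply: memv_suml => j _; apply: memvZ.
Qed.

Lemma gw_ind (U : {vspace g}) (P : g -> Prop) :
  (forall x v, x \in h -> v \in U -> br x v \in U) -> P 0 ->
  (forall u v, P u -> P v -> P (u + v)) ->
  (forall al v, v \in U -> gw al v -> P v) -> forall v, v \in U -> P v.
Proof.
move=> Ust P0 PD PW.
apply: (@joint_gen_ind _ _ (fun v => v \in U) [seq ad x | x <- vbasis h] P) => //.
- exact: subspace_mem.
- exact: fin_span_vect.
- by move=> _ /mapP[x /vbasis_mem xh ->] v; apply: Ust.
- move=> _ _ /mapP[x /vbasis_mem xh ->] /mapP[y /vbasis_mem yh ->].
  by apply: (actE_comm (ad_lie_module g_lie)); apply: h_abel.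
move=> w wU gx.
have /choice[a aP] (i : 'I_(\dim h)) : exists a, gen (ad (vbasis h)`_i) a w.
  by apply: gx; apply: map_f; rewrite mem_nth ?size_tuple.
by have [al [gal _]] := gw_basis aP; apply: PW gal.
Qed.

Lemma gw_ind_all (P : g -> Prop) : P 0 ->
  (forall u v, P u -> P v -> P (u + v)) -> (forall al v, gw al v -> P v) -> forall v, P v.
Proof.
move=> P0 PD PW v; apply: (@gw_ind fullv) => // [*|al w _|]; rewrite ?memvf //.
exact: PW.
Qed.

Lemma gw_br_h al v t : t \in h -> gw al v -> gw al (br t v).
Proof. by move=> th gv; rewrite -[al]add0r; apply: gw_br => //; apply: gw_h. Qed.

(** ad t is invertible on generalised weight vectors once al t is nonzero. This puts root vectors of
    a subalgebra containing h into its derived algebra. *)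
Lemma gw_bracket (E : g -> Prop) al t v : subspace E ->
  (forall x v, x \in h -> E v -> E (br x v)) -> t \in h -> ev al t != 0 ->
  E v -> gw al v -> exists w, [/\ E w, gw al w & v = br t w].
Proof.
move=> sE Est th at0 Ev gv; pose W w := E w /\ gw al w.
have sW : subspace W.
  split; first by split; [case: sE | case: (gw_subspace al)].
  by move=> k x y [Ex gx] [Ey gy]; split; [apply: sE.2 | apply: (gw_subspace al).2].
have Wst w : W w -> W (ad t w) by move=> [Ew gw']; split; [apply: Est | apply: gw_br_h].
have [w [[Ew gw'] _ <-]] := gen_inv sW Wst at0 (conj Ev gv) (gv t th).
by exists w; split=> //; rewrite scale0r subr0.
Qed.

Lemma killing_gw_eq0 al be x y : gw al x -> gw be y -> al + be != 0 -> B x y = 0.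
Proof.
move=> gx gy /ev_neq0[t th]; rewrite evD.
by apply: killing_gen_eq0 => //; [apply: gx | apply: gy].
Qed.

Lemma gw_ad_nil al x : gw al x -> al != 0 -> forall v, gen (ad x) 0 v.
Proof.
move=> gx a0; apply: gw_ind_all; first by case: (gen_subspace (ad x) 0).
  by move=> u v; apply: subspaceD; apply: gen_subspace.
move=> be v gv; have [t th at0] := ev_neq0 a0.
have [k xk] : exists k, (ad x ^+ k) v = 0.
  apply: (@shift_nilpotent _ _ (fun=> True) (ad t) (ad x) (ev al t) (ev be t)) => //.
  - exact: fin_span_vect.
  - by move=> c w gw'; rewrite addrC; apply: gen_br => //; apply: gx.
  - exact: gv.
by exists k; rewrite scale0r subr0.
Qed.

(** As al vanishes on z = [e, f], ad e and ad f preserve each generalised eigenspace of ad z. There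
    ad z is a commutator, of trace zero, so its only eigenvalue is zero. *)
Lemma gw_coroot_nil al e f : gw al e -> gw (- al) f -> ev al (br e f) = 0 ->
  forall v, gen (ad (br e f)) 0 v.
Proof.
move=> ge gf az; set z := br e f in az *.
have zh : z \in h by apply: gw0_h; rewrite -(subrr al); apply: gw_br.
move=> v0; apply: (@gen_ind _ _ (fun=> True) (ad z) (gen (ad z) 0)) => //; first exact: fin_span_vect.
- by case: (gen_subspace (ad z) 0).
- by move=> u v; apply: subspaceD; apply: gen_subspace.
move=> c w _ gcw; have [->|w0] := eqVneq w 0; first by case: (gen_subspace (ad z) 0).
suff c0 : c = 0 by rewrite -c0.
have [U UP] := subspace_vspace (gen_subspace (ad z) c).
have eU v : v \in U -> ad e v \in U.
  move=> /UP gv; apply/UP; rewrite -[c]add0r -az; apply: gen_br => //; exact: ge.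
have fU v : v \in U -> ad f v \in U.
  move=> /UP gv; apply/UP; rewrite -[c]add0r -[0]oppr0 -az -evN.
  by apply: gen_br => //; exact: gf.
apply: (@commutator_gen_eq0 _ _ U _ [:: tt] (fun=> ad e) (fun=> ad f) c w) => //.
  by move=> v /UP; rewrite big_seq1 -(actE_br (ad_lie_module g_lie)).
exact/UP.
Qed.

(** [engel_vector] for the operators ad x - al x, which commute and are nilpotent on generalised
    weight vectors. *)
Lemma eigenvector_exists (E : g -> Prop) al y : subspace E ->
  (forall x v, x \in h -> E v -> E (br x v)) -> (forall v, E v -> gw al v) ->
  E y -> y != 0 ->
  exists w, [/\ E w, w != 0 & forall t, t \in h -> br t w = ev al t *: w].
Proof.
move=> sE Est Egw Ey y0.
pose rho x := ad x - (ev al x)%:E.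
have rhoE x w : rho x w = br x w - ev al x *: w by [].
have [||||||w [Ew /eqP w0 rw]] := @engel_vector _ _ _ rho (fun v => v = 0) E (vbasis h) _ _ _ _ _ y Ey _.
- by split=> // k u v -> ->; rewrite scaler0 addr0.
- move=> q /vbasis_mem qh w Ew; rewrite rhoE; apply: subspaceB => //.
    exact: Est.
  exact: subspaceZ.
- by move=> q _ w ->; rewrite apply0.
- by move=> q /vbasis_mem qh w /Egw /(_ q qh).
- move=> s1 q s2 e p w ps1 _; have hb x : x \in s1 ++ q :: s2 -> x \in h.
    by move=> xs; apply: vbasis_mem; move: xs; rewrite -e.
  have ph : p \in h by apply: hb; rewrite mem_cat ps1.
  have qh : q \in h by apply: hb; rewrite mem_cat mem_head orbT.
  apply/eqP; rewrite subr_eq0 -!endoME; apply/eqP; congr (endo_fun _ w).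
  by apply: comm_shift; apply: (actE_comm (ad_lie_module g_lie)); apply: h_abel.
- by apply/eqP.
exists w; split=> // t th; apply/eqP; rewrite -subr_eq0; apply/eqP.
rewrite (coord_vbasis th) linear_sumlz.
suff -> : ev al (\sum_(i < \dim h) coord (vbasis h) i t *: (vbasis h)`_i) *: w =
  \sum_(i < \dim h) br (coord (vbasis h) i t *: (vbasis h)`_i) w by rewrite subrr.
rewrite ev_sum scaler_suml; apply: eq_bigr => i _.
rewrite evZ linearZl_LR /= -scalerA; congr (_ *: _).
apply/esym/eqP; rewrite -subr_eq0 -rhoE; apply/eqP; apply: rw.
by rewrite mem_nth ?size_tuple.
Qed.

End Weights.

(** * Borel subalgebras *)

Section Roots.
Variables (F : numClosedFieldType) (g : vectType F) (br : {bilinear g -> g -> g}).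
Hypothesis g_lie : lie_bracket br.
Variable h : {vspace g}.
Hypothesis h_cartan : cartan br h.
Local Notation ad := (actE br).
Local Notation B := (killing br).
Local Notation weight := (weight h).
Local Notation gw := (@gw F g br h).
Implicit Types (x y z t v w e : g) (al be : weight).

Section OneBorel.
Hypothesis h_abel : forall x y, x \in h -> y \in h -> br x y = 0.
Variable b : {vspace g}.
Hypotheses (b_borel : borel br b) (hb : (h <= b)%VS).
Local Notation U := (nilradical br b).

Lemma borel_subalgebra x y : x \in b -> y \in b -> br x y \in b.
Proof. by case: b_borel => + _ _; apply. Qed.

Lemma borel_solvable : solvable_lie br b. Proof. by case: b_borel. Qed.

Lemma mem_hb t : t \in h -> t \in b. Proof. exact: (subvP hb). Qed.

Lemma nilradical_sub x : x \in U -> x \in b.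
Proof.
move: x; apply: bracket_ind; first exact: subspace_mem.
by move=> x y; apply: borel_subalgebra.
Qed.

Lemma nilradical_br x y : x \in b -> y \in U -> br x y \in U.
Proof. by move=> xb /nilradical_sub; apply: mem_bracket. Qed.

Lemma nilradical_subalgebra x y : x \in U -> y \in U -> br x y \in U.
Proof. by move=> /nilradical_sub; apply: nilradical_br. Qed.

Lemma nilradical_solvable : solvable_lie br U.
Proof. by apply: solvableS borel_solvable; apply/subvP; apply: nilradical_sub. Qed.

Lemma borel_gw_nilradical al v : al != 0 -> v \in b -> gw al v -> v \in U.
Proof.
move=> /ev_neq0[t th at0] vb gv.
have [|w [wb _ ->]] := gw_bracket g_lie h_abel (subspace_mem b) _ th at0 vb gv.
  by move=> x w xh; apply: borel_subalgebra; apply: mem_hb.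
by apply: mem_bracket => //; apply: mem_hb.
Qed.

(** As U = [b, b], it suffices to treat z = [e, f] for weight vectors of b with opposite weights al
    and - al. If al z = 0, then z is ad-nilpotent and commutes with t. If not, z sits in a perfect
    subset of the solvable b, so z = 0. *)
Lemma nilradical_perp_h x t : x \in U -> t \in h -> B x t = 0.
Proof.
move=> + th; move: x; apply: bracket_ind; first exact: killing_orth_subspace.
have bst x v : x \in h -> v \in b -> br x v \in b.
  by move=> /mem_hb; apply: borel_subalgebra.
move=> e0 f0 + f0b; move: e0.
apply: (gw_ind g_lie h_abel bst) => [|u v|al e eb ge].
- by rewrite linear0l killing0l.
- by rewrite linearDl killingDl => -> ->; rewrite addr0.
move: f0 f0b; apply: (gw_ind g_lie h_abel bst) => [|u v|be f fb gf].
- by rewrite linear0r killing0l.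
- by rewrite linearDr killingDl => -> ->; rewrite addr0.
have gef := gw_br g_lie ge gf; have [ab0|ab0] := eqVneq (al + be) 0; last first.
  by apply: (killing_gw_eq0 g_lie gef (gw_h h_abel th)); rewrite addr0.
have beE : be = - al by rewrite (addr0_eq ab0).
rewrite beE in gf gef; rewrite subrr in gef.
set z := br e f in gef *; have zh : z \in h by apply: gw0_h gef.
have [az|az] := eqVneq (ev al z) 0.
  by apply: killing_nil_eq0; rewrite ?h_abel //; apply: gw_coroot_nil az.
have z0 : z = 0; last by rewrite z0 killing0l.
(* Root spaces are not yet known to be lines, so the analogue of an sl2-triple takes all weight
   vectors of b for al and - al, together with z. *)
pose X w := (w \in b /\ (gw al w \/ gw (- al) w)) \/ w = z.
apply: (perfect_in_solvable (X := X) borel_solvable); last by right.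
  by move=> w [[]//|->]; apply: borel_subalgebra.
move=> w [[wb [gv|gv]]|->].
- have [w' [w'b gw' ->]] := gw_bracket g_lie h_abel (subspace_mem b) bst zh az wb gv.
  by exists z, w'; split=> //; [right | left; split=> //; left].
- have az' : ev (- al) z != 0 by rewrite evN oppr_eq0.
  have [w' [w'b gw' ->]] := gw_bracket g_lie h_abel (subspace_mem b) bst zh az' wb gv.
  by exists z, w'; split=> //; [right | left; split=> //; right].
- by exists e, f; split=> //; left; split=> //; [left | right].
Qed.

Lemma borel_decomp v : v \in b -> exists t x, [/\ t \in h, x \in U & v = t + x].
Proof.
move: v; apply: (gw_ind g_lie h_abel).
- by move=> x v /mem_hb; apply: borel_subalgebra.
- by exists 0, 0; rewrite !mem0v addr0.
- move=> _ _ [t [x [th xU ->]]] [t' [x' [th' xU' ->]]].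
  by exists (t + t'), (x + x'); rewrite !memvD // addrACA.
move=> al v vb gv; have [a0|a0] := eqVneq al 0.
  rewrite a0 in gv; exists v, 0; rewrite mem0v addr0; split=> //.
  exact: gw0_h gv.
by exists 0, v; rewrite mem0v add0r; split=> //; apply: borel_gw_nilradical gv.
Qed.

Hypothesis U_nd : forall x, x \in U -> (forall z, B x z = 0) -> x = 0.

Lemma nilradical_cap_h x : x \in U -> x \in h -> x = 0.
Proof.
move=> xU xh; apply: U_nd => // z; move: z.
apply: (gw_ind_all g_lie h_abel) => [|u v|al v gv]; first exact: killing0r.
  by rewrite killingDr => -> ->; rewrite addr0.
have [a0|a0] := eqVneq al 0.
  by rewrite a0 in gv; apply: nilradical_perp_h => //; apply: gw0_h gv.
by apply: (killing_gw_eq0 g_lie (gw_h h_abel xh) gv); rewrite add0r.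
Qed.

Lemma nilradical_st t v : t \in h -> v \in U -> br t v \in U.
Proof. by move=> /mem_hb; apply: nilradical_br. Qed.

Lemma nilradical_gw0 x : x \in U -> gw 0 x -> x = 0.
Proof. by move=> xU gx; apply: nilradical_cap_h => //; exact: (gw0_h g_lie h_cartan h_abel gx). Qed.

Lemma nilradical_chain : exists s, [/\ lie_chain br s,
  {in s, forall x, x \in U /\ exists al, gw al x} & (U <= <<s>>)%VS].
Proof.
have [||s [cs sS Us]] := engel_chain g_lie (S := fun x => x \in U /\ exists al, gw al x).
- move=> x y [xU [al gx]] [yU [be gy]]; split; last by exists (al + be); apply: gw_br.
  exact: nilradical_subalgebra.
- move=> x y [xU [al gx]] _; have [a0|a0] := eqVneq al 0.
    by rewrite a0 in gx; exists 1%N; rewrite expr1 /= (nilradical_gw0 xU gx) linear0l.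
  by have [k] := gw_ad_nil g_lie h_abel gx a0 y; rewrite scale0r subr0; exists k.
exists s; split=> //; apply/subvP; apply: (gw_ind g_lie h_abel).
- exact: nilradical_st.
- exact: mem0v.
- by move=> u v; apply: memvD.
- by move=> al v vU gv; apply: Us; split=> //; exists al.
Qed.

Lemma nilradical_ad_nil x al : x \in U -> gw al x -> forall v, exists k, (ad x ^+ k) v = 0.
Proof.
move=> xU gx v; have [a0|a0] := eqVneq al 0.
  by rewrite a0 in gx; exists 1%N; rewrite expr1 /= (nilradical_gw0 xU gx) linear0l.
by have [k] := gw_ad_nil g_lie h_abel gx a0 v; rewrite scale0r subr0; exists k.
Qed.

(* Engel's theorem for the nilradical acting on g / b. *)
Lemma borel_extend (Q : g -> Prop) :
  (forall x be w, x \in U -> gw be x -> Q w -> Q (br x w)) ->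
  (forall w, Q w -> w \in b) \/
  exists w, [/\ Q w, w \notin b & forall x, x \in U -> br x w \in b].
Proof.
move=> Qst; have [Qb|] := pselect (forall w, Q w -> w \in b); first by left.
move=> /existsNP[w /not_implyP[Qw wb]]; right; have [s [cs sU Us]] := nilradical_chain.
have [|||w' [Qw' w'b sw']] := @engel_module _ _ _ _ br s (fun y => y \in b) Q
  (ad_lie_module g_lie) cs (subspace_mem _) _ _ _ w Qw wb.
- by move=> q /sU[qU [be gq]] v; apply: Qst gq.
- by move=> q /sU[/nilradical_sub qb _] v; apply: borel_subalgebra.
- move=> q /sU[qU [be gq]] v _; have [k e] := nilradical_ad_nil qU gq v.
  by exists k; rewrite e mem0v.
by exists w'; split=> //; [apply/negP | move=> x xU; apply: sw'; apply: (subvP Us)].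
Qed.

Lemma borel_line_bracket c al x : (U <= c)%VS -> (forall t, t \in h -> br t x = ev al t *: x) ->
  (forall e, e \in U -> br e x \in c) ->
  (bracket_space br (b + <[x]>) (b + <[x]>) <= c + <[x]>)%VS.
Proof.
move=> Uc xe xc; apply: (bracket_line_sub g_lie) => [y z yb zb|a].
  by apply: (subvP (addvSl _ _)); apply: (subvP Uc); apply: mem_bracket.
move=> /borel_decomp[t [e [th eU ->]]]; rewrite linearDl /= xe // addrC.
by apply: memv_add; [apply: xc | apply: memvZ; apply: memv_line].
Qed.

(** b + <[x]> is a subalgebra, since h scales x and U maps it into b; maximality of b does the
    rest. *)
Lemma borel_extend_line al x : (forall t, t \in h -> br t x = ev al t *: x) ->
  (forall e, e \in U -> br e x \in b) ->
  solvable_lie br (b + <[x]>)%VS -> x \in b.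
Proof.
move=> xe xU sol; have [_ _ bmax] := b_borel.
suff <- : (b + <[x]>)%VS = b by apply: (subvP (addvSr _ _)); apply: memv_line.
apply: bmax => //; last exact: addvSl.
have Ub : (U <= b)%VS by apply/subvP; apply: nilradical_sub.
by move=> y z yb zb; apply: (subvP (borel_line_bracket Ub xe xU)); apply: mem_bracket.
Qed.

End OneBorel.
End Roots.

(** * Root spaces *)

Section RootSpaces.
Variables (F : numClosedFieldType) (g : vectType F) (br : {bilinear g -> g -> g}).
Hypothesis g_lie : lie_bracket br.
Variable h : {vspace g}.
Hypothesis h_cartan : cartan br h.
Local Notation ad := (actE br).
Local Notation B := (killing br).
Local Notation weight := (weight h).
Local Notation gw := (@gw F g br h).
Implicit Types (x y z t v w e f : g) (al be : weight).
Hypothesis h_abel : forall x y, x \in h -> y \in h -> br x y = 0.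
Variable b : {vspace g}.
Hypotheses (b_borel : borel br b) (hb : (h <= b)%VS).
Local Notation U := (nilradical br b).
Hypothesis U_nd : forall x, x \in U -> (forall z, B x z = 0) -> x = 0.

Let mem_h := gw0_h g_lie h_cartan h_abel.
Let k x := forall z, B x z = 0.

Lemma killing_rad_subspace : subspace k.
Proof.
split; first by move=> z; apply: killing0l.
by move=> c u v ku kv z; rewrite killingDl killingZl ku kv mulr0 addr0.
Qed.

Lemma killing_rad_ideal x y : k y -> k (br x y).
Proof. by move=> ky z; rewrite brC // killingNl killing_inv // ky oppr0. Qed.

(** Components of nonzero weight lie in U, where the radical of the Killing form is trivial. *)
Lemma killing_rad_borel x : k x -> x \in b -> x \in h.
Proof.
move=> kx xb; have [V VP] : exists V : {vspace g}, forall w, w \in V <-> k w /\ w \in b.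
  apply: subspace_vspace; split; first by split; [case: killing_rad_subspace | exact: mem0v].
  by move=> c u v [ku ub] [kv vb]; split; [apply: killing_rad_subspace.2 | apply: (subspace_mem b).2].
have Vst t v : t \in h -> v \in V -> br t v \in V.
  move=> th /VP[kv vb]; apply/VP; split; first exact: killing_rad_ideal.
  by apply: (borel_subalgebra b_borel) => //; apply: (mem_hb hb).
have : x \in V by apply/VP.
move: {kx xb} x; apply: (gw_ind g_lie h_abel Vst); first exact: mem0v.
  by move=> u v; apply: memvD.
move=> al v /VP[kv vb] gv; have [a0|a0] := eqVneq al 0.
  by rewrite a0 in gv; apply: gw0_h gv.
have vU : v \in U by apply: borel_gw_nilradical gv.
by rewrite (U_nd vU kv) mem0v.
Qed.

Lemma killing_rad_nilradical x e : k x -> x \in h -> e \in U -> br x e = 0.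
Proof.
move=> kx xh eU; apply: U_nd; first by apply: nilradical_br => //; apply: (mem_hb hb).
by move=> z; rewrite killing_inv // kx.
Qed.

(** Otherwise [borel_extend], applied to weight vectors of the radical, leads to an h-eigenvector x
    != 0 of nonzero weight in the radical with [U, x] in b. Once b + <[x]> is shown solvable, x lies
    in b, hence in h, against its weight. *)
Lemma killing_rad_sub_borel x : k x -> x \in b.
Proof.
have [K KP] := subspace_vspace killing_rad_subspace.
move/KP; move: x; apply: (gw_ind g_lie h_abel).
- by move=> t v _ /KP kv; apply/KP; apply: killing_rad_ideal.
- exact: mem0v.
- by move=> u v; apply: memvD.
move=> ga v0 /KP kv0 gv0.
have kst t v : t \in h -> k v -> k (br t v) by move=> _; apply: killing_rad_ideal.
have Qst x be w : x \in U -> gw be x -> k w /\ (exists al, gw al w) ->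
    k (br x w) /\ exists al, gw al (br x w).
  by move=> _ gx [kw [al gw']]; split; [apply: killing_rad_ideal | exists (be + al); apply: gw_br].
have [Q|[w [Qw wb Uw]]] := borel_extend g_lie h_cartan h_abel b_borel hb U_nd Qst.
  by apply: Q; split=> //; exists ga.
case: Qw => kw [al gw'].
have a0 : al != 0.
  by apply: contraNneq wb => al0; rewrite al0 in gw'; apply: (mem_hb hb); apply: (mem_h gw').
pose E v := [/\ k v, gw al v & forall e, e \in U -> br e v \in b].
have sE : subspace E.
  split.
    by split; [case: killing_rad_subspace | case: (gw_subspace br al) | move=> e _; rewrite linear0r mem0v].
  move=> c u v [ku gu Uu] [kv gv Uv]; split.
  - exact: killing_rad_subspace.2.
  - exact: (gw_subspace br al).2.
  - by move=> e eU; rewrite linearDr /= linearZr_LR; apply: memvD; [apply: memvZ; apply: Uu | apply: Uv].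
have Est t v : t \in h -> E v -> E (br t v).
  move=> th [kv gv Uv]; split; [exact: killing_rad_ideal | exact: gw_br_h | move=> e eU].
  rewrite (jacobi g_lie); apply: memvD.
    by apply: Uv; apply: mem_bracket; [apply: (nilradical_sub b_borel) | apply: (mem_hb hb)].
  by apply: (borel_subalgebra b_borel); [apply: (mem_hb hb) | apply: Uv].
have w0 : w != 0 by apply: contraNneq wb => ->; rewrite mem0v.
have Egw v : E v -> gw al v by case.
have [x [[kx gx Ux] x0 xe]] := eigenvector_exists g_lie h_abel sE Est Egw (And3 kw gw' Uw) w0.
exfalso; move/negP: x0; apply; apply/eqP.
apply: (gw_neq_h h_abel gx) => //; apply: killing_rad_borel => //.
apply: (borel_extend_line g_lie h_cartan h_abel b_borel hb xe Ux).
have Uxh e : e \in U -> br e x \in h.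
  by move=> eU; apply: killing_rad_borel; [apply: killing_rad_ideal | apply: Ux].
(* Elements of the radical in h kill U. For e of weight - al this gives al [e, x] = 0, since [e, x]
   has generalised eigenvalue - al [e, x] on e; for other weights [e, x] itself is zero. *)
have Uxa e : e \in U -> ev al (br e x) = 0.
  move: e; apply: (gw_ind g_lie h_abel).
  - by move=> t v th vU; apply: nilradical_br => //; apply: (mem_hb hb).
  - by rewrite linear0l evt0.
  - by move=> u v e1 e2; rewrite linearDl -[br u x]scale1r ev_linear e1 e2 mulr0 addr0.
  move=> de e eU ge; set z := br e x.
  have gz : gw (de + al) z by apply: gw_br.
  have [da|da] := eqVneq (de + al) 0; last first.
    by rewrite (gw_neq_h h_abel gz (Uxh e eU) da) evt0.
  have [e0|e0] := eqVneq e 0; first by rewrite /z e0 linear0l evt0.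
  have zh : z \in h by apply: Uxh.
  have ze : ad z e = 0 *: e.
    by rewrite scale0r; apply: killing_rad_nilradical => //; apply: killing_rad_ideal.
  have deE : de = - al by apply/eqP; rewrite -addr_eq0 da.
  apply/eqP; move/eqP: e0; apply: contra_notT => az.
  by apply: (gen_eigen (ge z zh) ze); rewrite deE evN oppr_eq0.
(* Z contains [U, x] and commutes with U, with x and with itself. So the first three derived
   algebras of b + <[x]> lie in U + Z + <[x]>, in U + Z and in U. *)
have [Z ZP] : exists Z : {vspace g}, forall z, z \in Z <-> [/\ k z, z \in h & ev al z = 0].
  apply: subspace_vspace; split; first by split; [case: killing_rad_subspace | exact: mem0v | exact: evt0].
  move=> c u v [ku uh ua] [kv vh va]; split; first exact: killing_rad_subspace.2.
    exact: (subspace_mem h).2.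
  by rewrite ev_linear ua va mulr0 addr0.
have ZU z e : z \in Z -> e \in U -> br z e = 0.
  by move=> /ZP[kz zh _] eU; apply: killing_rad_nilradical.
have Zx z : z \in Z -> br z x = 0.
  by move=> /ZP[_ zh za]; rewrite xe // za scale0r.
have ZZ z z' : z \in Z -> z' \in Z -> br z z' = 0.
  by move=> /ZP[_ zh _] /ZP[_ zh' _]; apply: h_abel.
have UxZ e : e \in U -> br e x \in Z.
  by move=> eU; apply/ZP; split; [apply: killing_rad_ideal | apply: Uxh | apply: Uxa].
have WW y z : y \in (U + Z)%VS -> z \in (U + Z)%VS -> br y z \in U.
  move=> /memv_addP[e eU [c cZ ->]] /memv_addP[e' eU' [c' cZ' ->]].
  rewrite linearDl /= !linearDr /= (ZU _ _ cZ eU') (ZZ _ _ cZ cZ') [br e c'](brC g_lie) (ZU _ _ cZ' eU) oppr0 !addr0.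
  exact: (nilradical_subalgebra b_borel).
have UW : (U <= U + Z)%VS by apply: addvSl.
have ZW : (Z <= U + Z)%VS by apply: addvSr.
have D1 : (bracket_space br (b + <[x]>) (b + <[x]>) <= U + Z + <[x]>)%VS.
  apply: (borel_line_bracket g_lie h_cartan h_abel b_borel hb UW xe) => e eU.
  by apply: (subvP ZW); apply: UxZ.
have D2 : (bracket_space br (U + Z + <[x]>) (U + Z + <[x]>) <= U + Z)%VS.
  apply: (bracket_line_sub g_lie) => [y z yW zW|_ /memv_addP[e eU [z zZ ->]]].
    by apply: (subvP UW); apply: WW.
  by rewrite linearDl /= (Zx _ zZ) addr0; apply: (subvP ZW); apply: UxZ.
have D3 : (bracket_space br (U + Z) (U + Z) <= U)%VS.
  by apply/subvP; apply: bracket_ind; [apply: subspace_mem | apply: WW].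
apply: (@solvable_derived _ _ br _ 3); apply: solvableS (nilradical_solvable b_borel).
apply: (subv_trans _ D3); apply: bracketS; apply: (subv_trans _ D2); apply: bracketS; exact: D1.
Qed.

(** The radical lies in b, hence in h. The bracket of x with a vector of nonzero weight is again in
    the radical, thus in h, and so it vanishes. *)
Lemma killing_rad_center x : k x -> x \in h /\ forall v, br x v = 0.
Proof.
move=> kx; have xh : x \in h by apply: killing_rad_borel => //; apply: killing_rad_sub_borel.
split=> // v; move: v; apply: (gw_ind_all g_lie h_abel).
- exact: linear0r.
- by move=> u v e1 e2; rewrite linearDr /= e1 e2 addr0.
move=> al v gv; have [a0|a0] := eqVneq al 0.
  by apply: h_abel => //; rewrite a0 in gv; apply: gw0_h gv.
have kxv : k (br x v) by rewrite brC // => z; rewrite killingNl killing_rad_ideal // oppr0.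
apply: (gw_neq_h h_abel (gw_br_h g_lie h_abel xh gv)) => //.
by apply: killing_rad_borel => //; apply: killing_rad_sub_borel.
Qed.

(** A weight vector pairing trivially with the opposite weight space is in the radical of B, hence
    in h, which excludes nonzero weights. *)
Lemma killing_gw_dual al x : al != 0 -> gw al x -> x != 0 ->
  exists z, gw (- al) z /\ B x z = 1.
Proof.
move=> a0 gx x0; apply: contrapT => H.
have kx : k x.
  move=> z; move: z; apply: (gw_ind_all g_lie h_abel) => [|u v|be v gv]; first exact: killing0r.
    by rewrite killingDr => -> ->; rewrite addr0.
  have [ab|ab] := eqVneq (al + be) 0; last exact: (killing_gw_eq0 g_lie gx gv ab).
  have beE : be = - al by rewrite (addr0_eq ab).
  apply/eqP/negPn/negP => Bxv; apply: H; exists ((B x v)^-1 *: v); split.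
    by rewrite -beE; apply: subspaceZ (gw_subspace br _) _.
  by rewrite killingZr mulVf.
by move/eqP: x0; apply; apply: (gw_neq_h h_abel gx) => //; case: (killing_rad_center kx).
Qed.

Lemma killing_coroot al x z t : (forall t, t \in h -> br t x = ev al t *: x) ->
  t \in h -> B (br x z) t = ev al t * B x z.
Proof. by move=> xe th; rewrite killingC // -killing_inv // xe // killingZl. Qed.

(** If al vanished on the coroot [x, z], the coroot would be ad-nilpotent and orthogonal to h,
    whereas its pairing with t is al t. *)
Lemma coroot_neq0 al x z : al != 0 -> (forall t, t \in h -> br t x = ev al t *: x) ->
  gw (- al) z -> B x z = 1 -> ev al (br x z) != 0.
Proof.
move=> a0 xe gz xz; apply/negP => /eqP az.
have gx : gw al x by move=> t th; apply: eigen_gen; apply: xe.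
have [t th /negP[]] := ev_neq0 a0; apply/eqP.
rewrite -[LHS]mulr1 -xz -(killing_coroot _ xe th).
apply: killing_nil_eq0 => //; last by apply: gw_coroot_nil az.
by apply: h_abel => //; apply: mem_h; rewrite -(subrr al); apply: gw_br.
Qed.

(* The eigenvalues of the neutral element of an sl2-triple (X, T, Z) on the
   kernel of X (modulo the centre) are nonnegative integers. *)
Lemma coroot_kernel al x z w : al != 0 -> (forall t, t \in h -> br t x = ev al t *: x) ->
  gw (- al) z -> B x z = 1 -> gw (- al) w -> B x w = 0 -> w = 0.
Proof.
move=> a0 xe gz xz gw0 xw0; have gx : gw al x by move=> t th; apply: eigen_gen; apply: xe.
have t0h : br x z \in h.
  by apply: mem_h; rewrite -(subrr al); apply: gw_br.
(* Normalised so that [t, x] = 2 x and (x, t, z') behaves as an sl2-triple. *)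
set c := 2%:R / ev al (br x z); pose t := c *: br x z; pose z' := c *: z.
have ta : ev al t = 2%:R by rewrite evZ divfK //; apply: coroot_neq0 gz xz.
have th : t \in h by apply: memvZ.
have xz' : br x z' = t by rewrite linearZr_LR.
have tx : br t x = 2%:R *: x by rewrite xe // ta.
have [K XK] := endo_nilpotent (gw_ad_nil g_lie h_abel gx a0).
have swap n u : br t ((ad x ^+ n) u) = (ad x ^+ n) (br t u) + (2 * n)%:R *: (ad x ^+ n) u.
  elim: n u => [|n IHn] u; first by rewrite muln0 scale0r addr0.
  rewrite !endoXSr /= IHn (jacobi g_lie t x) tx linearZl_LR applyD applyZ.
  by rewrite [2%:R *: _ + _]addrC -addrA -scalerDl -natrD mulnS.
have triple m v : br z' ((ad x ^+ m.+1) v) =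
    (ad x ^+ m.+1) (br z' v) - m.+1%:R *: (br t ((ad x ^+ m) v) - m%:R *: (ad x ^+ m) v).
  elim: m v => [|m IH] v.
    rewrite !expr1 expr0 !scale1r scale0r subr0 /= (jacobi g_lie z' x) [br z' x](brC g_lie) xz'.
    by rewrite linearNl addrC.
  rewrite endoXSr IH [br z' _](jacobi g_lie z' x) [br z' x](brC g_lie) xz' linearNl applyD applyN.
  rewrite -!endoXSr addrC addrA; have := swap m.+1 v; set P := (ad x ^+ m.+1) v => /eqP.
  rewrite -subr_eq => /eqP <-; rewrite addrC -opprD; congr (_ - _).
  rewrite !scalerBr !scalerA addrACA -opprD -{2}[br t P]scale1r -!scalerDl.
  by rewrite natr1 -!natrM -natrD [(_ * m)%N]mulnC -mulnDl addn2.
(* Induction on d, with n + d at least K, over vectors u = (ad x)^n v. As [x, u] is central, the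
   relation [triple] exhibits [t, u] - n u as an image of (ad x)^(n + 1), zero by induction. So t
   has eigenvalue n >= 0 on u, while the weight of u gives - 2. *)
suff H d n u v : (K <= n + d)%N -> u = (ad x ^+ n) v -> gw (- al) u -> B x u = 0 -> u = 0.
  by apply: (H K 0%N w w).
elim: d n u v => [|d IH] n u v.
  by rewrite addn0 => /subnK <- -> _ _; rewrite exprD XK mulr0.
rewrite addnS -addSn => Kn uE gu xu.
have gxu : gw 0 (br x u) by rewrite -(subrr al); apply: gw_br.
have kxu : k (br x u).
  move=> s; move: s; apply: (gw_ind_all g_lie h_abel) => [|s1 s2|be s gs].
  - exact: killing0r.
  - by rewrite killingDr => -> ->; rewrite addr0.
  have [be0|be0] := eqVneq be 0; last by apply: (killing_gw_eq0 g_lie gxu gs); rewrite add0r.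
  rewrite be0 in gs; rewrite (killing_coroot _ xe) ?xu ?mulr0 //.
  exact: (mem_h gs).
have [_ cxu] := killing_rad_center kxu.
have := triple n v; rewrite endoXS -uE /= [br z' _](brC g_lie) cxu oppr0.
move/esym/eqP; rewrite subr_eq0 => /eqP e.
have u0 : br t u - n%:R *: u = 0.
  apply: (IH n.+1 _ (n.+1%:R^-1 *: br z' v)) => //.
  - by rewrite applyZ e scalerA mulVf ?pnatr_eq0 // scale1r.
  - by apply: subspaceB (gw_subspace br _) _ _; [apply: gw_br_h | apply: subspaceZ gu; apply: gw_subspace].
  rewrite -scaleN1r addrC killingDr !killingZr xu !mulr0 add0r.
  by rewrite -(killing_inv g_lie) [br x t](brC g_lie) tx killingNl killingZl xu mulr0 oppr0.
move/eqP: u0; rewrite subr_eq0 => /eqP u0.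
apply: (gen_eigen (gu t th) (b := n%:R) u0); rewrite evN ta.
by rewrite -subr_eq0 -opprD oppr_eq0 -natrD pnatr_eq0.
Qed.

(** Take an h-eigenvector f of weight - al and z of weight al with B f z = 1. For w of weight al, w
    - B f w *: z is orthogonal to f and vanishes by [coroot_kernel] for - al, so z spans the root
    space. *)
Lemma gw_dim1 al x y : al != 0 -> gw al x -> x != 0 -> gw al y -> exists c, y = c *: x.
Proof.
move=> a0 gx x0 gy; have [z0 [gz0 xz0]] := killing_gw_dual a0 gx x0.
have z00 : z0 != 0 by apply: killing1_neq0 xz0.
have na0 : - al != 0 by rewrite oppr_eq0.
have [|f [gf f0 fe]] := eigenvector_exists g_lie h_abel (gw_subspace br (- al)) _ (fun _ => id) gz0 z00.
  by move=> t v; apply: gw_br_h.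
have [z [gz fz]] := killing_gw_dual na0 gf f0.
have line w : gw al w -> w = B f w *: z.
  move=> gw'; apply/eqP; rewrite -subr_eq0; apply/eqP.
  apply: (coroot_kernel na0 fe gz fz).
    rewrite opprK; rewrite opprK in gz.
    by apply: subspaceB (gw_subspace br _) gw' _; apply: subspaceZ gz; apply: gw_subspace.
  by rewrite -scaleN1r killingDr !killingZr fz mulr1 mulN1r subrr.
have xE := line x gx; have yE := line y gy.
exists (B f y / B f x); transitivity ((B f y / B f x) *: (B f x *: z)); last by rewrite -xE.
rewrite scalerA divfK -?yE //.
by apply: contraNneq x0 => e; rewrite xE e scale0r.
Qed.

Lemma gw_eigen al x : gw al x -> forall t, t \in h -> br t x = ev al t *: x.
Proof.
move=> gx t th; have [a0|a0] := eqVneq al 0.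
  rewrite a0 ev0 scale0r in gx *; apply: h_abel => //.
  exact: (mem_h gx).
have [->|x0] := eqVneq x 0; first by rewrite linear0r scaler0.
have [|w [gw' w0 we]] := eigenvector_exists g_lie h_abel (gw_subspace br al) _ (fun _ => id) gx x0.
  by move=> s v; apply: gw_br_h.
have [c ->] := gw_dim1 a0 gw' w0 gx.
by rewrite linearZr_LR /= we // !scalerA mulrC.
Qed.

Lemma gw_coroot_neq0 al x z : al != 0 -> gw al x -> gw (- al) z -> B x z != 0 ->
  ev al (br x z) != 0.
Proof.
move=> a0 gx gz xz; have := coroot_neq0 a0 (gw_eigen gx) (z := (B x z)^-1 *: z).
rewrite killingZr linearZr_LR /= evZ mulVf // mulf_eq0 negb_or => H.
by have /andP[] := H (subspaceZ _ (gw_subspace br _) gz) erefl.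
Qed.

Lemma gw_killing_neq0 al x z : al != 0 -> gw al x -> gw (- al) z -> x != 0 -> z != 0 ->
  B x z != 0.
Proof.
move=> a0 gx gz x0 z0; have [z1 [gz1 xz1]] := killing_gw_dual a0 gx x0.
have na0 : - al != 0 by rewrite oppr_eq0.
have [c zE] := gw_dim1 na0 gz z0 gz1.
by apply: contra_eq_neq xz1 => xz; rewrite zE killingZr xz mulr0 eq_sym oner_eq0.
Qed.

Lemma gw_line_sub (V : {vspace g}) al x : al != 0 -> gw al x -> x != 0 -> x \in V ->
  forall y, gw al y -> y \in V.
Proof. by move=> a0 gx x0 xV y gy; have [c ->] := gw_dim1 a0 gx x0 gy; apply: memvZ. Qed.

Variable b' : {vspace g}.
Hypotheses (b'_borel : borel br b') (hb' : (h <= b')%VS).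
Local Notation U' := (nilradical br b').
Hypothesis UU' : forall x, x \in U -> (forall z, z \in U' -> B x z = 0) -> x = 0.
Hypothesis U'U : forall z, z \in U' -> (forall x, x \in U -> B x z = 0) -> z = 0.

Lemma gw_pairing_mem (V : {vspace g}) al x y : al != 0 -> gw al x -> gw (- al) y ->
  (forall t v, t \in h -> v \in V -> br t v \in V) -> ~ (forall z, z \in V -> B x z = 0) -> y \in V.
Proof.
move=> a0 gx gy Vst xV; apply: contrapT => yV; apply: xV; apply: (gw_ind g_lie h_abel Vst).
- exact: killing0r.
- by move=> u v e1 e2; rewrite killingDr e1 e2 addr0.
move=> be v vV gv; have [ab|ab] := eqVneq (al + be) 0; last exact: (killing_gw_eq0 g_lie gx gv ab).
rewrite -(addr0_eq ab) in gv; have [->|v0] := eqVneq v 0; first exact: killing0r.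
by case: yV; apply: (gw_line_sub _ gv v0 vV gy); rewrite oppr_eq0.
Qed.

Lemma gw_opposite al x y : al != 0 -> gw al x -> x != 0 -> x \in U -> gw (- al) y -> y \in U'.
Proof.
move=> a0 gx /eqP x0 xU gy; apply: (gw_pairing_mem a0 gx gy) => [t v|/(UU' xU)//].
exact: nilradical_st.
Qed.

Lemma gw_opposite' al x y : al != 0 -> gw al x -> x != 0 -> x \in U' -> gw (- al) y -> y \in U.
Proof.
move=> a0 gx /eqP x0 xU gy; apply: (gw_pairing_mem a0 gx gy) => [t v|xU0].
  exact: nilradical_st.
by apply: x0; apply: U'U => // z zU; rewrite killingC xU0.
Qed.

(** Otherwise [x, y] lies in both U and h, hence vanishes, although al is nonzero on it. *)
Lemma nilradical_antisym al x y : al != 0 -> gw al x -> x != 0 -> x \in U ->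
  gw (- al) y -> y \in U -> y = 0.
Proof.
move=> a0 gx x0 xU gy yU; apply/eqP/negPn/negP => y0.
have xy := gw_killing_neq0 a0 gx gy x0 y0.
have := gw_coroot_neq0 a0 gx gy xy.
rewrite (@nilradical_cap_h _ _ _ g_lie _ h_cartan h_abel _ b_borel hb U_nd (br x y)) ?evt0 ?eqxx //.
  exact: (nilradical_subalgebra b_borel).
by apply: mem_h; rewrite -(subrr al); apply: gw_br.
Qed.

(** The roots to be ruled out: neither al nor - al is a root of U. *)
Let outside al x := [/\ al != 0, gw al x, x != 0,
  ~ (forall y, gw al y -> y \in U) & ~ (forall y, gw (- al) y -> y \in U)].

Lemma outside_weight al be e x : e \in U -> gw be e -> outside al x ->
  e = 0 \/ be + al != 0.
Proof.
move=> eU ge [a0 _ _ _ naU]; have [->|e0] := eqVneq e 0; [by left | right].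
apply/eqP => ab; apply: naU; have beE : be = - al by apply/eqP; rewrite -addr_eq0 ab.
by apply: (gw_line_sub _ _ e0 eU); rewrite -?beE // beE oppr_eq0.
Qed.

Lemma outside_br_nilradical al be e x : e \in U -> gw be e -> outside al x ->
  br e x \in b -> br e x \in U.
Proof.
move=> eU ge xo exb; have [->|ab] := outside_weight eU ge xo.
  by rewrite linear0l mem0v.
case: xo => _ gx _ _ _; apply: (borel_gw_nilradical g_lie h_abel b_borel hb ab exb).
exact: gw_br.
Qed.

(** If - (be + al) were a root of U, bracketing with e would make - al = be - (be + al) one too,
    which is excluded for an outside root. *)
Lemma outside_br al be e x : e \in U -> gw be e -> outside al x ->
  br e x \in b \/ outside (be + al) (br e x).
Proof.
move=> eU ge xo; have [->|ab] := outside_weight eU ge xo.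
  by left; rewrite linear0l mem0v.
case: xo => a0 gx x0 aU naU; have gex : gw (be + al) (br e x) by apply: gw_br.
have [->|ex0] := eqVneq (br e x) 0; first by left; rewrite mem0v.
have [abU|abU] := pselect (forall y, gw (be + al) y -> y \in U).
  by left; apply: (nilradical_sub b_borel); apply: abU.
right; split=> // nabU; have [f [gf exf]] := killing_gw_dual ab gex ex0.
have fU := nabU f gf; apply: naU; apply: (@gw_line_sub _ _ (br e f)).
- by rewrite oppr_eq0.
- have -> : - al = be + - (be + al) by rewrite opprD addNKr.
  exact: gw_br.
- apply: contra_eq_neq exf => ef; rewrite [br e x]brC // killingNl killing_inv // ef killing0r oppr0.
  by rewrite eq_sym oner_eq0.
- exact: (nilradical_subalgebra b_borel).
Qed.

(** A root missing from U and U' has its opposite missing from U. Bracketing with U stays among such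
    roots modulo b, so [borel_extend] would give an outside w not in b with [U, w] in U. The derived
    algebras of b + <[w]> then lie in U + <[w]> and in U, against the maximality of b. *)
Lemma root_cover al x : al != 0 -> gw al x -> x \in U \/ x \in U'.
Proof.
move=> a0 gx; have [->|x0] := eqVneq x 0; first by left; rewrite mem0v.
have [|xU] := boolP (x \in U); first by left.
have [|xU'] := boolP (x \in U'); first by right.
have na0 : - al != 0 by rewrite oppr_eq0.
have xo : outside al x.
  split=> // [/(_ x gx)|naU]; first by apply/negP.
  have [z [gz xz]] := killing_gw_dual a0 gx x0.
  have z0 : z != 0 by apply: killing1_neq0 xz.
  move/negP: xU'; apply; apply: (gw_opposite na0 gz z0 (naU z gz)).
  by rewrite opprK.
pose Q w := w \in b \/ exists al, outside al w.
have Qst e be w : e \in U -> gw be e -> Q w -> Q (br e w).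
  move=> eU ge [wb|[ga wo]].
    by left; apply: (borel_subalgebra b_borel) => //; apply: (nilradical_sub b_borel).
  by case: (outside_br eU ge wo) => [|wo']; [left | right; exists (be + ga)].
exfalso; have [Qb|[w [[wb|[ga wo]] /negP nwb Uw]]] :=
    borel_extend g_lie h_cartan h_abel b_borel hb U_nd Qst; last first.
- have UwU e : e \in U -> br e w \in U.
    move: e; apply: (gw_ind g_lie h_abel).
    - by move=> t v /(subvP hb) tb; apply: nilradical_br.
    - by rewrite linear0l mem0v.
    - by move=> u v uU vU; rewrite linearDl; apply: memvD.
    - by move=> be e eU ge; apply: (outside_br_nilradical eU ge wo); apply: Uw.
  have [_ gw' _ _ _] := wo; have we := gw_eigen gw'.
  apply: nwb; apply: (borel_extend_line g_lie h_cartan h_abel b_borel hb we Uw).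
  have D1 : (bracket_space br (b + <[w]>) (b + <[w]>) <= U + <[w]>)%VS.
    exact: (borel_line_bracket g_lie h_cartan h_abel b_borel hb (subvv _) we).
  have D2 : (bracket_space br (U + <[w]>) (U + <[w]>) <= U)%VS.
    by apply: (bracket_line_sub g_lie) => // y z; apply: (nilradical_subalgebra b_borel).
  apply: (@solvable_derived _ _ br _ 2); apply: solvableS (nilradical_solvable b_borel).
  by apply: (subv_trans _ D2); apply: bracketS; exact: D1.
- exact: nwb.
move/negP: xU; apply; apply: (borel_gw_nilradical g_lie h_abel b_borel hb a0 _ gx).
by apply: Qb; right; exists al.
Qed.

Lemma nilradical_isotropic x y : x \in U -> y \in U -> B x y = 0.
Proof.
have Ust t v : t \in h -> v \in U -> br t v \in U by move=> /(subvP hb) tb; apply: nilradical_br.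
move=> + yU; move: x; apply: (gw_ind g_lie h_abel Ust); first exact: killing0l.
  by move=> u v e1 e2; rewrite killingDl e1 e2 addr0.
move=> al x xU gx; move: y yU; apply: (gw_ind g_lie h_abel Ust); first exact: killing0r.
  by move=> u v e1 e2; rewrite killingDr e1 e2 addr0.
move=> be y yU gy; have [ab|ab] := eqVneq (al + be) 0; last exact: (killing_gw_eq0 g_lie gx gy ab).
have [->|x0] := eqVneq x 0; first exact: killing0l.
have [a0|a0] := eqVneq al 0.
  rewrite a0 in gx; have := nilradical_gw0 g_lie h_cartan h_abel b_borel hb U_nd xU gx.
  by move=> ->; apply: killing0l.
have beE : be = - al by rewrite (addr0_eq ab).
by rewrite beE in gy; rewrite (nilradical_antisym a0 gx x0 xU gy yU) killing0r.
Qed.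

Lemma triangular_decomposition x : exists u t u',
  [/\ u \in U, t \in h, u' \in U' & x = u + t + u'].
Proof.
move: x; apply: (gw_ind_all g_lie h_abel).
- by exists 0, 0, 0; rewrite !mem0v !addr0.
- move=> _ _ [u [t [u' [uU th uU' ->]]]] [v [s [v' [vU sh vU' ->]]]].
  by exists (u + v), (t + s), (u' + v'); rewrite !memvD // addrACA [u + t + _]addrACA.
move=> al x gx; have [a0|a0] := eqVneq al 0.
  exists 0, x, 0; rewrite !mem0v addr0 add0r; split=> //.
  by rewrite a0 in gx; apply: (mem_h gx).
have [xU|xU'] := root_cover a0 gx.
  by exists x, 0, 0; rewrite !mem0v !addr0.
by exists 0, 0, x; rewrite !mem0v !add0r.
Qed.

End RootSpaces.

(** * The cubic Dirac operator *)

(* [ring] needs a commutative ring; [zmod] decides additive identities by reflection. *)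
Inductive zterm := ZZero | ZAtom of nat | ZAdd of zterm & zterm | ZOpp of zterm.
Fixpoint zeval (V : zmodType) (env : seq V) e : V :=
  match e with
  | ZZero => 0
  | ZAtom i => env`_i
  | ZAdd e1 e2 => zeval env e1 + zeval env e2
  | ZOpp e1 => - zeval env e1
  end.
Fixpoint zcoef e (i : nat) : int :=
  match e with
  | ZZero => 0
  | ZAtom j => (i == j)%:R
  | ZAdd e1 e2 => zcoef e1 i + zcoef e2 i
  | ZOpp e1 => - zcoef e1 i
  end.
Fixpoint zsize e : nat :=
  match e with
  | ZZero => 0
  | ZAtom j => j.+1
  | ZAdd e1 e2 => maxn (zsize e1) (zsize e2)
  | ZOpp e1 => zsize e1
  end.

Lemma zevalE (V : zmodType) (env : seq V) N e : (zsize e <= N)%N ->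
  zeval env e = \sum_(i < N) env`_i *~ zcoef e i.
Proof.
elim: e => [|j|e1 IH1 e2 IH2|e IH] /= sz.
- by rewrite big1 // => i _; rewrite mulr0z.
- rewrite (bigD1 (Ordinal sz)) //= eqxx big1 ?addr0 // => i ij.
  by rewrite (_ : (i == j :> nat) = false) ?mulr0z //; apply: contraNF ij => /eqP e; apply/eqP/val_inj.
- rewrite geq_max in sz; have /andP[/IH1 -> /IH2 ->] := sz.
  by rewrite -big_split; apply: eq_bigr => i _; rewrite mulrzDr.
- by rewrite IH // -sumrN; apply: eq_bigr => i _; rewrite mulrNz.
Qed.

Lemma zeval_eq (V : zmodType) (env : seq V) e1 e2 :
  all (fun i => zcoef e1 i == zcoef e2 i) (iota 0 (maxn (zsize e1) (zsize e2))) ->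
  zeval env e1 = zeval env e2.
Proof.
set N := maxn _ _ => /allP H.
rewrite (@zevalE _ _ N) ?leq_maxl // (@zevalE _ _ N) ?leq_maxr //.
apply: eq_bigr => i _; have iN : nat_of_ord i \in iota 0 N by rewrite mem_iota add0n ltn_ord.
by rewrite (eqP (H _ iN)).
Qed.

Ltac z_same x y := match goal with _ => unify x y end.
Ltac z_index x env :=
  match env with
  | ?y :: _ => let _ := z_same x y in constr:(0%N)
  | _ :: ?env' => let n := z_index x env' in constr:(S n)
  end.
Ltac z_mem x env :=
  match env with
  | [::] => constr:(false)
  | ?y :: _ => let _ := z_same x y in constr:(true)
  | _ :: ?env' => z_mem x env'
  end.
Ltac z_atoms t env :=
  lazymatch t with
  | (?a + ?b)%R => let env := z_atoms a env in z_atoms b env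
  | (- ?a)%R => z_atoms a env
  | 0%R => env
  | _ => lazymatch z_mem t env with true => env | false => constr:(t :: env) end
  end.
Ltac z_reify t env :=
  lazymatch t with
  | (?a + ?b)%R => let x := z_reify a env in let y := z_reify b env in constr:(ZAdd x y)
  | (- ?a)%R => let x := z_reify a env in constr:(ZOpp x)
  | 0%R => constr:(ZZero)
  | _ => let i := z_index t env in constr:(ZAtom i)
  end.
Ltac zmod :=
  lazymatch goal with
  | |- @eq ?V ?a ?b =>
    let env := z_atoms a (@nil V) in let env := z_atoms b env in
    let x := z_reify a env in let y := z_reify b env in
    exact: (@zeval_eq _ env x y isT)
  end.

(** * Commutators and anticommutators *)

Section SuperCommutators.
Variable R : pzRingType.
Implicit Types x y z a c s v : R.

Definition cmt x y := x * y - y * x.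
Definition act2 x y := x * y + y * x.

Local Ltac nc := rewrite /cmt /act2 ?(mulrDl, mulrDr, mulrBl, mulrBr, mulNr, mulrN) ?mulrA; zmod.

Lemma cmtMl x y z : cmt (x * y) z = x * act2 y z - act2 x z * y. Proof. nc. Qed.
Lemma cmtMr s x y : cmt s (x * y) = cmt s x * y + x * cmt s y. Proof. nc. Qed.
Lemma act2Ml x y z : act2 (x * y) z = x * cmt y z + act2 x z * y. Proof. nc. Qed.
Lemma act2M3 x y z a :
  act2 (x * y * z) a = x * y * act2 z a - x * act2 y a * z + act2 x a * y * z.
Proof. nc. Qed.
Lemma cmtDl x y z : cmt (x + y) z = cmt x z + cmt y z. Proof. nc. Qed.
Lemma cmtDr x y z : cmt z (x + y) = cmt z x + cmt z y. Proof. nc. Qed.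
Lemma cmtNl x z : cmt (- x) z = - cmt x z. Proof. nc. Qed.
Lemma cmtNr x z : cmt z (- x) = - cmt z x. Proof. nc. Qed.
Lemma act2Dl x y z : act2 (x + y) z = act2 x z + act2 y z. Proof. nc. Qed.
Lemma act2Dr x y z : act2 z (x + y) = act2 z x + act2 z y. Proof. nc. Qed.
Lemma act2Nl x z : act2 (- x) z = - act2 x z. Proof. nc. Qed.
Lemma cmt0l x : cmt 0 x = 0. Proof. by rewrite /cmt mulr0 mul0r subrr. Qed.
Lemma cmtC x y : cmt x y = - cmt y x. Proof. nc. Qed.
Lemma act2C x y : act2 x y = act2 y x. Proof. nc. Qed.
Lemma cmt_cmt s x y : cmt s (cmt x y) = cmt (cmt s x) y + cmt x (cmt s y). Proof. nc. Qed.
Lemma cmt_cmtl x y z : cmt (cmt x y) z = cmt x (cmt y z) - cmt y (cmt x z). Proof. nc. Qed.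
Lemma cmt_act2 s x y : cmt s (act2 x y) = act2 (cmt s x) y + act2 x (cmt s y). Proof. nc. Qed.
Lemma act2_cmt v q c : act2 (cmt v q) c = act2 v (cmt q c) + cmt (act2 v c) q. Proof. nc. Qed.

(** Both sides equal x z x. *)
Lemma comm_act2_sq0 x z : x * x = 0 -> x * act2 z x = act2 z x * x.
Proof.
move=> xx; rewrite /act2 mulrDr mulrDl mulrA mulrA xx mul0r addr0 -[z * x * x]mulrA xx.
by rewrite mulr0 add0r.
Qed.

Lemma cmt_sumr I (r : seq I) (E : I -> R) z : cmt z (\sum_(i <- r) E i) = \sum_(i <- r) cmt z (E i).
Proof. by rewrite /cmt mulr_sumr mulr_suml -sumrB. Qed.
Lemma cmt_suml I (r : seq I) (E : I -> R) z : cmt (\sum_(i <- r) E i) z = \sum_(i <- r) cmt (E i) z.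
Proof. by rewrite /cmt mulr_sumr mulr_suml -sumrB. Qed.
Lemma act2_suml I (r : seq I) (E : I -> R) z : act2 (\sum_(i <- r) E i) z = \sum_(i <- r) act2 (E i) z.
Proof. by rewrite /act2 mulr_sumr mulr_suml -big_split. Qed.
Lemma act2_sumr I (r : seq I) (E : I -> R) z : act2 z (\sum_(i <- r) E i) = \sum_(i <- r) act2 z (E i).
Proof. by rewrite /act2 mulr_sumr mulr_suml -big_split. Qed.
End SuperCommutators.

Section EndoCommutators.
Variables (F : fieldType) (T : lmodType F).
Implicit Types x y : endo T.
Lemma cmtZl k x y : cmt (k *: x) y = k *: cmt x y.
Proof. by rewrite /cmt endoZAl endoZAr -scalerBr. Qed.
Lemma cmtZr k x y : cmt x (k *: y) = k *: cmt x y.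
Proof. by rewrite /cmt endoZAl endoZAr -scalerBr. Qed.
Lemma act2Zl k x y : act2 (k *: x) y = k *: act2 x y.
Proof. by rewrite /act2 endoZAl endoZAr -scalerDr. Qed.
Lemma act2Zr k x y : act2 x (k *: y) = k *: act2 x y.
Proof. by rewrite /act2 endoZAl endoZAr -scalerDr. Qed.
End EndoCommutators.

(** * Antisymmetrised contractions *)

Section Theta.
Variables (F : numClosedFieldType) (g : vectType F) (br : {bilinear g -> g -> g}).
Hypothesis g_lie : lie_bracket br.
Local Notation B := (killing br).
Implicit Types x y z w p q r : g.

(* [B (theta p q r y x) w] is the full antisymmetrisation of
   [B p _ * B q _ * B r _] evaluated at (y, x, w). *)
Definition theta p q r y x := (B r y * B q x) *: p - (B r y * B p x) *: q
  - (B q y * B r x) *: p + (B q y * B p x) *: r + (B p y * B r x) *: q - (B p y * B q x) *: r.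

Variables (n : nat) (a b : 'I_n -> g).
Let pr x := \sum_i B x (a i) *: b i.

Lemma sum_dual x (f : g -> F) : (forall k x y, f (k *: x + y) = k * f x + f y) ->
  \sum_i B (a i) x * f (b i) = f (pr x).
Proof.
move=> lf; have f0 : f 0 = 0 by have := lf (-1) 0 0; rewrite scaler0 addr0 mulN1r addNr.
rewrite /pr; elim: (index_enum _) => [|i r IH]; first by rewrite !big_nil f0.
by rewrite !big_cons lf IH killingC.
Qed.

(** Summing against [a] and [b] evaluates B [pr d, pr e] f, and the six terms of [theta] agree in
    pairs by antisymmetry of the bracket, whence the 2. For dual bases [pr] is the projection to the
    span of [b]. *)
Lemma sum_theta x y w :
  \sum_i \sum_j B (theta (a i) (a j) (br (b i) (b j)) y x) w =
  2%:R * (B (br (pr w) (pr x)) y + B (br (pr y) (pr w)) x + B (br (pr x) (pr y)) w).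
Proof.
pose S d e f := \sum_i \sum_j B (a i) d * B (a j) e * B (br (b i) (b j)) f.
have SE d e f : S d e f = B (br (pr d) (pr e)) f.
  rewrite -(sum_dual d (f := fun z => B (br z (pr e)) f)); last first.
    by move=> k z z'; rewrite linearDl linearZl_LR killingDl killingZl.
  apply: eq_bigr => i _; rewrite -(sum_dual e (f := fun z => B (br (b i) z) f)); last first.
    by move=> k z z'; rewrite linearDr linearZr_LR killingDl killingZl.
  by rewrite mulr_sumr; apply: eq_bigr => j _; rewrite mulrA.
transitivity (S w x y - S x w y - S w y x + S x y w + S y w x - S y x w).
  rewrite /S -sumrB -sumrB -big_split -big_split -sumrB /=; apply: eq_bigr => i _.
  rewrite -sumrB -sumrB -big_split -big_split -sumrB /=; apply: eq_bigr => j _.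
  rewrite /theta !(killingDl, killingNl, killingZl); ring.
rewrite !SE [br (pr x) (pr w)]brC // [br (pr w) (pr y)]brC // [br (pr y) (pr x)]brC //.
by rewrite !killingNl; ring.
Qed.
End Theta.

Lemma gen_cmt_shift (F : fieldType) (T : lmodType F) (f q : endo T) a b w :
  cmt f q = a *: q -> gen f b w -> gen f (b + a) (q w).
Proof.
move=> /eqP; rewrite subr_eq => /eqP e [k wk]; exists k.
have sq : (f - (b + a)%:E) * q = q * (f - b%:E).
  by rewrite mulrBl e mulrBr endoZAl endoZAr mul1r mulr1 scalerDl; zmod.
rewrite -[RHS](apply0 q) -wk; elim: k {wk} => // k IH.
by rewrite !endoXS IH -!endoME sq.
Qed.

(** The inverse is formally the sum of (- Q)^k Y^(- k - 1), finite on each vector; induction on the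
    exponent of Q avoids forming the inverse of Y. *)
Lemma nilpotent_perturbation (F : fieldType) (T : lmodType F) (Y Q : endo T) : GRing.comm Y Q ->
  (forall w, exists w', Y w' = w) -> (forall w, Y w = 0 -> w = 0) ->
  (forall w, exists k, (Q ^+ k) w = 0) ->
  (forall w, exists w', (Y + Q) w' = w) /\ (forall w, (Y + Q) w = 0 -> w = 0).
Proof.
move=> YQ Ysurj Yinj Qnil; split=> w; have [k] := Qnil w.
  elim: k w => [|k IH] w wk; first by exists 0; rewrite apply0 (_ : w = 0).
  have [w1 w1E] := Ysurj w; have [|w2 w2E] := IH (Q w1); last first.
    by exists (w1 - w2); rewrite applyB w2E endoDE w1E addrK.
  apply: Yinj; rewrite -endoXSr -endoME (commrX k.+1 YQ) endoME w1E.
  exact: wk.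
elim: k => [|k IH] wk e //; apply: IH => //; apply: Yinj.
rewrite -endoME (commrX k YQ) endoME; move/eqP: e; rewrite endoDE addr_eq0 => /eqP ->.
by rewrite applyN -endoXSr wk oppr0.
Qed.

(** * The cubic element of the Clifford algebra *)

Section Clifford.
Variables (F : numClosedFieldType) (g : vectType F) (br : {bilinear g -> g -> g}).
Hypothesis g_lie : lie_bracket br.
Local Notation B := (killing br).
Variables (h U U' : {vspace g}) (n : nat) (u us : 'I_n -> g).
Hypotheses (uU : forall i, u i \in U) (usU' : forall i, us i \in U').
Hypothesis Uexp : forall x, x \in U -> x = \sum_i B x (us i) *: u i.
Hypothesis U'exp : forall x, x \in U' -> x = \sum_i B x (u i) *: us i.
Hypothesis Uiso : forall x y, x \in U -> y \in U -> B x y = 0.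
Hypothesis U'iso : forall x y, x \in U' -> y \in U' -> B x y = 0.
Hypothesis Ubr : forall x y, x \in U -> y \in U -> br x y \in U.
Hypothesis U'br : forall x y, x \in U' -> y \in U' -> br x y \in U'.
Hypothesis hU : forall t x, t \in h -> x \in U -> B t x = 0.
Hypothesis hU' : forall t x, t \in h -> x \in U' -> B t x = 0.
Hypothesis hUbr : forall t x, t \in h -> x \in U -> br t x \in U.
Hypothesis hU'br : forall t x, t \in h -> x \in U' -> br t x \in U'.
Hypothesis decomp : forall x, exists y t z, [/\ y \in U, t \in h, z \in U' & x = y + t + z].

Local Notation s := (U + U')%VS.

Variables (T : lmodType F) (c : g -> endo T).
(** Extends the Clifford action from s to g through the Killing projection, so that [c (br x y)]
    makes sense; c vanishes on h. *)
Hypothesis c_exp : forall x, c x = \sum_i (B x (us i) *: c (u i) + B x (u i) *: c (us i)).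
Hypothesis cliff : forall x y, x \in s -> y \in s -> act2 (c x) (c y) = (2%:R * B x y)%:E.

Implicit Types x y z w t : g.

Let pp x := \sum_i B x (us i) *: u i.
Let pm x := \sum_i B x (u i) *: us i.

Lemma c_linear k x y : c (k *: x + y) = k *: c x + c y.
Proof.
rewrite !c_exp scaler_sumr -big_split; apply: eq_bigr => i _.
by rewrite !killingDl !killingZl !scalerDl scalerDr !scalerA /=; zmod.
Qed.
Lemma cD x y : c (x + y) = c x + c y.
Proof. by rewrite -[x]scale1r c_linear !scale1r. Qed.
Lemma c0 : c 0 = 0.
Proof. by rewrite c_exp big1 // => i _; rewrite !killing0l !scale0r addr0. Qed.
Lemma cZ k x : c (k *: x) = k *: c x.
Proof. by rewrite -[_ *: _]addr0 c_linear c0 addr0. Qed.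
Lemma cN x : c (- x) = - c x. Proof. by rewrite -scaleN1r cZ scaleN1r. Qed.
Lemma c_sum I (r : seq I) (E : I -> g) : c (\sum_(i <- r) E i) = \sum_(i <- r) c (E i).
Proof. by elim/big_rec2: _ => [|i y x _ <-]; rewrite ?c0 ?cD. Qed.

Lemma Us x : x \in U -> x \in s. Proof. exact: (subvP (addvSl _ _)). Qed.
Lemma U's x : x \in U' -> x \in s. Proof. exact: (subvP (addvSr _ _)). Qed.
Lemma hs t x : t \in h -> x \in s -> B t x = 0.
Proof. by move=> th /memv_addP[y yU [z zU' ->]]; rewrite killingDr hU // hU' // addr0. Qed.
Lemma hsbr t x : t \in h -> x \in s -> br t x \in s.
Proof.
by move=> th /memv_addP[y yU [z zU' ->]]; rewrite linearDr memv_add //; [apply: hUbr | apply: hU'br].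
Qed.
Lemma ch t : t \in h -> c t = 0.
Proof. by move=> th; rewrite c_exp big1 // => i _; rewrite (hU' th (usU' i)) (hU th (uU i)) !scale0r addr0. Qed.

Lemma ppU x : pp x \in U.
Proof. by apply: memv_suml => i _; apply: memvZ. Qed.
Lemma pmU' x : pm x \in U'.
Proof. by apply: memv_suml => i _; apply: memvZ. Qed.

Lemma pp_U' x : x \in U' -> pp x = 0.
Proof. by move=> xU'; apply: big1 => i _; rewrite U'iso // scale0r. Qed.
Lemma pm_U x : x \in U -> pm x = 0.
Proof. by move=> xU; apply: big1 => i _; rewrite Uiso // scale0r. Qed.
Lemma ppE x : x \in U -> pp x = x. Proof. by move=> /Uexp xE; rewrite [RHS]xE. Qed.
Lemma pmE x : x \in U' -> pm x = x. Proof. by move=> /U'exp xE; rewrite [RHS]xE. Qed.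
Lemma ppD x y : pp (x + y) = pp x + pp y.
Proof. by rewrite -big_split; apply: eq_bigr => i _; rewrite killingDl scalerDl. Qed.
Lemma pmD x y : pm (x + y) = pm x + pm y.
Proof. by rewrite -big_split; apply: eq_bigr => i _; rewrite killingDl scalerDl. Qed.

Lemma s_exp x : x \in s -> x = pp x + pm x.
Proof.
move=> /memv_addP[y yU [z zU' ->]].
by rewrite ppD pmD (pp_U' zU') (pm_U yU) ppE // pmE // addr0 add0r.
Qed.

Lemma s_sum x : x \in s -> x = \sum_i (B x (us i) *: u i + B x (u i) *: us i).
Proof. by move=> /s_exp {1}->; rewrite big_split. Qed.

Lemma sdecomp x : exists2 t, t \in h & x - t \in s.
Proof.
have [y [t [z [yU th zU' ->]]]] := decomp x; exists t => //.
by rewrite (_ : y + t + z - t = y + z) ?memv_add //; zmod.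
Qed.

Lemma pp_h t : t \in h -> pp t = 0.
Proof. by move=> th; apply: big1 => i _; rewrite hU' // scale0r. Qed.
Lemma pm_h t : t \in h -> pm t = 0.
Proof. by move=> th; apply: big1 => i _; rewrite hU // scale0r. Qed.

Lemma B_U x y : x \in U -> B x y = B x (pm y).
Proof.
move=> xU; have [t th ws] := sdecomp y; rewrite -[y](subrK t); move: ws; set w := y - t => ws.
by rewrite pmD (pm_h th) addr0 killingDr [B x t]killingC (hU th xU) addr0 {1}(s_exp ws) killingDr Uiso ?ppU // add0r.
Qed.

Lemma B_U' x y : x \in U' -> B x y = B x (pp y).
Proof.
move=> xU; have [t th ws] := sdecomp y; rewrite -[y](subrK t); move: ws; set w := y - t => ws.
by rewrite ppD (pp_h th) addr0 killingDr [B x t]killingC (hU' th xU) addr0 {1}(s_exp ws) killingDr [X in _ + X]U'iso ?pmU' // addr0.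
Qed.

Lemma c_eq x y : (forall w, w \in s -> B x w = B y w) -> c x = c y.
Proof. by move=> e; rewrite !c_exp; apply: eq_bigr => i _; rewrite !e //; [apply: Us | apply: U's]. Qed.

Definition cubic : endo T :=
  - (4%:R^-1 *: \sum_i \sum_j c (u i) * c (u j) * c (br (us i) (us j)))
  - (4%:R^-1 *: \sum_i \sum_j c (us i) * c (us j) * c (br (u i) (u j))).

Local Notation v := cubic.
Local Notation Q := (fun y => act2 v (c y)).

(** Two contractions of a product of three vectors leave a combination of them, and each contraction
    contributes a 2 from the Clifford relation. *)
Lemma cubic_theta p q r y x : p \in s -> q \in s -> r \in s -> y \in s -> x \in s ->
  cmt (act2 (c p * c q * c r) (c y)) (c x) = c (4%:R *: theta br p q r y x).
Proof.
move=> ps qs rs ys xs; rewrite act2M3 !cliff //.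
rewrite !endoZAr !endoZAl !mulr1 cmtDl cmtDl cmtNl !cmtZl !cmtMl !cliff //.
rewrite !endoZAr !endoZAl !mulr1 !mul1r /theta cZ !(cD, cN, cZ).
rewrite cliff // !endoZAl !mul1r !scalerDr !scalerN !scalerA.
have E (a d : F) : 2%:R * a * (2%:R * d) = 4%:R * (a * d) by ring.
by rewrite !E; zmod.
Qed.

Let phi x y z := B (br x y) z.
Lemma phiC x y z : phi x y z = - phi y x z.
Proof. by rewrite /phi [br x y]brC // killingNl. Qed.
Lemma phi_rot x y z : phi x y z = phi y z x.
Proof. by rewrite /phi killing_inv // killingC. Qed.

(** The form [phi] is alternating and vanishes on U x U x U and on U' x U' x U'. Its components with
    two entries in U' come from the first half of the cubic term, those with two entries in U from
    the second. *)
Lemma br_theta y x w : y \in s -> x \in s -> w \in s ->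
  - (\sum_i \sum_j B (theta br (u i) (u j) (br (us i) (us j)) y x) w)
  - (\sum_i \sum_j B (theta br (us i) (us j) (br (u i) (u j)) y x) w) =
  B (2%:R *: br y x) w.
Proof.
move=> ys xs ws; rewrite !(sum_theta g_lie) -/(pm _) -/(pm _) -/(pm _) -/(pp _) -/(pp _) -/(pp _).
rewrite -!/(phi _ _ _) killingZl -/(phi _ _ _).
have mE a d e : phi (pm a) (pm d) e = phi (pm a) (pm d) (pp e).
  by apply: B_U'; apply: U'br; apply: pmU'.
have pE a d e : phi (pp a) (pp d) e = phi (pp a) (pp d) (pm e).
  by apply: B_U; apply: Ubr; apply: ppU.
rewrite [phi (pm w) (pm x) y]mE [phi (pm y) (pm w) x]mE [phi (pm x) (pm y) w]mE.
rewrite [phi (pp w) (pp x) y]pE [phi (pp y) (pp w) x]pE [phi (pp x) (pp y) w]pE.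
have phiD1 a d e f : phi (a + d) e f = phi a e f + phi d e f.
  by rewrite /phi linearDl killingDl.
have phiD2 a d e f : phi e (a + d) f = phi e a f + phi e d f.
  by rewrite /phi linearDr killingDl.
have phiD3 a d e f : phi e f (a + d) = phi e f a + phi e f d.
  by rewrite /phi killingDr.
rewrite [in RHS](s_exp ys) [in RHS](s_exp xs) [in RHS](s_exp ws).
rewrite !phiD1 !phiD2 !phiD3.
have -> : phi (pp y) (pp x) (pp w) = 0 by apply: Uiso; [apply: Ubr|]; apply: ppU.
have -> : phi (pm y) (pm x) (pm w) = 0 by apply: U'iso; [apply: U'br|]; apply: pmU'.
have alt1 a d e : phi a d e = - phi e d a by rewrite phiC (phi_rot e).
have alt2 a d e : phi a d e = - phi a e d by rewrite phiC (phi_rot d).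
rewrite [phi (pm w) (pm x) _]alt1 [phi (pm y) (pm w) _]alt2 [phi (pm x) (pm y) _]phiC.
rewrite [phi (pp w) (pp x) _]alt1 [phi (pp y) (pp w) _]alt2 [phi (pp x) (pp y) _]phiC.
ring.
Qed.

(** The 4 of a double contraction cancels the 4^-1 in [cubic], and the 2 is that of [sum_theta].
    Thus half of Q y acts on s as ad y followed by the projection to s. *)
Lemma cubic_cmt y x : y \in s -> x \in s -> cmt (Q y) (c x) = c (2%:R *: br y x).
Proof.
move=> ys xs; rewrite /cubic act2Dl !act2Nl !act2Zl cmtDl !cmtNl !cmtZl.
have E (a b : 'I_n -> g) : (forall i, a i \in s) -> (forall i j, br (b i) (b j) \in s) ->
    4%:R^-1 *: cmt (act2 (\sum_i \sum_j c (a i) * c (a j) * c (br (b i) (b j))) (c y)) (c x) =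
    c (\sum_i \sum_j theta br (a i) (a j) (br (b i) (b j)) y x).
  move=> as_ bs; rewrite act2_suml cmt_suml scaler_sumr c_sum; apply: eq_bigr => i _.
  rewrite act2_suml cmt_suml scaler_sumr c_sum; apply: eq_bigr => j _.
  by rewrite cubic_theta // cZ scalerA mulVf ?scale1r // pnatr_eq0.
rewrite (E u us) ?(E us u); first last.
- by move=> i j; apply: U's; apply: U'br.
- by move=> i; apply: Us.
- by move=> i j; apply: Us; apply: Ubr.
- by move=> i; apply: U's.
rewrite -!cN -cD; apply: c_eq => w ws; rewrite -br_theta // killingDl !killingNl.
by rewrite !killing_suml; congr (- _ - _); apply: eq_bigr => i _; rewrite killing_suml.
Qed.

(** In the spin module this is the natural action of t on the exterior algebra of U; the shift by
    the half sum of roots is scalar and drops out of commutators. *)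
Definition spin_h t : endo T := 2%:R^-1 *: \sum_i c (br t (u i)) * c (us i).

Lemma spin_h_cmt t x : t \in h -> x \in s -> cmt (spin_h t) (c x) = c (br t x).
Proof.
move=> th xs; rewrite /spin_h cmtZl cmt_suml scaler_sumr.
transitivity (c (\sum_i (B (us i) x *: br t (u i) - B (br t (u i)) x *: us i))).
  rewrite c_sum; apply: eq_bigr => i _; have tu := hUbr th (uU i).
  rewrite cmtMl (cliff (U's (usU' i)) xs) (cliff (Us tu) xs) endoZAr endoZAl mulr1 mul1r cD cN !cZ scalerBr !scalerA.
  by rewrite !mulrA mulVf ?pnatr_eq0 // !mul1r.
apply: c_eq => w ws; rewrite killing_suml.
transitivity (B (br t (pp x)) w + B (pm (br t x)) w).
  rewrite -(@sum_dual _ _ br _ us u x (fun z => B (br t z) w)); last first.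
    by move=> k z z'; rewrite linearDr linearZr_LR killingDl killingZl.
  rewrite killing_suml -big_split; apply: eq_bigr => i _.
  rewrite killingDl killingNl !killingZl; congr (_ + _).
  by rewrite -mulNr -killingNl -brC // killing_inv // killingC.
rewrite [in RHS](s_exp xs) (linearDr br t) killingDl; congr (_ + _).
have tmU' : br t (pm x) \in U' by apply: hU'br => //; apply: pmU'.
by rewrite {1}(s_exp xs) (linearDr br t) pmD (pm_U (hUbr th (ppU x))) add0r pmE.
Qed.

Lemma dual_inv t (be : g -> g -> endo T) : t \in h ->
  (forall k x y z, be (k *: x + y) z = k *: be x z + be y z) ->
  (forall k x y z, be z (k *: x + y) = k *: be z x + be z y) ->
  \sum_i (be (br t (u i)) (us i) + be (u i) (br t (us i))) = 0.
Proof.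
move=> th be1 be2.
have be01 z : be 0 z = 0 by have := be1 (-1) 0 0 z; rewrite scaler0 addr0 scaleN1r addNr.
have be02 z : be z 0 = 0 by have := be2 (-1) 0 0 z; rewrite scaler0 addr0 scaleN1r addNr.
have sum1 (r : seq 'I_n) (a : 'I_n -> F) E z :
    be (\sum_(k <- r) a k *: E k) z = \sum_(k <- r) a k *: be (E k) z.
  by elim: r => [|k r IH]; rewrite ?big_nil // !big_cons be1 IH.
have sum2 (r : seq 'I_n) (a : 'I_n -> F) E z :
    be z (\sum_(k <- r) a k *: E k) = \sum_(k <- r) a k *: be z (E k).
  by elim: r => [|k r IH]; rewrite ?big_nil // !big_cons be2 IH.
transitivity (\sum_i \sum_k B (br t (u i)) (us k) *: be (u k) (us i)
   + \sum_i \sum_k B (br t (us k)) (u i) *: be (u k) (us i)).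
  rewrite [X in _ + X]exchange_big -big_split; apply: eq_bigr => i _ /=.
  rewrite {1}(Uexp (hUbr th (uU i))) {1}(U'exp (hU'br th (usU' i))).
  by rewrite sum1 sum2.
rewrite -big_split big1 // => i _; rewrite -big_split big1 // => k _ /=.
have -> : B (br t (us k)) (u i) = - B (br t (u i)) (us k).
  by rewrite brC // killingNl killing_inv // killingC.
by rewrite -scalerDl subrr scale0r.
Qed.

(** The cubic term is built from the tensor summing u i (x) us i, which is h-invariant by
    [dual_inv]. *)
Lemma spin_h_cubic t : t \in h -> cmt (spin_h t) v = 0.
Proof.
move=> th; rewrite /cubic cmtDr !cmtNr !cmtZr.
have E (a b : 'I_n -> g) : (forall i, a i \in s) -> (forall i j, br (b i) (b j) \in s) ->
    (forall be : g -> g -> endo T,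
      (forall k x y z, be (k *: x + y) z = k *: be x z + be y z) ->
      (forall k x y z, be z (k *: x + y) = k *: be z x + be z y) ->
      \sum_i (be (br t (a i)) (b i) + be (a i) (br t (b i))) = 0) ->
    cmt (spin_h t) (\sum_i \sum_j c (a i) * c (a j) * c (br (b i) (b j))) = 0.
  move=> as_ bs inv.
  transitivity (\sum_i \sum_j ((c (br t (a i)) * c (a j) * c (br (b i) (b j))
       + c (a i) * c (a j) * c (br (br t (b i)) (b j)))
     + (c (a i) * c (br t (a j)) * c (br (b i) (b j))
       + c (a i) * c (a j) * c (br (b i) (br t (b j)))))).
    rewrite cmt_sumr; apply: eq_bigr => i _; rewrite cmt_sumr; apply: eq_bigr => j _.
    rewrite !cmtMr !spin_h_cmt // (jacobi g_lie t) cD mulrDl mulrDr -!mulrA; zmod.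
  have -> : forall G H : 'I_n -> 'I_n -> endo T, \sum_i \sum_j (G i j + H i j) =
      \sum_j \sum_i G i j + \sum_i \sum_j H i j.
    by move=> G H; rewrite exchange_big [X in _ + X]exchange_big -big_split; apply: eq_bigr => j _; rewrite big_split.
  rewrite !big1 ?addr0 // => i _.
    apply: (inv (fun p q => c (a i) * c p * c (br (b i) q))) => k x y z.
      by rewrite c_linear mulrDr mulrDl endoZAr endoZAl.
    by rewrite linearDr linearZr_LR c_linear mulrDr endoZAr.
  apply: (inv (fun p q => c p * c (a i) * c (br q (b i)))) => k x y z.
    by rewrite c_linear !mulrDl !endoZAl.
  by rewrite linearDl linearZl_LR c_linear mulrDr endoZAr.
rewrite (E u us) ?(E us u) ?scaler0 ?oppr0 ?addr0 //.
- by move=> i; apply: U's.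
- by move=> i j; apply: Us; apply: Ubr.
- move=> be be1 be2; rewrite -[RHS](@dual_inv t (fun x y => be y x)) //.
  by apply: eq_bigr => i _; rewrite addrC.
- by move=> i; apply: Us.
- by move=> i j; apply: U's; apply: U'br.
- by move=> be be1 be2; apply: dual_inv.
Qed.

Lemma cubic_weight t x : t \in h -> x \in s -> cmt (spin_h t) (Q x) = Q (br t x).
Proof.
by move=> th xs; rewrite cmt_act2 spin_h_cubic // spin_h_cmt // /act2 mul0r mulr0 add0r add0r.
Qed.

Lemma cmt_spin_h (Z : endo T) t : t \in h -> (forall x, x \in s -> cmt Z (c x) = 0) ->
  cmt Z (spin_h t) = 0.
Proof.
move=> th Zc; rewrite /spin_h cmtZr cmt_sumr big1 ?scaler0 // => i _.
by rewrite cmtMr !Zc ?mul0r ?mulr0 ?addr0 //; [apply: U's | apply: Us; apply: hUbr].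
Qed.

Lemma act2_spin_h (Z : endo T) t : t \in h -> (forall x, x \in s -> act2 Z (c x) = 0) ->
  cmt Z (spin_h t) = 0.
Proof.
move=> th Zc; rewrite /spin_h cmtZr cmt_sumr big1 ?scaler0 // => i _.
rewrite cmtC cmtMl ![act2 _ Z]act2C (Zc _ (U's (usU' i))) (Zc _ (Us (hUbr th (uU i)))).
by rewrite mulr0 mul0r subrr oppr0.
Qed.

(** * The cubic element and a root vector *)

Section RootVector.
Variables (y y' : g) (al : g -> F).
Local Notation t := (br y y').
Hypotheses (ys : y \in s) (y's : y' \in s) (th : t \in h).
Hypothesis y_eig : forall t', t' \in h -> br t' y = al t' *: y.
Hypothesis y'_eig : forall t', t' \in h -> br t' y' = - al t' *: y'.
Hypothesis yy' : B y y' = 1.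
Hypothesis al_B : forall t', t' \in h -> al t' = B t t'.
Hypothesis al_neq0 : exists2 t', t' \in h & al t' != 0.
Hypothesis h_abel : forall t1 t2, t1 \in h -> t2 \in h -> br t1 t2 = 0.
(** Encodes that s is the line of y' plus weight vectors of weights k other than - al, the
    difference being witnessed by some t'. *)
Hypothesis s_ind : forall P : g -> Prop, P 0 -> (forall w1 w2, P w1 -> P w2 -> P (w1 + w2)) ->
  (forall k, P (k *: y')) ->
  (forall w t' k, w \in s -> t' \in h -> br t' w = k *: w -> al t' + k != 0 ->
     B y w = 0 -> P w) ->
  forall w, w \in s -> P w.

(** B y w *: t is the h component of [y, w]: for y' the bracket is t itself, and the other weight
    vectors are moved to nonzero weights, where this component vanishes. *)
Lemma root_br w : w \in s -> br y w - B y w *: t \in s.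
Proof.
move: w; apply: s_ind.
- by rewrite linear0r killing0r scale0r subr0 mem0v.
- move=> w1 w2 h1 h2; rewrite linearDr killingDr scalerDl opprD addrACA.
  exact: memvD.
- by move=> k; rewrite linearZr_LR killingZr yy' mulr1 subrr mem0v.
move=> w t' k ws t'h wk alk yw; rewrite yw scale0r subr0.
have [t1 t1h] := sdecomp (br y w); set z := br y w - t1 => zs.
have e : br t' (br y w) = (al t' + k) *: br y w.
  by rewrite (jacobi g_lie) y_eig // wk linearZl_LR linearZr_LR -scalerDl.
rewrite -[br y w](scalerK alk) memvZ // -e.
by rewrite -[br y w](subrK t1) linearDr (h_abel t'h t1h) addr0 hsbr.
Qed.

Lemma c_root_br w : c (br y w) = c (br y w - B y w *: t).
Proof. by rewrite cD cN cZ (ch th) scaler0 subr0. Qed.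

(** The defect of Q / 2 as a Lie algebra homomorphism, up to a constant: it would vanish if Q / 2
    preserved the bracket of w and y. *)
Let K w := 2%:R *: Q (br y w) + cmt (Q w) (Q y).

(** By the Jacobi identity this would be zero if c did not drop the h components of [y, x], [y, w]
    and [w, x]; the three terms are the corrections for these. *)
Lemma K_cmt w x : w \in s -> x \in s -> cmt (K w) (c x) =
  4%:R *: (B y x *: c (br t w) - B y w *: c (br t x) - B (br t w) x *: c y).
Proof.
move=> ws xs; rewrite cmtDl cmtZl cmt_cmtl c_root_br.
rewrite (cubic_cmt (root_br ws) xs) (cubic_cmt ys xs) (cubic_cmt ws xs).
rewrite [c (2%:R *: br y x)]cZ [c (2%:R *: br w x)]cZ !cmtZr c_root_br.
have [ta tah zs] := sdecomp (br w x).
have -> : c (br w x) = c (br w x - ta) by rewrite cD cN (ch tah) subr0.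
rewrite (cubic_cmt ws (root_br xs)) (cubic_cmt ys zs).
have yta : br y ta = - (B (br t w) x *: y).
  rewrite brC // y_eig // al_B // (killing_inv g_lie t w x); congr (- (_ *: _)).
  by rewrite -[br w x](subrK ta) killingDr (hs th zs) add0r.
rewrite !linearBr !linearBl !linearZl_LR !linearZr_LR /= yta [br w t]brC // (jacobi g_lie y w x).
rewrite !(cZ, cD, cN) !(scalerDr, scalerN) !scalerA.
have -> : (4%:R : F) = 2%:R * 2%:R by rewrite -natrM.
by rewrite !mulrA; zmod.
Qed.

(** The second summand removes from [K_cmt] at y' all but its middle term, so that [K'] acts on s as
    - 4 ad t. *)
Let K' := K y' + 2%:R *: (c y * c (br t y')).

Lemma cmt_cyc z x : z \in s -> x \in s ->
  cmt (c y * c z) (c x) = (2%:R * B z x) *: c y - (2%:R * B y x) *: c z.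
Proof.
by move=> zs xs; rewrite cmtMl !cliff // endoZAr endoZAl mulr1 mul1r.
Qed.

Lemma K'_cmt x : x \in s -> cmt K' (c x) = - (4%:R *: c (br t x)).
Proof.
move=> xs; rewrite /K' cmtDl cmtZl K_cmt // cmt_cyc ?hsbr // yy' scale1r.
rewrite !(scalerDr, scalerN) !scalerA !mulrA -natrM; zmod.
Qed.

(** The combination in which the three terms of [K_cmt] cancel; it is zero at y' by the choice of
    [K']. *)
Let Z w := K w + 2%:R *: (c y * c (br t w)) - B y w *: K'.

Lemma Z_cmt w x : w \in s -> x \in s -> cmt (Z w) (c x) = 0.
Proof.
move=> ws xs; rewrite /Z 2!cmtDl cmtNl !cmtZl K_cmt // K'_cmt // cmt_cyc ?hsbr //.
rewrite !(scalerDr, scalerN) !scalerA !mulrA -natrM [B y w * _]mulrC; zmod.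
Qed.

Lemma Q_linear k w1 w2 : Q (k *: w1 + w2) = k *: Q w1 + Q w2.
Proof. by rewrite /= c_linear act2Dr act2Zr. Qed.

Lemma Z_linear k w1 w2 : Z (k *: w1 + w2) = k *: Z w1 + Z w2.
Proof.
have K_linear : K (k *: w1 + w2) = k *: K w1 + K w2.
  rewrite /K linearDr linearZr_LR !Q_linear cmtDl cmtZl.
  move: (Q (br y w1)) (Q (br y w2)) (cmt _ _) (cmt _ _) => a b p q.
  by rewrite !scalerDr !scalerA [k * _]mulrC; zmod.
rewrite /Z K_linear linearDr linearZr_LR c_linear killingDr killingZr mulrDr endoZAr [X in _ - X]scalerDl.
move: (K w1) (K w2) (c y * _) (c y * _) K' => a b p q r.
by rewrite !(scalerDr, scalerN) !scalerA [k * 2%:R]mulrC; zmod.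
Qed.

Lemma spin_h_eig t' w k : t' \in h -> w \in s -> br t' w = k *: w ->
  cmt (spin_h t') (c w) = k *: c w.
Proof. by move=> t'h ws wk; rewrite spin_h_cmt // wk cZ. Qed.

Lemma cubic_eig t' w k : t' \in h -> w \in s -> br t' w = k *: w ->
  cmt (spin_h t') (Q w) = k *: Q w.
Proof. by move=> t'h ws wk; rewrite cubic_weight // wk cZ act2Zr. Qed.

(* A weight vector of nonzero weight that commutes or anticommutes with every
   [c x] commutes with [spin_h t], and therefore vanishes. *)
Lemma Z_eq0 w : w \in s -> Z w = 0.
Proof.
have Z0 : Z 0 = 0 by have := Z_linear (-1) 0 0; rewrite scaler0 addr0 scaleN1r addNr.
move: w; apply: s_ind => //.
- by move=> w1 w2 e1 e2; rewrite -[w1]scale1r Z_linear e1 e2 scaler0 addr0.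
- by move=> k; rewrite -[_ *: _]addr0 Z_linear Z0 addr0 {1}/Z yy' scale1r -/K' subrr scaler0.
move=> w t' k ws t'h wk alk yw.
have zs : br y w \in s by have := root_br ws; rewrite yw scale0r subr0.
have z_eig : br t' (br y w) = (al t' + k) *: br y w.
  by rewrite (jacobi g_lie) y_eig // wk linearZl_LR linearZr_LR -scalerDl.
have tw_eig : br t' (br t w) = k *: br t w.
  by rewrite (jacobi g_lie) (h_abel t'h th) linear0l add0r wk linearZr_LR.
have : cmt (spin_h t') (Z w) = (al t' + k) *: Z w.
  rewrite /Z yw scale0r subr0 cmtDr cmtZr /K cmtDr cmtZr cmt_cmt cmtMr.
  rewrite (cubic_eig t'h zs z_eig) (cubic_eig t'h ws wk) (cubic_eig t'h ys (y_eig t'h)).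
  rewrite (spin_h_eig t'h ys (y_eig t'h)) (spin_h_eig t'h (hsbr th ws) tw_eig).
  rewrite cmtZl cmtZr endoZAl endoZAr -!scalerDl [k + al t']addrC !scalerDr.
  by rewrite !scalerA ![2%:R * _]mulrC.
rewrite cmtC (cmt_spin_h t'h) => [/eqP|x xs]; last exact: Z_cmt.
by rewrite oppr0 eq_sym scaler_eq0 (negPf alk) => /eqP.
Qed.

Lemma cubic_act2 w : w \in s -> act2 (cmt v (Q y)) (c w) = K w.
Proof. by move=> ws; rewrite act2_cmt (cubic_cmt ys ws) cZ act2Zr. Qed.

(** The anticommutator of the difference with c w is Z w, hence zero, and the difference has the
    nonzero weight al. The left factor c y is what c y annihilates in [root_c_cubic]. *)
Lemma root_cubic : cmt v (Q y) = 2%:R^-1 *: (c y * K').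
Proof.
apply/eqP; rewrite -subr_eq0; apply/eqP; set R1 := _ - _.
have R1c w : w \in s -> act2 R1 (c w) = 0.
  move=> ws; rewrite /R1 act2Dl act2Nl act2Zl cubic_act2 // act2Ml K'_cmt // cliff //.
  rewrite endoZAl mul1r mulrN endoZAr -[RHS](Z_eq0 ws) /Z scalerDr scalerN !scalerA.
  rewrite opprD opprK [2%:R^-1 * 4%:R](_ : _ = 2%:R); last by field.
  by rewrite mulrA mulVf ?pnatr_eq0 // mul1r addrA.
have [t' t'h alt'] := al_neq0.
have : cmt (spin_h t') R1 = al t' *: R1.
  rewrite /R1 cmtDr cmtNr cmtZr cmt_cmt spin_h_cubic // cmt0l add0r.
  rewrite (cubic_eig t'h ys (y_eig t'h)) cmtZr cmtMr (spin_h_eig t'h ys (y_eig t'h)).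
  (* [K'] has weight zero: c kills [y, y'] = t, and the other terms combine the weights al and -
     al. *)
  suff -> : cmt (spin_h t') K' = 0.
    by rewrite mulr0 addr0 endoZAl [RHS]scalerBr !scalerA [2%:R^-1 * _]mulrC.
  rewrite /K' /K cmtDr cmtZr (ch th) {1}/act2 mulr0 mul0r addr0 scaler0 add0r.
  rewrite cmt_cmt (cubic_eig t'h y's (y'_eig t'h)) (cubic_eig t'h ys (y_eig t'h)) cmtZl cmtZr -scalerDl addNr scale0r add0r.
  rewrite cmtMr y'_eig // cZ cmtZr (spin_h_eig t'h ys (y_eig t'h)) (spin_h_eig t'h y's (y'_eig t'h)).
  rewrite !(endoZAl, endoZAr) !scalerA -scalerDl.
  have -> : al t' * - al t + - al t * - al t' = 0 by ring.
  by rewrite scale0r scaler0.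
rewrite cmtC (act2_spin_h t'h R1c) oppr0 => /esym/eqP.
by rewrite scaler_eq0 (negPf alt') => /eqP.
Qed.

Lemma root_isotropic : B y y = 0.
Proof.
have [t' t'h alt'] := al_neq0; apply/eqP.
have : al t' * B y y = 0 by rewrite -killingZl -y_eig // killing_inv // brxx // killing0r.
by move/eqP; rewrite mulf_eq0 (negPf alt').
Qed.

Lemma root_c_sq : c y * c y = 0.
Proof.
have := cliff ys ys; rewrite root_isotropic mulr0 scale0r /act2 -mulr2n => /eqP.
by rewrite -scaler_nat scaler_eq0 pnatr_eq0 => /eqP.
Qed.

Lemma root_c_cubic : c y * cmt v (Q y) = 0.
Proof. by rewrite root_cubic endoZAr mulrA root_c_sq mul0r scaler0. Qed.

Variable m : g -> endo T.
Hypothesis m_linear : forall k x z, m (k *: x + z) = k *: m x + m z.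
Hypothesis m_br : forall x z, m (br x z) = cmt (m x) (m z).
Hypothesis mc : forall x z, m x * c z = c z * m x.

Definition dirac_op : endo T :=
  \sum_i (m (us i) * c (u i) + m (u i) * c (us i)) + v.

Lemma mD x z : m (x + z) = m x + m z.
Proof. by rewrite -[x]scale1r m_linear !scale1r. Qed.
Lemma m0 : m 0 = 0.
Proof. by have := m_linear (-1) 0 0; rewrite scaler0 addr0 scaleN1r addNr. Qed.
Lemma mZ k x : m (k *: x) = k *: m x.
Proof. by rewrite -[_ *: _]addr0 m_linear m0 addr0. Qed.
Lemma m_sum I (r : seq I) (E : I -> g) : m (\sum_(i <- r) E i) = \sum_(i <- r) m (E i).
Proof. by elim/big_rec2: _ => [|i w x _ <-]; rewrite ?m0 ?mD. Qed.

Lemma m_c_act2 x w z : act2 (m x * c w) (c z) = m x * act2 (c w) (c z).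
Proof. by rewrite /act2 mulrDr !mulrA -mc. Qed.

Lemma comm_m_cubic x : GRing.comm (m x) v.
Proof.
have cm3 (a b : 'I_n -> g) :
    GRing.comm (m x) (4%:R^-1 *: \sum_i \sum_j c (a i) * c (a j) * c (br (b i) (b j))).
  rewrite /GRing.comm endoZAl endoZAr; congr (_ *: _).
  by apply: commr_sum => i _; apply: commr_sum => j _; do ![apply: commrM | exact: mc].
by apply: commrB => //; rewrite -mulN1r; apply: commrM => //; apply: commrN1.
Qed.

Lemma comm_m_Q x z : GRing.comm (m x) (Q z).
Proof. by apply: commrD; apply: commrM; (exact: mc || exact: comm_m_cubic). Qed.

Local Notation A := (2%:R *: m y + Q y).

Lemma dirac_act2 : act2 dirac_op (c y) = A.
Proof.
rewrite act2Dl; congr (_ + _); rewrite act2_suml [in RHS](s_sum ys) m_sum scaler_sumr.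
apply: eq_bigr => i _; rewrite act2Dl !m_c_act2 !cliff ?(Us (uU i)) ?(U's (usU' i)) //.
rewrite !endoZAr !mulr1 mD !mZ scalerDr !scalerA addrC.
by rewrite [B (us i) y]killingC [B (u i) y]killingC.
Qed.

Lemma killing_skew x z w : B (br x z) w = - B (br x w) z.
Proof. by rewrite [br x z]brC // killingNl killing_inv // killingC. Qed.

Lemma m_root_br w : w \in s ->
  m (br y w) = \sum_k (B (br y w) (us k) *: m (u k) + B (br y w) (u k) *: m (us k)) + B y w *: m t.
Proof.
move=> ws; rewrite -{1}[br y w](subrK (B y w *: t)) mD mZ; congr (_ + _).
rewrite {1}(s_sum (root_br ws)) m_sum; apply: eq_bigr => k _.
by rewrite mD !mZ !killingDl !killingNl !killingZl (hU' th (usU' k)) (hU th (uU k)) !mulr0 !subr0.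
Qed.

(** ad y is skew for B, so all terms with components in s cancel. Only the h components of the
    brackets remain, which m keeps and c discards; by [root_br] they are multiples of t. *)
Lemma dirac_skew :
  \sum_i (m (br y (us i)) * c (u i) + m (us i) * c (br y (u i))
        + (m (br y (u i)) * c (us i) + m (u i) * c (br y (us i)))) = m t * c y.
Proof.
pose X i k := B (br y (us i)) (us k) *: (m (u k) * c (u i)).
pose Y i k := B (br y (us i)) (u k) *: (m (us k) * c (u i)).
pose X' i k := B (br y (u i)) (us k) *: (m (u k) * c (us i)).
pose Y' i k := B (br y (u i)) (u k) *: (m (us k) * c (us i)).
transitivity (\sum_i ((\sum_k (X i k + Y i k) + B y (us i) *: (m t * c (u i)))
     + \sum_k (- Y k i - Y' k i)
     + ((\sum_k (X' i k + Y' i k) + B y (u i) *: (m t * c (us i)))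
     + \sum_k (- X k i - X' k i)))).
  apply: eq_bigr => i _; have ui := Us (uU i); have usi := U's (usU' i).
  congr (_ + _ + (_ + _)).
  - rewrite m_root_br // mulrDl endoZAl mulr_suml; congr (_ + _); apply: eq_bigr => k _.
    by rewrite mulrDl !endoZAl.
  - rewrite c_exp mulr_sumr; apply: eq_bigr => k _; rewrite mulrDr !endoZAr.
    by rewrite /Y /Y' -!scaleNr -!killing_skew.
  - rewrite m_root_br // mulrDl endoZAl mulr_suml; congr (_ + _); apply: eq_bigr => k _.
    by rewrite mulrDl !endoZAl.
  - rewrite c_exp mulr_sumr; apply: eq_bigr => k _; rewrite mulrDr !endoZAr.
    by rewrite /X /X' -!scaleNr -!killing_skew.
have -> : m t * c y = \sum_i (B y (us i) *: (m t * c (u i)) + B y (u i) *: (m t * c (us i))).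
  by rewrite c_exp mulr_sumr; apply: eq_bigr => i _; rewrite mulrDr !endoZAr.
apply/eqP; rewrite -subr_eq0 -sumrB; apply/eqP.
transitivity (\sum_i \sum_k (X i k + Y i k + X' i k + Y' i k)
            - \sum_i \sum_k (X k i + Y k i + X' k i + Y' k i)).
  rewrite -sumrB; apply: eq_bigr => i _.
  transitivity (\sum_k (X i k + Y i k) + \sum_k (- Y k i - Y' k i) + \sum_k (X' i k + Y' i k) + \sum_k (- X k i - X' k i)).
    by zmod.
  rewrite -!big_split -sumrB /=; apply: eq_bigr => k _; zmod.
by rewrite exchange_big subrr.
Qed.

(** The linear part of D contributes through [dirac_skew], and m y commutes with the cubic term.
    Both remaining terms are annihilated by c y on the left. *)
Lemma dirac_cmt : cmt dirac_op A = cmt v (Q y) - 2%:R *: (m t * c y).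
Proof.
rewrite cmtDl addrC (cmtDr (2%:R *: m y) (Q y) v) cmtZr [cmt v (m y)]cmtC.
have -> : cmt (m y) v = 0 by rewrite /cmt comm_m_cubic subrr.
rewrite oppr0 scaler0 add0r; congr (_ + _).
rewrite -dirac_skew scaler_sumr -sumrN cmt_suml; apply: eq_bigr => i _ /=.
have ui := Us (uU i); have usi := U's (usU' i).
have cm x w z : cmt (m x * c w) (m z) = - (m (br z x) * c w).
  by rewrite m_br /cmt mulrBl opprB !mulrA -[m x * c w * m z]mulrA -mc mulrA.
have cq x w : w \in s -> cmt (m x * c w) (Q y) = - (2%:R *: (m x * c (br y w))).
  move=> ws; rewrite cmtC cmtMr (cubic_cmt ys ws) cZ endoZAr.
  by rewrite [cmt (Q y) (m x)](_ : _ = 0) ?mul0r ?add0r // /cmt comm_m_Q subrr.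
rewrite cmtDl !(cmtDr (2%:R *: m y) (Q y)) !cmtZr !cm !cq // !scalerN !scalerDr; zmod.
Qed.

(* The argument at the heart of the theorem: a = c y satisfies a^2 = 0 and
   D A - A D = R with a R = 0, so f = A k in Ker D forces A (a D k) = 0,
   hence a D k = 0 and D (a k) = A k = f. *)
Lemma dirac_ker_im (f : T) : (forall w : T, exists w' : T, (A : endo T) w' = w) ->
  (forall w : T, (A : endo T) w = 0 -> w = 0) ->
  dirac_op f = 0 -> exists f', f = dirac_op f'.
Proof.
move=> Asurj Ainj Df; have [w wf] := Asurj f; exists (c y w).
have aA : c y * A = A * c y.
  by rewrite -dirac_act2; apply: comm_act2_sq0; apply: root_c_sq.
have aR : c y * cmt dirac_op A = 0.
  by rewrite dirac_cmt mulrBr root_c_cubic endoZAr mulrA -mc -mulrA root_c_sq mulr0 scaler0 subrr.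
have e : dirac_op * A = A * dirac_op + cmt dirac_op A by rewrite [RHS]addrC /cmt subrK.
have aDw : c y (dirac_op w) = 0.
  apply: Ainj; rewrite -[LHS]/((A * c y) (dirac_op w)) -aA endoME.
  have := congr1 (fun X : endo T => c y (X w)) e; rewrite (endoME dirac_op) wf Df apply0 endoDE applyD.
  have -> : c y ((cmt dirac_op A : endo T) w) = 0 by rewrite -endoME aR.
  by rewrite addr0 endoME => <-.
have := congr1 (fun X : endo T => X w) dirac_act2; rewrite [in RHS]wf => <-.
by rewrite /act2 endoDE !endoME aDw addr0.
Qed.

Hypothesis c_fin : forall f : T, exists W : T -> Prop,
  [/\ subspace W, fin_span W, W f & forall x p, W p -> W (c x p)].

(** Q y raises the generalised eigenvalues of [spin_h t'] by al t' != 0, inside a finite-dimensional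
    Clifford-stable subspace. *)
Lemma root_Q_nilpotent (f : T) : exists k, ((Q y : endo T) ^+ k) f = 0.
Proof.
have [W [sW fW Wf Wc]] := c_fin f; have [t' t'h alt'] := al_neq0.
have Wv p : W p -> W ((v : endo T) p).
  move=> Wp; have WS (a b : 'I_n -> g) :
      W ((4%:R^-1 *: \sum_i \sum_j c (a i) * c (a j) * c (br (b i) (b j)) : endo T) p).
    rewrite endoZE; apply: subspaceZ => //; rewrite endo_sumE; apply: subspace_sum => // i _.
    by rewrite endo_sumE; apply: subspace_sum => // j _; rewrite !endoME; do 3!apply/Wc.
  by rewrite /cubic endoBE endoNE; apply: subspaceB => //; apply: subspaceN.
have WQ p : W p -> W ((Q y : endo T) p).
  by move=> Ww; apply: subspaceD => //; [apply/Wv/Wc | apply/Wc/Wv].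
have Ws p : W p -> W (spin_h t' p).
  move=> Ww; rewrite endoZE; apply: subspaceZ => //; rewrite endo_sumE.
  by apply: subspace_sum => // i _; apply/Wc/Wc.
apply: (gen_ind sW fW Ws (P := fun f => exists k, ((Q y : endo T) ^+ k) f = 0)) (Wf).
- by exists 0%N; rewrite apply0.
- move=> w1 w2 [k1 e1] [k2 e2]; exists (maxn k1 k2).
  by rewrite applyD (endoX0_le e1) ?leq_maxl // (endoX0_le e2) ?leq_maxr // addr0.
move=> b w Ww gw; apply: (shift_nilpotent fW alt' (f := spin_h t') _ gw) => [d w' gw'|k]; last first.
  by elim: k => // k IH; rewrite endoXS; apply: WQ.
by apply: gen_cmt_shift; [apply: (cubic_eig t'h ys (y_eig t'h)) |].
Qed.

Lemma bijective_root_ker_im (f : T) : (forall p : T, exists q : T, m y q = p) ->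
  (forall p : T, m y p = 0 -> p = 0) -> dirac_op f = 0 -> exists f', f = dirac_op f'.
Proof.
move=> y_surj y_inj; have two : 2%:R != 0 :> F by rewrite pnatr_eq0.
have [||||Asurj Ainj] := @nilpotent_perturbation _ _ (2%:R *: m y) (Q y).
- by rewrite /GRing.comm endoZAl endoZAr; congr (_ *: _); apply: comm_m_Q.
- move=> p; have [q <-] := y_surj p; exists (2%:R^-1 *: q).
  by rewrite endoZE applyZ scalerA mulfV // scale1r.
- by move=> p /eqP; rewrite endoZE scaler_eq0 (negPf two) => /eqP/y_inj.
- exact: root_Q_nilpotent.
exact: dirac_ker_im.
Qed.

End RootVector.

End Clifford.

(** * The spin module *)

Section SpinOperators.
Variables (F : numClosedFieldType) (n : nat) (M : lmodType F).
Local Notation T := (tensorS M n).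
Local Notation sg := (sgn F).
Implicit Types (i j : 'I_n) (J K : {set 'I_n}) (f : T).

Lemma sgn_add i j K : j \notin K -> sg i (j |: K) = (-1) ^+ (j < i)%N * sg i K.
Proof.
move=> jK; rewrite /sgn -exprD; congr (_ ^+ _).
rewrite (cardsD1 j) !inE eqxx /=; congr (_ + _)%N.
apply: eq_card => k; rewrite !inE; have [->|] //= := eqVneq k j.
by rewrite (negPf jK).
Qed.

Lemma sgn_sq i K : sg i K * sg i K = 1.
Proof. by rewrite /sgn -exprD addnn -mul2n exprM sqrrN expr1n expr1n. Qed.

Lemma sgn_anti i j K : i != j -> i \notin K -> j \notin K ->
  sg i (j |: K) * sg j K = - (sg j (i |: K) * sg i K).
Proof.
move=> ij iK jK; rewrite !sgn_add //.
case: (ltngtP i j) => [ij'|ij'|/val_inj e]; last by rewrite e eqxx in ij.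
  by rewrite !expr0 expr1; ring.
by rewrite !expr0 expr1; ring.
Qed.

Fact wedge_linear i : linear (fun f : T =>
  [ffun J : {set 'I_n} => if i \in J then sg i (J :\ i) *: f (J :\ i)%SET else 0] : T).
Proof.
move=> k f1 f2; apply/ffunP => J; rewrite !ffunE; case: ifP => _; last by rewrite scaler0 addr0.
by rewrite scalerDr !scalerA mulrC.
Qed.
Definition wedge i : endo T := Endo (wedge_linear i).

Fact contract_linear i : linear (fun f : T =>
  [ffun J : {set 'I_n} => if i \in J then 0 else sg i J *: f (i |: J)%SET] : T).
Proof.
move=> k f1 f2; apply/ffunP => J; rewrite !ffunE; case: ifP => _; first by rewrite scaler0 addr0.
by rewrite scalerDr !scalerA mulrC.
Qed.
Definition contract i : endo T := Endo (contract_linear i).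

Lemma wedgeE i f J : wedge i f J = if i \in J then sg i (J :\ i)%SET *: f (J :\ i)%SET else 0.
Proof. by rewrite ffunE. Qed.
Lemma contractE i f J : contract i f J = if i \in J then 0 else sg i J *: f (i |: J)%SET.
Proof. by rewrite ffunE. Qed.

Lemma wedge_wedge i j : act2 (wedge i) (wedge j) = 0.
Proof.
apply: endoP => f; apply/ffunP => J.
rewrite -[LHS]/((wedge i (wedge j f) + wedge j (wedge i f)) J) ffunE [RHS]ffunE !wedgeE !in_setD1; have [->|ij] := eqVneq i j.
  by rewrite /= !scaler0 if_same addr0.
rewrite /=.
have [iJ|iJ] := boolP (i \in J); have [jJ|jJ] := boolP (j \in J); rewrite ?scaler0 ?addr0 //.
rewrite !scalerA !finset.setDDl [([set j] :|: [set i])%SET]finset.setUC -scalerDl.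
pose K := (J :\: [set i; j])%SET.
have iK : i \notin K by rewrite !inE eqxx.
have jK : j \notin K by rewrite !inE eqxx orbT.
have -> : (J :\ i)%SET = (j |: K)%SET.
  by apply/setP => k; rewrite !inE; have [->|] := eqVneq k j; rewrite ?jJ 1?eq_sym ?ij //= orbF.
have -> : (J :\ j)%SET = (i |: K)%SET.
  by apply/setP => k; rewrite !inE; have [->|] := eqVneq k i; rewrite ?iJ ?ij.
by rewrite sgn_anti // addNr scale0r.
Qed.

Lemma contract_contract i j : act2 (contract i) (contract j) = 0.
Proof.
apply: endoP => f; apply/ffunP => J.
rewrite -[LHS]/((contract i (contract j f) + contract j (contract i f)) J) ffunE [RHS]ffunE !contractE !in_setU1; have [->|ij] := eqVneq i j.
  by rewrite /= !scaler0 if_same addr0.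
rewrite /=.
have [iJ|iJ] := boolP (i \in J); have [jJ|jJ] := boolP (j \in J); rewrite ?scaler0 ?addr0 //.
rewrite !scalerA !finset.setUA [([set j] :|: [set i])%SET]finset.setUC -scalerDl.
by rewrite [sg j J * _]mulrC sgn_anti // [sg i J * _]mulrC subrr scale0r.
Qed.

Lemma wedge_contract i j : act2 (wedge i) (contract j) = ((i == j)%:R)%:E.
Proof.
apply: endoP => f; apply/ffunP => J.
rewrite -[LHS]/((wedge i (contract j f) + contract j (wedge i f)) J) ffunE [RHS]ffunE.
rewrite wedgeE !contractE wedgeE in_setD1 in_setU1; have [<-|ij] := eqVneq i j.
  rewrite /= scale1r; case: ifP => iJ.
    by rewrite addr0 scalerA sgn_sq scale1r finset.setD1K.
  by rewrite add0r scalerA finset.setU1K ?iJ // sgn_sq scale1r.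
rewrite /= scale0r.
have [iJ|iJ] := boolP (i \in J); have [jJ|jJ] := boolP (j \in J); rewrite ?scaler0 ?addr0 //.
rewrite !scalerA; pose K := (J :\ i)%SET.
have iK : i \notin K by rewrite !inE eqxx.
have jK : j \notin K by rewrite !inE negb_and jJ orbT.
have JE : J = (i |: K)%SET by rewrite finset.setD1K.
have -> : ((j |: J) :\ i)%SET = (j |: K)%SET.
  by apply/setP => k; rewrite !inE; have [->|] := eqVneq k i; rewrite // (negPf ij).
rewrite -scalerDl -/K; have := sgn_anti ij iK jK; rewrite -JE => e.
(* [sgn_anti] multiplied through by squares of signs, which are 1. *)
have -> : sg i K * sg j K = - (sg j J * sg i (j |: K)).
  rewrite -[RHS]mulr1 -(sgn_sq j K) -[LHS]mulr1 -{1}(sgn_sq j J).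
  have -> : - (sg j J * sg i (j |: K)) * (sg j K * sg j K) = - sg j J * sg j K * (sg i (j |: K) * sg j K) by ring.
  by rewrite e; ring.
by rewrite addNr scale0r.
Qed.

Lemma act2_wedge_contract (a a' b b' : 'I_n -> F) :
  act2 (\sum_i (a i *: wedge i + b i *: contract i))
       (\sum_i (a' i *: wedge i + b' i *: contract i)) =
  (\sum_i (a i * b' i + b i * a' i))%:E.
Proof.
rewrite act2_suml scaler_suml; apply: eq_bigr => i _.
rewrite act2_sumr (bigD1 i) //= big1 ?addr0 => [|j ji].
  rewrite act2Dl !act2Dr !act2Zl !act2Zr wedge_wedge contract_contract wedge_contract.
  rewrite (act2C (contract i)) wedge_contract eqxx !scale1r !scaler0 addr0 add0r.
  by rewrite !scalerA -scalerDl.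
rewrite act2Dl !act2Dr !act2Zl !act2Zr wedge_wedge contract_contract wedge_contract.
by rewrite (act2C (contract i)) wedge_contract (negPf ji) eq_sym (negPf ji) !scale0r !scaler0 !addr0.
Qed.

(** The orbit of f under End S: Clifford operators only recombine the finitely many coefficients f
    I, so this is finite-dimensional and stable even when M is infinite-dimensional. *)
Definition coefficient_span f : T -> Prop := fun p =>
  exists C : {set 'I_n} -> {set 'I_n} -> F, forall J, p J = \sum_I C J I *: f I.

Lemma coefficient_span_subspace f : subspace (coefficient_span f).
Proof.
split; first by exists (fun _ _ => 0) => J; rewrite ffunE big1 // => I _; rewrite scale0r.
move=> k p q [C pC] [C' qC]; exists (fun J I => k * C J I + C' J I) => J.
rewrite !ffunE pC qC scaler_sumr -big_split; apply: eq_bigr => I _.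
by rewrite scalerDl scalerA.
Qed.

Lemma coefficient_span_fin f : fin_span (coefficient_span f).
Proof.
pose D : finType := ({set 'I_n} * {set 'I_n})%type.
pose e (d : D) : T := [ffun J => (J == d.1)%:R *: f d.2].
exists #|D|, (fun k => e (enum_val k)) => p [C pC].
exists (fun k => C (enum_val k).1 (enum_val k).2); apply/ffunP => J.
rewrite sum_ffunE -(big_enum_val (fun d : D => ((C d.1 d.2 *: e d) : T) J)) /=.
rewrite -(pair_big xpredT xpredT (fun J' I => ((C J' I *: e (J', I)) : T) J)) /= pC.
rewrite [RHS](bigD1 J) //= [X in _ + X]big1 ?addr0 => [|J' JJ'].
  by apply: eq_bigr => I _; rewrite !ffunE eqxx scale1r.
by apply: big1 => I _; rewrite !ffunE /= eq_sym (negPf JJ') scale0r scaler0.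
Qed.

Lemma coefficient_span_refl f : coefficient_span f f.
Proof.
exists (fun J I => (J == I)%:R) => J; rewrite (bigD1 J) //= eqxx scale1r big1 ?addr0 // => I JI.
by rewrite eq_sym (negPf JI) scale0r.
Qed.

Lemma coefficient_span_wedge f i p : coefficient_span f p -> coefficient_span f (wedge i p).
Proof.
move=> [C pC]; exists (fun J I => if i \in J then sg i (J :\ i)%SET * C (J :\ i)%SET I else 0) => J.
rewrite wedgeE; case: ifP => _; last by rewrite big1 // => I _; rewrite scale0r.
by rewrite pC scaler_sumr; apply: eq_bigr => I _; rewrite scalerA.
Qed.

Lemma coefficient_span_contract f i p : coefficient_span f p -> coefficient_span f (contract i p).
Proof.
move=> [C pC]; exists (fun J I => if i \in J then 0 else sg i J * C (i |: J)%SET I) => J.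
rewrite contractE; case: ifP => _; first by rewrite big1 // => I _; rewrite scale0r.
by rewrite pC scaler_sumr; apply: eq_bigr => I _; rewrite scalerA.
Qed.

(* A coefficientwise version of [tens id a = A] that is stable under composition. *)
Definition represents (a : spin F n -> spin F n) (A : endo T) :=
  (forall s J, a s J = \sum_K s K * a (spin_basis F K) J) /\ forall f, tens id a f = A f.

Lemma represents_comp a b A A' : represents a A -> represents b A' ->
  represents (fun s => a (b s)) (A * A').
Proof.
move=> [al aA] [bl bA]; split=> [s J|f].
  rewrite al; under eq_bigr do rewrite bl mulr_suml.
  rewrite exchange_big; apply: eq_bigr => I _ /=.
  by rewrite al mulr_sumr; apply: eq_bigr => K _; rewrite mulrA.
rewrite endoME -bA -aA; apply/ffunP => J; rewrite !ffunE.
transitivity (\sum_I \sum_K (b (spin_basis F I) K * a (spin_basis F K) J) *: f I).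
  by apply: eq_bigr => I _; rewrite al scaler_suml.
rewrite exchange_big; apply: eq_bigr => K _; rewrite ffunE scaler_sumr.
by apply: eq_bigr => I _; rewrite scalerA mulrC.
Qed.

Lemma spin_basis_sum (s : spin F n) J : s J = \sum_K s K * spin_basis F K J.
Proof.
rewrite (bigD1 J) //= ffunE eqxx mulr1 big1 ?addr0 // => K KJ.
by rewrite ffunE eq_sym (negPf KJ) mulr0.
Qed.

Lemma represents_weighted (P : {set 'I_n} -> pred 'I_n) (k : {set 'I_n} -> 'I_n -> F)
    (r : 'I_n -> {set 'I_n} -> {set 'I_n}) (A : endo T) :
  (forall f J, A f J = \sum_(i | P J i) k J i *: f (r i J)) ->
  represents (fun s => [ffun J => \sum_(i | P J i) k J i * s (r i J)]) A.
Proof.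
move=> AE; split=> [s J|f].
  rewrite ffunE; under eq_bigr do rewrite [s _]spin_basis_sum mulr_sumr.
  rewrite exchange_big; apply: eq_bigr => K _; rewrite ffunE mulr_sumr.
  by apply: eq_bigr => i _; rewrite mulrCA.
apply/ffunP => J; rewrite AE !ffunE.
transitivity (\sum_I \sum_(i | P J i) (k J i * (r i J == I)%:R) *: f I).
  apply: eq_bigr => I _; rewrite ffunE scaler_suml; apply: eq_bigr => i _.
  by rewrite ffunE.
rewrite exchange_big; apply: eq_bigr => i _; rewrite (bigD1 (r i J)) //= eqxx mulr1.
by rewrite big1 ?addr0 // => I rI; rewrite eq_sym (negPf rI) mulr0 scale0r.
Qed.

End SpinOperators.

Section DualBases.
Variables (F : numClosedFieldType) (g : vectType F) (br : {bilinear g -> g -> g}).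
Local Notation B := (killing br).
Variables (U : {vspace g}) (n : nat) (u us : n.-tuple g).
Hypothesis u_basis : basis_of U u.
Hypothesis u_dual : forall i j : 'I_n, B u`_i us`_j = (i == j)%:R.
Implicit Types i j : 'I_n.

Lemma dual_mem i : u`_i \in U.
Proof. by rewrite -(span_basis u_basis) memv_span // mem_nth // size_tuple ltn_ord. Qed.

Lemma dual_coord x i : x \in U -> coord u i x = B x us`_i.
Proof.
move=> xU; rewrite {2}(coord_basis u_basis xU) killing_suml (bigD1 i) //=.
rewrite killingZl u_dual eqxx mulr1 big1 ?addr0 // => j ji.
by rewrite killingZl u_dual (negPf ji) mulr0.
Qed.

Lemma dual_exp x : x \in U -> x = \sum_(i < n) B x us`_i *: u`_i.
Proof.
by move=> xU; rewrite {1}(coord_basis u_basis xU); apply: eq_bigr => i _; rewrite dual_coord.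
Qed.
End DualBases.

Section SpinDirac.
Variables (F : numClosedFieldType) (g : vectType F) (br : {bilinear g -> g -> g}).
Hypothesis g_lie : lie_bracket br.
Local Notation B := (killing br).
Variables (U U' : {vspace g}) (n : nat) (u us : n.-tuple g).
Hypotheses (u_basis : basis_of U u) (us_basis : basis_of U' us).
Hypothesis u_dual : forall i j : 'I_n, B u`_i us`_j = (i == j)%:R.
Hypothesis Uiso : forall x y, x \in U -> y \in U -> B x y = 0.
Hypothesis U'iso : forall x y, x \in U' -> y \in U' -> B x y = 0.
Variables (M : lmodType F) (act : {bilinear g -> M -> M}).
Hypothesis M_mod : lie_module br act.
Local Notation T := (tensorS M n).
Implicit Types i j : 'I_n.

Let us_dual i j : B us`_i u`_j = (i == j)%:R.
Proof. by rewrite killingC u_dual eq_sym. Qed.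
Let uU := dual_mem u_basis.
Let usU' := dual_mem us_basis.

(** The 2 is that of the odd derivation in [ctr]; pairing with both bases defines the operator for
    all x in g, not only in U + U'. *)
Definition spin_c x : endo T :=
  \sum_(i < n) (B x us`_i *: wedge M i + (2%:R * B x u`_i) *: contract M i).

Lemma spin_c_u j : spin_c u`_j = wedge M j.
Proof.
rewrite /spin_c (bigD1 j) //= u_dual eqxx scale1r Uiso ?uU // mulr0 scale0r addr0.
rewrite big1 ?addr0 // => i ij; rewrite u_dual eq_sym (negPf ij) scale0r.
by rewrite Uiso ?uU // mulr0 scale0r addr0.
Qed.

Lemma spin_c_us j : spin_c us`_j = 2%:R *: contract M j.
Proof.
rewrite /spin_c (bigD1 j) //= killingC u_dual eqxx mulr1 U'iso ?usU' // scale0r add0r.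
rewrite big1 ?addr0 // => i ij; rewrite [killing _ _ u`_i]killingC u_dual (negPf ij) mulr0.
by rewrite U'iso ?usU' // !scale0r addr0.
Qed.

Lemma spin_c_exp x : spin_c x = \sum_(i < n) (B x us`_i *: spin_c u`_i + B x u`_i *: spin_c us`_i).
Proof. by apply: eq_bigr => i _; rewrite spin_c_u spin_c_us scalerA [_ * 2%:R]mulrC. Qed.

Lemma spin_c_cliff x y : x \in (U + U')%VS -> y \in (U + U')%VS ->
  act2 (spin_c x) (spin_c y) = (2%:R * B x y)%:E.
Proof.
move=> xs /memv_addP[y1 y1U [y2 y2U' yE]].
rewrite /spin_c act2_wedge_contract; congr (_ *: _).
have yu i : B y u`_i = B y2 u`_i by rewrite yE killingDl Uiso ?uU // add0r.
have yus i : B y us`_i = B y1 us`_i by rewrite yE killingDl [X in _ + X]U'iso ?usU' // addr0.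
rewrite [in RHS]yE killingDr {1}(dual_exp u_basis u_dual y1U) {1}(dual_exp us_basis us_dual y2U') !killing_sumr -big_split mulr_sumr.
apply: eq_bigr => i _; rewrite yu yus !killingZr /=; ring.
Qed.

Lemma spin_c_fin (f : T) : exists W : T -> Prop,
  [/\ subspace W, fin_span W, W f & forall x p, W p -> W (spin_c x p)].
Proof.
exists (coefficient_span f); split; [exact: coefficient_span_subspace | exact: coefficient_span_fin
  | exact: coefficient_span_refl |].
have sW := coefficient_span_subspace f.
move=> x p Wp; rewrite endo_sumE; apply: subspace_sum => // i _; rewrite endoDE !endoZE.
by apply: subspaceD => //; apply: subspaceZ => //;
  [apply: coefficient_span_wedge | apply: coefficient_span_contract].
Qed.

Fact pointwise_act_linear x : linear (fun f : T => [ffun J => act x (f J)] : T).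
Proof. by move=> k f1 f2; apply/ffunP => J; rewrite !ffunE linearPr. Qed.
Definition pointwise_act x : endo T := Endo (pointwise_act_linear x).

Lemma pointwise_act_sub k x z : pointwise_act (k *: x + z) = k *: pointwise_act x + pointwise_act z.
Proof.
by apply: endoP => f; apply/ffunP => J; rewrite endoDE endoZE !ffunE linearDl linearZl_LR.
Qed.

Lemma pointwise_act_br x z : pointwise_act (br x z) = cmt (pointwise_act x) (pointwise_act z).
Proof.
apply: endoP => f; apply/ffunP => J; rewrite /cmt endoBE !endoME.
by rewrite !ffunE M_mod.
Qed.

Lemma pointwise_act_wedge x i : pointwise_act x * wedge M i = wedge M i * pointwise_act x.
Proof.
apply: endoP => f; apply/ffunP => J; rewrite !endoME wedgeE !ffunE.
by case: ifP => _; rewrite ?linear0r ?linearZr_LR.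
Qed.

Lemma pointwise_act_contract x i : pointwise_act x * contract M i = contract M i * pointwise_act x.
Proof.
apply: endoP => f; apply/ffunP => J; rewrite !endoME contractE !ffunE.
by case: ifP => _; rewrite ?linear0r ?linearZr_LR.
Qed.

Lemma pointwise_act_c x z : pointwise_act x * spin_c z = spin_c z * pointwise_act x.
Proof.
rewrite /spin_c mulr_sumr mulr_suml; apply: eq_bigr => i _.
by rewrite mulrDr [(_ + _) * pointwise_act _]mulrDl !endoZAl !endoZAr pointwise_act_wedge pointwise_act_contract.
Qed.

Lemma represents_ext x : x \in U -> represents (ext u x) (spin_c x).
Proof.
move=> xU; apply: (@represents_weighted _ _ _ (fun J i => i \in J)
  (fun J i => coord u i x * sgn F i (J :\ i)%SET) (fun i J => (J :\ i)%SET)) => f J.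
rewrite /spin_c endo_sumE sum_ffunE [RHS]big_mkcond; apply: eq_bigr => i _.
rewrite endoDE !endoZE !ffunE [B x u`_i]Uiso ?uU // mulr0 scale0r addr0 -(dual_coord u_basis u_dual) //.
by case: ifP => _; rewrite ?scaler0 // scalerA.
Qed.

Lemma represents_ctr x : x \in U' -> represents (ctr br u x) (spin_c x).
Proof.
move=> xU; apply: (@represents_weighted _ _ _ (fun J i => i \notin J)
  (fun J i => 2%:R * B u`_i x * sgn F i J) (fun i J => (i |: J)%SET)) => f J.
rewrite /spin_c endo_sumE sum_ffunE [RHS]big_mkcond; apply: eq_bigr => i _.
rewrite endoDE !endoZE !ffunE [B x us`_i]U'iso ?usU' // scale0r add0r [B u`_i x]killingC.
by case: ifP => _; rewrite ?scaler0 // scalerA.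
Qed.

Lemma tens_act x a (A : endo T) f : represents a A -> tens (act x) a f = (pointwise_act x * A) f.
Proof.
move=> [_ aA]; rewrite endoME -aA; apply/ffunP => J; rewrite !ffunE linear_sumr.
by apply: eq_bigr => I _; rewrite linearZr_LR.
Qed.

Hypothesis Ubr : forall x y, x \in U -> y \in U -> br x y \in U.
Hypothesis U'br : forall x y, x \in U' -> y \in U' -> br x y \in U'.

(** Passes from the coordinate definition of D to the ring [endo T], where the commutator calculus
    applies. *)
Lemma dirac_opE f : dirac br act u us f =
  dirac_op br (fun i : 'I_n => u`_i) (fun i : 'I_n => us`_i) spin_c pointwise_act f.
Proof.
rewrite /dirac /dirac_C /dirac_Cminus /dirac_op /cubic.
rewrite [RHS]endoDE [X in _ = _ + X]endoBE endoNE addrACA [in RHS]big_split /= [X in _ = X + _]endoDE; congr (_ + _ + (_ + _)).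
- by rewrite endo_sumE; apply: eq_bigr => i _; apply: tens_act; apply/represents_ext/uU.
- by rewrite endo_sumE; apply: eq_bigr => i _; apply: tens_act; apply/represents_ctr/usU'.
- rewrite [X in _ = - X]endoZE endo_sumE; congr (- (_ *: _)); apply: eq_bigr => i _; rewrite endo_sumE; apply: eq_bigr => j _.
  rewrite -mulrA; apply: (represents_comp _ (represents_comp _ _)).2.
  + exact/represents_ext/uU.
  + exact/represents_ext/uU.
  + by apply: represents_ctr; apply: U'br; apply: usU'.
- rewrite [X in _ = - X]endoZE endo_sumE; congr (- (_ *: _)); apply: eq_bigr => i _; rewrite endo_sumE; apply: eq_bigr => j _.
  rewrite -mulrA; apply: (represents_comp _ (represents_comp _ _)).2.
  + exact/represents_ctr/usU'.
  + exact/represents_ctr/usU'.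
  + by apply: represents_ext; apply: Ubr; apply: uU.
Qed.

End SpinDirac.

(** * Locally nilpotent elements *)

Lemma gen0P (F : fieldType) (V : lmodType F) (f : endo V) v :
  gen f 0 v <-> exists k, (f ^+ k) v = 0.
Proof. by rewrite /gen scale0r subr0. Qed.

(** Writing p(c) for the sum, p(2 c) - 2^n p(c) has no term of degree n, and the factors 2^k - 2^n
    for k < n are invertible; so induction on the degree applies. *)
Lemma coef_subspace (F : numClosedFieldType) (V : lmodType F) (P : V -> Prop) n (z : nat -> V) :
  subspace P -> (forall c : F, P (\sum_(k < n) c ^+ k *: z k)) -> forall k, (k < n)%N -> P (z k).
Proof.
move=> sP; elim: n z => [//|n IH] z Pz.
have Plt k : (k < n)%N -> P (z k).
  move=> kn; have e0 : 2%:R ^+ k - 2%:R ^+ n != 0 :> F.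
    by rewrite subr_eq0 -!natrX eqr_nat eqn_exp2l // ltn_eqF.
  rewrite -[z k](scalerK e0); apply: subspaceZ => //.
  apply: (IH (fun k => (2%:R ^+ k - 2%:R ^+ n) *: z k)) => // c.
  have -> : \sum_(k < n) c ^+ k *: ((2%:R ^+ k - 2%:R ^+ n) *: z k) =
      \sum_(k < n.+1) (2%:R * c) ^+ k *: z k - 2%:R ^+ n *: \sum_(k < n.+1) c ^+ k *: z k.
    rewrite !big_ord_recr /= scalerDr scalerA -exprMn opprD addrACA subrr addr0.
    rewrite scaler_sumr -sumrB; apply: eq_bigr => i _.
    by rewrite !scalerA -scalerBl exprMn mulrBr mulrC [c ^+ i * 2%:R ^+ n]mulrC.
  by apply: subspaceB => //; apply: subspaceZ.
move=> k; rewrite ltnS leq_eqVlt => /predU1P[->|]; last exact: Plt.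
have := Pz 1; rewrite big_ord_recr /= expr1n scale1r => Pn.
rewrite -[z n](addKr (\sum_(k < n) 1 ^+ k *: z k)) addrC.
by apply: subspaceB => //; apply: subspace_sum => // i _; apply: subspaceZ => //; apply: Plt.
Qed.

(** * Exponentials of locally nilpotent operators *)

Section Exponential.
Variables (F : numClosedFieldType) (V : lmodType F) (T : endo V).
Implicit Types v w : V.

Definition divpow j v := (j`!%:R^-1 : F) *: (T ^+ j) v.

Lemma divpow_eq0 n j v : (T ^+ n) v = 0 -> (n <= j)%N -> divpow j v = 0.
Proof. by move=> vn nj; rewrite /divpow (endoX0_le vn nj) scaler0. Qed.

Lemma divpow_sum n m v : (T ^+ n) v = 0 -> (n <= m)%N ->
  \sum_(j < m) divpow j v = \sum_(j < n) divpow j v.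
Proof.
move=> vn /subnK <-; rewrite addnC big_split_ord /= [X in _ + X]big1 ?addr0 // => i _.
by rewrite (divpow_eq0 vn) // leq_addr.
Qed.

Hypothesis T_nil : forall v, gen T 0 v.

Lemma nil_index_exists : exists n : V -> nat, forall v, (T ^+ n v) v = 0.
Proof. by have /choice[n nP] v := (gen0P T v).1 (T_nil v); exists n. Qed.
Definition nil_index := projT1 (cid nil_index_exists).
Lemma nil_indexP v : (T ^+ nil_index v) v = 0.
Proof. exact: (projT2 (cid nil_index_exists)). Qed.

(** exp T; the sum stops at a chosen exponent killing v, and [nexpE] allows any other one. *)
Definition nexp v := \sum_(j < nil_index v) divpow j v.

Lemma nexpE n v : (T ^+ n) v = 0 -> nexp v = \sum_(j < n) divpow j v.
Proof.
move=> vn; rewrite /nexp -(divpow_sum (nil_indexP v) (leq_maxl _ n)).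
by rewrite (divpow_sum vn) ?leq_maxr.
Qed.

Lemma nexpD u v : nexp (u + v) = nexp u + nexp v.
Proof.
pose n := maxn (nil_index u) (nil_index v).
have un : (T ^+ n) u = 0 by apply: endoX0_le (nil_indexP u) (leq_maxl _ _).
have vn : (T ^+ n) v = 0 by apply: endoX0_le (nil_indexP v) (leq_maxr _ _).
rewrite (nexpE un) (nexpE vn) (@nexpE n) ?applyD ?un ?vn ?addr0 // -big_split.
by apply: eq_bigr => j _; rewrite /divpow applyD scalerDr.
Qed.

Lemma nexp0 : nexp 0 = 0.
Proof. by rewrite (@nexpE 0) ?big_ord0. Qed.

(** exp T w - w is killed by a smaller power of T, hence is a value of exp T by induction, and w is
    a difference of two values. *)
Lemma nexp_surj w : exists v, nexp v = w.
Proof.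
have [k] := (gen0P T w).1 (T_nil w); elim: k w => [|k IH] w wk.
  by exists 0; rewrite nexp0; exact: esym wk.
have [v vE] : exists v, nexp v = nexp w - w.
  apply: IH; rewrite (nexpE wk) big_ord_recl {1}/divpow fact0 invr1 scale1r addrC addKr apply_sum.
  apply: big1 => j _; rewrite /divpow applyZ -endoME -exprD lift0 addnS.
  by rewrite (endoX0_le wk) ?scaler0 // ltnS leq_addr.
exists (w - v); have := nexpD (w - v) v; rewrite subrK vE => e.
by rewrite -[LHS](addrK (nexp w - w)) -e subKr.
Qed.
End Exponential.

Section ExpModule.
Variables (F : numClosedFieldType) (g : vectType F) (br : {bilinear g -> g -> g}).
Hypothesis g_lie : lie_bracket br.
Local Notation ad := (actE br).
Variables (V : lmodType F) (act : {bilinear g -> V -> V}).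
Hypothesis V_mod : lie_module br act.

Lemma act_leibniz x z v j : (actE act x ^+ j) (act z v) =
  \sum_(i < j.+1) act ((ad x ^+ i) z) ((actE act x ^+ (j - i)) v) *+ 'C(j, i).
Proof.
elim: j z v => [|j IH] z v; first by rewrite big_ord_recl big_ord0 addr0 bin0.
transitivity (\sum_(i < j.+1) act ((ad x ^+ i.+1) z) ((actE act x ^+ (j - i)) v) *+ 'C(j, i) +
  \sum_(i < j.+1) act ((ad x ^+ i) z) ((actE act x ^+ (j.+1 - i)) v) *+ 'C(j, i)).
  rewrite (endoXSr _ j) -[actE act x (act z v)]/(act x (act z v)) (act_swap V_mod) applyD !IH.
  congr (_ + _); apply: eq_bigr => i _; first by rewrite (endoXSr (ad x) i).
  by rewrite subSn ?(endoXSr (actE act x) (j - i)) // -ltnS.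
rewrite [X in _ + X]big_ord_recl [RHS]big_ord_recl !bin0 addrCA; congr (_ + _).
under [RHS]eq_bigr do rewrite lift0 binS mulrnDr subSS.
rewrite big_split /= addrC; congr (_ + _).
by rewrite [RHS]big_ord_recr /= bin_small // mulr0n addr0.
Qed.

Lemma divpow_leibniz x z v j : divpow (actE act x) j (act z v) =
  \sum_(i < j.+1) act (divpow (ad x) i z) (divpow (actE act x) (j - i) v).
Proof.
rewrite /divpow act_leibniz scaler_sumr; apply: eq_bigr => i _.
rewrite linearZl_LR linearZr_LR scalerA -scaler_nat scalerA; congr (_ *: _).
have ij : (i <= j)%N by rewrite -ltnS.
rewrite -(bin_fact ij) !natrM; field.
by rewrite !pnatr_eq0 -!lt0n !fact_gt0 bin_gt0 ij.
Qed.

Variables (x : g) (n : nat).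
Hypothesis x_nil : forall v, gen (actE act x) 0 v.

(** The Leibniz rule turns exp x (z v) into the Cauchy product of exp (ad x) z and exp x v. *)
Lemma nexp_act z v : (ad x ^+ n) z = 0 ->
  act (\sum_(i < n) divpow (ad x) i z) (nexp x_nil v) = nexp x_nil (act z v).
Proof.
move=> zn; have [m] := (gen0P _ v).1 (x_nil v) => vm.
have a0 i : (n <= i)%N -> divpow (ad x) i z = 0 by apply: divpow_eq0.
have b0 i : (m <= i)%N -> divpow (actE act x) i v = 0 by apply: divpow_eq0.
(* Of n + m factors x, at least n fall on z or at least m on v. *)
have zvP : (actE act x ^+ (n + m)) (act z v) = 0.
  rewrite act_leibniz big1 // => i _; have [ni|ni] := leqP n i.
    by rewrite (endoX0_le zn ni) linear0l mul0rn.
  rewrite (endoX0_le vm) ?linear0r ?mul0rn //.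
  by rewrite leq_subRL ?leq_add2r ?(ltnW ni) // (leq_trans (ltnW ni)) ?leq_addr.
rewrite (nexpE x_nil vm) (nexpE x_nil zvP) linear_sumlz /=.
under [RHS]eq_bigr do rewrite divpow_leibniz.
rewrite (eq_bigr (fun j : 'I_(n + m) => \sum_(i < n + m | (i < j.+1)%N)
    act (divpow (ad x) i z) (divpow (actE act x) (j - i) v))) => [|j _]; last first.
  by rewrite (big_ord_widen _ (fun i => act (divpow (ad x) i z) (divpow (actE act x) (j - i) v)) (ltn_ord j)).
rewrite (exchange_big_dep xpredT) //= big_split_ord /= [X in _ + X]big1 ?addr0 => [|i _]; last first.
  by apply: big1 => j _; rewrite a0 ?linear0l // leq_addr.
apply: eq_bigr => i _; rewrite linear_sumr [RHS]big_mkcond /=.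
rewrite -(big_mkord xpredT (fun j => if (i < j.+1)%N then
  act (divpow (ad x) i z) (divpow (actE act x) (j - i) v) else 0)).
have iP : (i <= n + m)%N by rewrite (leq_trans (ltnW (ltn_ord i))) ?leq_addr.
rewrite (big_cat_nat (n := i)) //= [X in _ = X + _]big_nat [X in _ = X + _]big1 ?add0r => [|j /andP[_ ji]]; last first.
  by rewrite ltnS leqNgt ji.
rewrite (@big_addn _ _ _ 0%N _ i) big_mkord.
have -> : (n + m - i = m + (n - i))%N by rewrite addnC addnBA // ltnW.
rewrite big_split_ord /= [X in _ = _ + X]big1 ?addr0 => [|k _]; last first.
  by rewrite addnK b0 ?leq_addr // linear0r if_same.
by apply: eq_bigr => k _; rewrite ltnS leq_addl addnK.
Qed.

(** exp (ad x) z is the conjugate of z by exp x, so its powers are conjugates of the powers of z. *)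
Lemma exp_ad_nil z : (ad x ^+ n) z = 0 -> (forall v, gen (actE act z) 0 v) ->
  forall v, gen (actE act (\sum_(i < n) divpow (ad x) i z)) 0 v.
Proof.
move=> zn z_nil w; have [v <-] := nexp_surj x_nil w.
have [k vk] := (gen0P _ v).1 (z_nil v); apply/gen0P; exists k.
have -> : forall j, (actE act (\sum_(i < n) divpow (ad x) i z) ^+ j) (nexp x_nil v) =
    nexp x_nil ((actE act z ^+ j) v).
  by elim=> // j IH; rewrite !(endoXS _ j) IH; apply: nexp_act.
by rewrite vk nexp0.
Qed.
End ExpModule.

Definition seq_span (F : fieldType) (V : lmodType F) (r : seq V) (u : V) :=
  exists c : 'I_(size r) -> F, u = \sum_i c i *: r`_i.

Section SeqSpan.
Variables (F : fieldType) (V : lmodType F).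
Implicit Types (r : seq V) (u : V).

Lemma seq_span_subspace r : subspace (seq_span r).
Proof.
split; first by exists (fun _ => 0); rewrite big1 // => i _; rewrite scale0r.
move=> k u v [c ->] [d ->]; exists (fun i => k * c i + d i).
by rewrite scaler_sumr -big_split; apply: eq_bigr => i _; rewrite scalerDl scalerA.
Qed.

Lemma seq_span_fin r : fin_span (seq_span r).
Proof. by exists (size r), (fun i => r`_i). Qed.

Lemma mem_seq_span r u : u \in r -> seq_span r u.
Proof.
move=> ur; have ltur := ur; rewrite -index_mem in ltur.
exists (fun i => (i == Ordinal ltur)%:R); rewrite (bigD1 (Ordinal ltur)) //= eqxx scale1r nth_index //.
by rewrite big1 ?addr0 // => i /negPf->; rewrite scale0r.
Qed.

Lemma seq_span_ind r (P : V -> Prop) : subspace P -> {in r, forall u, P u} ->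
  forall u, seq_span r u -> P u.
Proof.
move=> sP rP u [c ->]; apply: subspace_sum => // i _; apply: subspaceZ => //.
by apply: rP; rewrite mem_nth.
Qed.
End SeqSpan.

(** * Local finiteness *)

Section LocallyFinite.
Variables (F : numClosedFieldType) (g : vectType F) (br : {bilinear g -> g -> g}).
Hypothesis g_lie : lie_bracket br.
Local Notation ad := (actE br).
Variables (V : lmodType F) (act : {bilinear g -> V -> V}).
Hypothesis V_mod : lie_module br act.

Section Filtration.
Variable s : seq g.
Hypothesis s_br : forall x y, x \in <<s>>%VS -> y \in <<s>>%VS -> br x y \in <<s>>%VS.
Variable v : V.

(** Spans the degree d part of the standard filtration on the submodule that v generates under the
    span of s. *)
Fixpoint words d : seq V :=
  if d is d'.+1 then words d' ++ [seq act y w | y <- s, w <- words d'] else [:: v].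
Arguments words : simpl never.
Lemma wordsS d : words d.+1 = words d ++ [seq act y w | y <- s, w <- words d].
Proof. by []. Qed.
Local Notation Um d := (seq_span (words d)).

Let sub d := seq_span_subspace (words d).

Lemma words_mono d e u : (d <= e)%N -> Um d u -> Um e u.
Proof.
move=> /subnK <-; elim: (e - d)%N => //= k IH Uu.
apply: seq_span_ind (IH Uu); first exact: seq_span_subspace.
by move=> w wk; apply: mem_seq_span; rewrite wordsS mem_cat wk.
Qed.

Lemma words_act d x u : x \in <<s>>%VS -> Um d u -> Um d.+1 (act x u).
Proof.
move=> xs Uu; have P : subspace (fun x => Um d.+1 (act x u)).
  split; first by rewrite linear0l; case: (sub d.+1).
  by move=> k y z yP zP; rewrite linearDl linearZl_LR; apply: (sub d.+1).2.
move: xs; apply: (span_subspace P) => y ys {x P}.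
have P : subspace (fun u => Um d.+1 (act y u)).
  split; first by rewrite linear0r; case: (sub d.+1).
  by move=> k p q pP qP; rewrite linearDr linearZr_LR; apply: (sub d.+1).2.
apply: (seq_span_ind P) Uu => w wd; apply: mem_seq_span; rewrite wordsS mem_cat orbC.
by rewrite (allpairs_f (fun y w => act y w)).
Qed.

Definition word (t : seq g) u := foldr (fun x w => act x w) u t.

Lemma word_mem t u d : {subset t <= s} -> Um d u -> Um (size t + d) (word t u).
Proof.
elim: t => //= x t IH ts Uu; apply: words_act.
  by apply: memv_span; apply: ts; rewrite mem_head.
by apply: IH => // y yt; apply: ts; rewrite inE yt orbT.
Qed.

Lemma word_commute y t u d : y \in s -> {subset t <= s} -> Um d u ->
  Um (size t + d) (act y (word t u) - word t (act y u)).
Proof.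
move=> ys; elim: t => /= [|x t IH] ts Uu; first by rewrite subrr; case: (sub (0 + d)).
have xs : x \in s by apply: ts; rewrite mem_head.
have ts' : {subset t <= s} by move=> p pt; apply: ts; rewrite inE pt orbT.
rewrite (act_swap V_mod) -addrA; apply: subspaceD => //.
  by apply: words_act; [apply: s_br; apply: memv_span | apply: word_mem].
by rewrite -linearBr; apply: words_act; [apply: memv_span | apply: IH].
Qed.

(** Brackets of letters lie in the span of s, so exchanging neighbours costs only shorter words, and
    all letters y can be moved next to v. *)
Lemma word_sort y t : y \in s -> {subset t <= s} ->
  Um (size t).-1 (word t v - word [seq x <- t | x != y] ((actE act y ^+ count_mem y t) v)).
Proof.
move=> ys; elim: t => /= [|x t IH] ts; first by rewrite subrr; case: (sub 0).
have xs : x \in s by apply: ts; rewrite mem_head.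
have ts' : {subset t <= s} by move=> p pt; apply: ts; rewrite inE pt orbT.
set f := [seq x <- t | x != y]; set u := (actE act y ^+ count_mem y t) v.
have fs : {subset f <= s} by move=> p; rewrite mem_filter => /andP[_ /ts'].
have Uu : Um (count_mem y t) u.
  rewrite /u; elim: (count_mem y t) => [|k IHk]; first by apply: mem_seq_span; rewrite mem_head.
  by rewrite endoXS; apply: words_act => //; apply: memv_span.
have szf : (size f + count_mem y t = size t)%N.
  by rewrite size_filter addnC -(count_predC (pred1 y) t).
have Ux : Um (size t) (act x (word t v) - act x (word f u)).
  rewrite -linearBr; case: t ts ts' IH @f @u fs Uu szf => [|x' t] ts ts' IH f u fs Uu szf.
    by rewrite /= subrr linear0r; case: (sub 0).
  by apply: words_act; [apply: memv_span | apply: IH].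
rewrite -[X in X - _](subrK (act x (word f u))) -addrA; apply: subspaceD => //.
case: eqVneq => [->|xy] /=; last by rewrite add0n subrr; case: (sub (size t)).
by rewrite add1n endoXS -szf; apply: word_commute.
Qed.

Lemma words_memP d w : w \in words d ->
  exists t, [/\ {subset t <= s}, (size t <= d)%N & w = word t v].
Proof.
elim: d w => [|d IH] w /=; first by rewrite inE => /eqP ->; exists [::].
rewrite wordsS mem_cat => /orP[/IH[t [ts td ->]]|/allpairsP[[y w'] /= [ys /IH[t [ts td ->]] ->]]].
  by exists t; split=> //; apply: leqW.
exists (y :: t); split=> // p; rewrite inE => /predU1P[->//|]; exact: ts.
Qed.

Hypothesis s_nil : {in s, forall y, gen (actE act y) 0 v}.

(* Up to shorter words, a word containing n letters y is a word applied to
   y^n v = 0, and a long word contains some letter n times. *)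
Lemma words_stable : exists d, forall u, Um d.+1 u -> Um d u.
Proof.
have [n nP] : exists n, {in s, forall y, (actE act y ^+ n) v = 0}.
  have : {in s, forall y, exists k, (actE act y ^+ k) v = 0} by move=> y /s_nil/gen0P.
  elim: (s) => [|y r IH] rP; first by exists 0%N.
  have [|n nP] := IH; first by move=> x xr; apply: rP; rewrite inE xr orbT.
  have [k kP] := rP y (mem_head _ _); exists (maxn n k) => x.
  rewrite inE => /predU1P[->|/nP xn]; first by apply: endoX0_le kP (leq_maxr _ _).
  exact: endoX0_le xn (leq_maxl _ _).
exists (size s * n)%N; set d := (_ * _)%N; apply: seq_span_ind (sub d) _.
move=> _ /words_memP[t [ts td ->]]; move: td; rewrite leq_eqVlt ltnS => /predU1P[td|td]; last first.
  by apply: (words_mono td); rewrite -[size t]addn0; apply: word_mem => //; apply: mem_seq_span; rewrite mem_head.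
have [y ys cy] : exists2 y, y \in s & (n <= count_mem y t)%N.
  apply: contrapT => no; suff : (size t <= \sum_(y <- s) n)%N.
    by rewrite big_const_seq count_predT iter_addn_0 mulnC td ltnn.
  apply: (@leq_trans (\sum_(y <- s) count_mem y t)).
    elim: t ts {td no} => //= x t IH ts; rewrite big_split /= -add1n leq_add //.
      by rewrite (big_rem x) ?eqxx ?leq_addr //=; apply: ts; rewrite mem_head.
    by apply: IH => p pt; apply: ts; rewrite inE pt orbT.
  rewrite [X in (_ <= X)%N]big_seq big_seq; apply: leq_sum => y ys.
  by rewrite leqNgt; apply/negP => lt; apply: no; exists y => //; apply: ltnW.
have := word_sort ys ts; rewrite (endoX0_le (nP y ys) cy) td.
have -> : word [seq x <- t | x != y] 0 = 0 by elim: [seq _ <- _ | _] => //= x r ->; rewrite linear0r.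
by rewrite subr0.
Qed.

Lemma locally_finite : exists W : V -> Prop, [/\ subspace W, fin_span W, W v &
  forall x u, x \in <<s>>%VS -> W u -> W (act x u)].
Proof.
have [d dP] := words_stable; exists (Um d); split=> //.
- exact: seq_span_fin.
- by apply: words_mono (leq0n d) _; apply: mem_seq_span; rewrite mem_head.
- by move=> x u xs Uu; apply/dP/words_act.
Qed.
End Filtration.
End LocallyFinite.

Section LocallyNilpotent.
Variables (F : numClosedFieldType) (g : vectType F) (br : {bilinear g -> g -> g}).
Hypothesis g_lie : lie_bracket br.
Local Notation ad := (actE br).
Variables (V : lmodType F) (act : {bilinear g -> V -> V}).
Hypothesis V_mod : lie_module br act.

Definition locally_nilpotent x := forall v, gen (actE act x) 0 v.
(** Nilpotency on g makes exp (ad x) a finite sum, so that conjugation by exp x produces elements of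
    g. *)
Definition nil_element x := (forall z, gen (ad x) 0 z) /\ locally_nilpotent x.

Lemma nil_elementZ c x : nil_element x -> nil_element (c *: x).
Proof.
by move=> [xa xn]; split=> w; rewrite actEZ -(mulr0 c); apply: gen_scale; [apply: xa | apply: xn].
Qed.

Lemma divpowZ (W : lmodType F) (c : F) (T : endo W) k w : divpow (c *: T) k w = c ^+ k *: divpow T k w.
Proof.
rewrite /divpow scalerA mulrC -scalerA; congr (_ *: _).
by elim: k => [|k IH]; rewrite ?expr0 ?scale1r // !(endoXS _ k) IH applyZ endoZE scalerA -exprSr.
Qed.

(* exp (ad (c x)) z is nilpotent again for every scalar c, so the coefficients of
   this polynomial in c lie in the span. *)
Lemma nil_element_span_br s : {in s, forall x, nil_element x} ->
  (forall x, nil_element x -> x \in <<s>>%VS) ->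
  forall x y, x \in <<s>>%VS -> y \in <<s>>%VS -> br x y \in <<s>>%VS.
Proof.
move=> sN Ns x y xs ys.
have P1 y' : subspace (fun x => br x y' \in <<s>>%VS).
  split=> [|k u v uP vP]; first by rewrite linear0l mem0v.
  by rewrite linearDl linearZl_LR memvD ?memvZ.
have P2 x' : subspace (fun y => br x' y \in <<s>>%VS).
  split=> [|k u v uP vP]; first by rewrite linear0r mem0v.
  by rewrite linearDr linearZr_LR memvD ?memvZ.
move: xs; apply: (span_subspace (P1 y)) => {}x /sN Nx.
move: ys; apply: (span_subspace (P2 x)) => z /sN[za zn].
have [k xk] := (gen0P _ z).1 (Nx.1 z).
(* The coefficient of c is [x, z]. Length k + 2 keeps index 1 in range and makes (c ad x)^(k + 2)
   vanish on z for every c, including 0. *)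
have := @coef_subspace _ _ (fun y => y \in <<s>>%VS) k.+2 (fun k => divpow (ad x) k z).
move=> /(_ (subspace_mem _)) H.
suff /H/(_ 1%N isT) : forall c, \sum_(i < k.+2) c ^+ i *: divpow (ad x) i z \in <<s>>%VS.
  by rewrite /divpow expr1 [X in X *: _](_ : _ = 1) ?invr1 ?scale1r.
move=> c; apply: Ns; have [cxa cxn] := nil_elementZ c Nx.
have -> : \sum_(i < k.+2) c ^+ i *: divpow (ad x) i z = \sum_(i < k.+2) divpow (ad (c *: x)) i z.
  by apply: eq_bigr => i _; rewrite actEZ divpowZ.
have xk2 : (ad (c *: x) ^+ k.+2) z = 0.
  rewrite actEZ; have [|] := boolP (c == 0) => [/eqP->|c0].
    by rewrite scale0r (endoXS _ k.+1).
  have -> : forall j, ((c *: ad x) ^+ j) z = c ^+ j *: (ad x ^+ j) z.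
    by elim=> [|j IH]; rewrite ?expr0 ?scale1r // !(endoXS _ j) IH applyZ endoZE scalerA -exprSr.
  by rewrite (endoX0_le xk) ?scaler0 // leqW.
split=> w.
  by apply: (exp_ad_nil (ad_lie_module g_lie) cxa xk2 za).
exact: (exp_ad_nil V_mod cxn xk2 zn).
Qed.

Variable h : {vspace g}.
Local Notation gw := (@gw F g br h).

(* Fernando: the span of the elements that are nilpotent on g and on V is a
   subalgebra, and it acts locally finitely on V. *)
Lemma locally_nilpotent_br (Q : V -> Prop) (al : weight h) x y :
  nil_element x -> nil_element y -> al != 0 ->
  (forall t, t \in h -> br t (br x y) = ev al t *: br x y) ->
  (forall P : V -> Prop, subspace P -> (forall v, Q v -> P v) -> forall v, P v) ->
  (forall v t, Q v -> t \in h -> exists a, gen (actE act t) a v) ->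
  locally_nilpotent (br x y).
Proof.
move=> Nx Ny al0 zal Qind Qw; have [s [sN Ns]] := spanning_seq nil_element.
have zs : br x y \in <<s>>%VS by apply: (nil_element_span_br sN Ns); apply: Ns.
apply: Qind => [|v Qv]; first exact: gen_subspace.
have [t th alt] := ev_neq0 al0; have [a va] := Qw v t Qv th.
have [W [sW fW Wv Ws]] := locally_finite V_mod (nil_element_span_br sN Ns) (fun y ys => (sN y ys).2 v).
apply/gen0P; apply: (shift_nilpotent fW alt _ va) => [b w wb|k].
  rewrite addrC; apply: (gen_act V_mod) wb.
  by apply: eigen_gen; apply: zal.
by apply: subspaceX Wv => u Wu; apply: Ws.
Qed.
End LocallyNilpotent.

(** * Highest weight vectors *)

(** By [gen_ind] only generalised eigenvectors matter: nonzero eigenvalues are handled by [gen_inv],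
    and for eigenvalue 0 injectivity makes the vector zero. *)
Lemma fin_span_inj_surj (F : numClosedFieldType) (V : lmodType F) (W : V -> Prop) (f : endo V) :
  subspace W -> fin_span W -> (forall v, W v -> W (f v)) -> (forall v, f v = 0 -> v = 0) ->
  forall v, W v -> exists w, W w /\ f w = v.
Proof.
move=> sW fW Wf f_inj; apply: (gen_ind sW fW Wf).
- by exists 0; rewrite apply0; split=> //; case: sW.
- by move=> u v [u' [Wu <-]] [v' [Wv <-]]; exists (u' + v'); rewrite applyD; split=> //; apply: subspaceD.
move=> a w Ww ga; have [a0|a0] := eqVneq a 0.
  move: ga; rewrite a0 => /gen0P[k wk]; exists 0; rewrite apply0; split; first by case: sW.
  by elim: k wk => [|k IH]; [move=> <- | rewrite endoXS => /f_inj].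
have [w' [Ww' _ <-]] := gen_inv sW Wf a0 Ww ga.
by exists w'; rewrite scale0r subr0.
Qed.

(** * Root vectors on simple weight modules *)

Section WeightModules.
Variables (F : numClosedFieldType) (g : vectType F) (br : {bilinear g -> g -> g}).
Hypothesis g_lie : lie_bracket br.
Variable h : {vspace g}.
Local Notation ad := (actE br).
Local Notation weight := (weight h).
Variables (M : lmodType F) (act : {bilinear g -> M -> M}).
Hypothesis M_mod : lie_module br act.
Local Notation Mw := (@weight_space F g h M act).
Implicit Types (al be mu : weight) (x y z t : g) (v w : M).

Lemma weight_spaceP mu v : Mw mu v <-> forall t, t \in h -> act t v = ev mu t *: v.
Proof.
split=> [wv t th | wv t]; first by rewrite -{1}(vsprojK th) wv.
by rewrite wv ?subvsP // /ev vsvalK.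
Qed.

Lemma weight_space_subspace mu : subspace (Mw mu).
Proof.
split=> [t|k u v uP vP t]; first by rewrite linear0r scaler0.
by rewrite linearDr linearZr_LR uP vP scalerDr !scalerA mulrC.
Qed.

Lemma weight_space_act al mu x v : (forall t, t \in h -> br t x = ev al t *: x) ->
  Mw mu v -> Mw (al + mu) (act x v).
Proof.
move=> xal /weight_spaceP vmu; apply/weight_spaceP => t th.
by rewrite (act_swap M_mod) xal // (vmu t) // linearZl_LR linearZr_LR evD scalerDl.
Qed.

Hypothesis M_wt : weight_module h act.

Lemma weight_ind (P : M -> Prop) : subspace P ->
  (forall mu v, Mw mu v -> P v) -> forall v, P v.
Proof.
move=> sP PW v; have [ms [f [fw ->]]] := M_wt.1 v.
by apply: subspace_sum => // mu _; apply: PW (fw mu).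
Qed.

Hypothesis M_simple : simple_module act.

(** As ad x is nilpotent, the vectors killed by powers of x form a submodule, and simplicity makes
    it 0 or M. *)
Lemma injective_or_nilpotent x : (forall z, gen (ad x) 0 z) ->
  (forall v, act x v = 0 -> v = 0) \/ locally_nilpotent act x.
Proof.
move=> x_ad; have sN := gen_subspace (actE act x) 0.
have [|N0|] := M_simple.2 (gen (actE act x) 0).
- split=> [||z v vN]; [by case: sN | exact: sN.2 |].
  by rewrite -[0]addr0; apply: (gen_act M_mod).
- by left=> v xv; apply: N0; apply: eigen_gen; rewrite scale0r.
- by right.
Qed.

Lemma nilpotent_not_injective x y k : locally_nilpotent act x -> y = k *: x ->
  ~ (forall v, act y v = 0 -> v = 0).
Proof.
move=> x_nil yE y_inj; have [u /eqP u0] := M_simple.1; have /gen0P[j] := x_nil u.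
elim: j => [//|j IH]; rewrite endoXS => xu; apply/IH/y_inj.
by rewrite yE linearZl_LR -[act x _]/(actE act x _) xu scaler0.
Qed.

Hypothesis M_adm : admissible h act.

(** x after y maps every finite-dimensional weight space injectively into itself, hence onto it. *)
Lemma injective_pair_surjective al x y :
  (forall t, t \in h -> br t x = ev al t *: x) ->
  (forall t, t \in h -> br t y = ev (- al) t *: y) ->
  (forall v, act x v = 0 -> v = 0) -> (forall v, act y v = 0 -> v = 0) ->
  forall v, exists w, act x w = v.
Proof.
move=> xal yal x_inj y_inj; apply: weight_ind.
  split; first by exists 0; rewrite linear0r.
  by move=> k u v [u' <-] [v' <-]; exists (k *: u' + v'); rewrite linearDr linearZr_LR.
move=> mu v vmu.
have fW : fin_span (Mw mu) by have [k [e [_ eP]]] := M_adm mu; exists k, e.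
have [|u /x_inj/y_inj//|w [_ <-]] := @fin_span_inj_surj _ _ _ (actE act x * actE act y) (weight_space_subspace mu) fW _ _ v vmu.
  move=> u uP; rewrite endoME; have := weight_space_act xal (weight_space_act yal uP).
  by rewrite addrA subrr add0r.
by exists (act y w).
Qed.
End WeightModules.

(** * The Borel subalgebra attached to a simple module *)

Section HighestWeight.
Variables (F : numClosedFieldType) (g : vectType F) (br : {bilinear g -> g -> g}).
Hypothesis g_lie : lie_bracket br.
Variable h : {vspace g}.
Hypothesis h_cartan : cartan br h.
Local Notation ad := (actE br).
Local Notation B := (killing br).
Local Notation weight := (weight h).
Local Notation gw := (@gw F g br h).
Hypothesis h_abel : forall x y, x \in h -> y \in h -> br x y = 0.
Variable b : {vspace g}.
Hypotheses (b_borel : borel br b) (hb : (h <= b)%VS).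
Local Notation U := (nilradical br b).
Hypothesis U_nd : forall x, x \in U -> (forall z, B x z = 0) -> x = 0.
Variable b' : {vspace g}.
Hypotheses (b'_borel : borel br b') (hb' : (h <= b')%VS).
Local Notation U' := (nilradical br b').
Hypothesis UU' : forall x, x \in U -> (forall z, z \in U' -> B x z = 0) -> x = 0.
Hypothesis U'U : forall z, z \in U' -> (forall x, x \in U -> B x z = 0) -> z = 0.
Variables (M : lmodType F) (act : {bilinear g -> M -> M}).
Hypothesis M_mod : lie_module br act.
Hypothesis M_wt : weight_module h act.
Hypothesis M_simple : simple_module act.
Local Notation Mw := (@weight_space F g h M act).
Implicit Types (al be mu : weight) (x y z t : g) (v w : M).
Local Notation lnil := (locally_nilpotent act).

Let eig := gw_eigen g_lie h_cartan h_abel b_borel hb U_nd.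
Let dual := killing_gw_dual g_lie h_cartan h_abel b_borel hb U_nd.
Let nondeg := gw_killing_neq0 g_lie h_cartan h_abel b_borel hb U_nd.
Let antisym := nilradical_antisym g_lie h_cartan h_abel b_borel hb U_nd.
Let ad_nil := gw_ad_nil g_lie h_abel.

Lemma gw_locally_nilpotent_br al be x y : al != 0 -> be != 0 -> al + be != 0 ->
  gw al x -> gw be y -> lnil x -> lnil y -> lnil (br x y).
Proof.
move=> al0 be0 ab0 gx gy nx ny.
apply: (@locally_nilpotent_br _ _ _ g_lie _ _ M_mod _ (fun v => exists mu, Mw mu v) (al + be)) => //.
- by split=> // z; apply: (ad_nil gx).
- by split=> // z; apply: (ad_nil gy).
- by apply: eig; apply: gw_br.
- by move=> P sP PW; apply: (weight_ind M_wt sP) => mu v vmu; apply: PW; exists mu.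
move=> v t [mu /weight_spaceP vmu] th; exists (ev mu t).
by apply: eigen_gen; apply: vmu.
Qed.

(* U breaks the tie between al and - al when both root spaces are locally
   nilpotent on M, so that the roots occurring here form a positive system. *)
Definition parabolic_vector x := x = 0 \/ exists al, [/\ al != 0, gw al x, lnil x &
  x \in U \/ forall y, gw (- al) y -> lnil y -> y = 0].
Local Notation S := parabolic_vector.

(** Suppose - al has no nonzero locally nilpotent vector. Then [y, z], locally nilpotent of weight -
    al, is zero, so B [x, y] z = B x [y, z] = 0, against the nondegenerate pairing of opposite root
    lines. *)
Lemma parabolic_vector_half al be x y : al != 0 -> be != 0 -> al + be != 0 ->
  gw al x -> gw be y -> lnil y -> br x y != 0 ->
  x \in U \/ (forall z, gw (- al) z -> lnil z -> z = 0) ->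
  (exists z, [/\ gw (- (al + be)) z, lnil z & z != 0]) -> x \in U.
Proof.
move=> al0 be0 ab0 gx gy ny xy0 [//|xP] [z [gz nz z0]].
have gzy : gw (- al) (br y z).
  by rewrite (_ : - al = be + - (al + be)); [apply: gw_br | rewrite opprD addrCA subrr addr0].
suff yz : br y z = 0.
  have := nondeg ab0 (gw_br g_lie gx gy) gz xy0 z0.
  by rewrite killing_inv // yz killing0r eqxx.
apply: xP => //; apply: gw_locally_nilpotent_br gy gz ny nz => //; first by rewrite oppr_eq0.
by rewrite opprD addrCA subrr addr0 oppr_eq0.
Qed.

(** For opposite weights the defining condition would put both vectors in U, which has no opposite
    roots. Otherwise, if - (al + be) has a nonzero locally nilpotent vector, [parabolic_vector_half]
    puts x and y, hence [x, y], in U. *)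
Lemma parabolic_vector_br x y : S x -> S y -> S (br x y).
Proof.
move=> [->|[al [al0 gx nx xP]]]; first by left; rewrite linear0l.
move=> [->|[be [be0 gy ny yP]]]; first by left; rewrite linear0r.
have [xy0|xy0] := eqVneq (br x y) 0; [by left | right].
have x0 : x != 0 by apply: contraNneq xy0 => ->; rewrite linear0l.
have y0 : y != 0 by apply: contraNneq xy0 => ->; rewrite linear0r.
have [ab0|ab0] := eqVneq (al + be) 0.
  have bE : be = - al by rewrite (addr0_eq ab0).
  have xU : x \in U.
    by case: xP => // /(_ y) yE; move: y0; rewrite yE ?eqxx // -bE.
  have yU : y \in U.
    by case: yP => // /(_ x) xE; move: x0; rewrite xE ?eqxx // bE opprK.
  rewrite bE in gy; by move: y0; rewrite (antisym al0 gx x0 xU gy yU) eqxx.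
exists (al + be); split=> //; [exact: gw_br | exact: gw_locally_nilpotent_br gx gy nx ny |].
have [ex|no] := pselect (exists z, [/\ gw (- (al + be)) z, lnil z & z != 0]); last first.
  by right=> z gz nz; apply/eqP/negPn/negP => z0; apply: no; exists z.
left; have xU := parabolic_vector_half al0 be0 ab0 gx gy ny xy0 xP ex.
have yU : y \in U.
  apply: (parabolic_vector_half be0 al0 _ gy gx nx _ yP); rewrite 1?addrC //.
  by rewrite brC // oppr_eq0.
exact: (nilradical_subalgebra b_borel).
Qed.

Hypothesis not_both_injective : forall al x y, al != 0 -> gw al x -> gw (- al) y ->
  (forall v, act x v = 0 -> v = 0) -> (forall v, act y v = 0 -> v = 0) -> x = 0 \/ y = 0.

Lemma parabolic_vector_chain : exists s, [/\ lie_chain br s, {in s, forall x, S x} &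
  forall x, S x -> x \in <<s>>%VS].
Proof.
apply: engel_chain => // [|x y]; first exact: parabolic_vector_br.
move=> [->|[al [al0 gx _ _]]] _; last by apply/gen0P; apply: (ad_nil gx).
by exists 1%N; rewrite expr1 /= linear0l.
Qed.

Section ParabolicBorel.
Variable s : seq g.
Hypotheses (cs : lie_chain br s) (sS : {in s, forall x, S x}).
Hypothesis Ss : forall x, S x -> x \in <<s>>%VS.
Local Notation c := (h + <<s>>)%VS.

Lemma parabolic_h_br t x : t \in h -> x \in <<s>>%VS -> br t x \in <<s>>%VS.
Proof.
move=> th xs; apply: (span_subspace (P := fun x => br t x \in <<s>>%VS)) xs.
  split=> [|k u v uP vP]; first by rewrite linear0r mem0v.
  by rewrite linearDr linearZr_LR memvD ?memvZ.
move=> y ys; have [->|[al [_ gy _ _]]] := sS ys; first by rewrite linear0r mem0v.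
by rewrite (eig gy) // memvZ ?memv_span.
Qed.

Lemma parabolic_br x y : x \in c -> y \in c -> br x y \in <<s>>%VS.
Proof.
move=> /memv_addP[t th [u us ->]] /memv_addP[t' t'h [u' us' ->]].
rewrite linearDl !linearDr h_abel // add0r.
apply: memvD; first exact: parabolic_h_br.
apply: memvD; last exact: (lie_chain_subalgebra g_lie cs).
by rewrite brC // memvN parabolic_h_br.
Qed.

Lemma parabolic_solvable : solvable_lie br c.
Proof.
apply: (@solvable_derived _ _ br c 1); apply: (lie_chain_solvable g_lie cs).
apply/subvP; apply: bracket_ind; first exact: subspace_mem.
by move=> x y; apply: parabolic_br.
Qed.

(** x, y and [x, y] span a copy of sl2, which is perfect. *)
Lemma root_pair_not_solvable (c' : {vspace g}) al x y : subalgebra br c' -> solvable_lie br c' ->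
  al != 0 -> gw al x -> gw (- al) y -> x != 0 -> y != 0 -> x \in c' -> y \in c' -> False.
Proof.
move=> c'sub c'solv al0 gx gy x0 y0 xc yc; pose t := br x y.
have Bxy := nondeg al0 gx gy x0 y0.
have alt : ev al t != 0 by apply: (gw_coroot_neq0 g_lie h_cartan h_abel b_borel hb U_nd).
have th : t \in h.
  by apply: (gw0_h g_lie h_cartan h_abel); rewrite -(subrr al); apply: gw_br.
have tc : t \in c' by apply: c'sub.
pose X z := exists k, [\/ z = k *: x, z = k *: y | z = k *: t].
have X0 : forall z, X z -> z = 0; last first.
  have /eqP : x = 0 by apply: X0; exists 1; apply: Or31; rewrite scale1r.
  by rewrite (negPf x0).
apply: (perfect_in_solvable c'solv) => [z [k [] ->]|z [k [] ->]]; try exact: memvZ.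
- exists ((ev al t)^-1 *: t), (k *: x); split; [by exists (ev al t)^-1; apply: Or33 | by exists k; apply: Or31 |].
  by rewrite linearZl_LR linearZr_LR (eig gx) // !scalerA mulrAC mulVf ?mul1r.
- exists (- (ev al t)^-1 *: t), (k *: y); split; [by exists (- (ev al t)^-1); apply: Or33 | by exists k; apply: Or32 |].
  by rewrite linearZl_LR linearZr_LR (eig gy) // evN !scalerA mulrAC mulrNN mulVf ?mul1r.
- exists (k *: x), y; split; [by exists k; apply: Or31 | by exists 1; apply: Or32; rewrite scale1r |].
  by rewrite linearZl_LR.
Qed.

(** For maximality let v be a root vector in a larger solvable subalgebra, y one for the opposite
    root. Having y in S is impossible, as it would give an sl2. If v acts injectively, y is locally
    nilpotent and in S. If v is locally nilpotent it is itself in S, unless v is in U' and y, in U,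
    is locally nilpotent too; then again y is in S. *)
Lemma parabolic_borel : borel br c.
Proof.
split=> [x y xc yc||c' c'sub c'solv cc'].
- by apply: (subvP (addvSr _ _)); apply: parabolic_br.
- exact: parabolic_solvable.
have hc' t : t \in h -> t \in c' by move=> th; apply: (subvP cc'); apply: (subvP (addvSl _ _)).
have Sc' x : S x -> x \in c' by move=> /Ss xs; apply: (subvP cc'); apply: (subvP (addvSr _ _)).
apply/eqP; rewrite eqEsubv cc' andbT; apply/subvP; apply: (gw_ind g_lie h_abel).
- by move=> t v th vc; apply: c'sub => //; apply: hc'.
- exact: mem0v.
- by move=> u v; apply: memvD.
move=> al v vc gv; have [->|v0] := eqVneq v 0; first exact: mem0v.
have [a0|al0] := eqVneq al 0.
  by rewrite a0 in gv; apply: (subvP (addvSl _ _)); apply: (gw0_h g_lie h_cartan h_abel).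
have [y [gy vy]] := dual al0 gv v0.
have y0 : y != 0 by apply: killing1_neq0 vy.
have nal0 : - al != 0 by rewrite oppr_eq0.
have contra : S y -> v \in c.
  by move=> /Sc' yc; case: (root_pair_not_solvable c'sub c'solv al0 gv gy v0 y0 vc yc).
have dim1 := gw_dim1 g_lie h_cartan h_abel b_borel hb U_nd.
have [v_inj|v_nil] := injective_or_nilpotent M_mod M_simple (ad_nil gv al0).
  apply: contra; right; exists (- al).
  have [y_inj|y_nil] := injective_or_nilpotent M_mod M_simple (ad_nil gy nal0).
    by case: (not_both_injective al0 gv gy v_inj y_inj) => e; [move: v0 | move: y0]; rewrite e eqxx.
  split=> //; right => z; rewrite opprK => gz z_nil; apply/eqP/negPn/negP => z0.
  have [k vE] := dim1 _ _ _ al0 gz z0 gv.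
  exact: (nilpotent_not_injective M_simple z_nil vE).
have [vU|vU] := boolP (v \in U).
  by apply: (subvP (addvSr _ _)); apply: Ss; right; exists al; split=> //; left.
have vU' : v \in U'.
  by case: (root_cover g_lie h_cartan h_abel b_borel hb U_nd b'_borel hb' UU' al0 gv) => // e; rewrite e in vU.
have yU := gw_opposite' g_lie h_cartan h_abel b_borel hb U_nd U'U al0 gv v0 vU' gy.
have [y_inj|y_nil] := injective_or_nilpotent M_mod M_simple (ad_nil gy nal0); last first.
  by apply: contra; right; exists (- al); split=> //; left.
apply: (subvP (addvSr _ _)); apply: Ss; right; exists al; split=> //; right=> z gz z_nil.
apply/eqP/negPn/negP => z0; have [k yE] := dim1 _ _ _ nal0 gz z0 gy.
exact: (nilpotent_not_injective M_simple z_nil yE).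
Qed.
End ParabolicBorel.

Theorem simple_highest_weight : highest_weight_module br h act.
Proof.
have [s [cs sS Ss]] := parabolic_vector_chain.
have [mu0 [v0 [v0mu v00]]] : exists mu v, Mw mu v /\ v != 0.
  have [u u0] := M_simple.1; apply: contrapT => no; move: u0; apply/negP/negPn/eqP.
  apply: (weight_ind M_wt (P := fun u => u = 0)) => [|mu v vmu].
    by split=> // k p q -> ->; rewrite scaler0 addr0.
  by apply/eqP/negPn/negP => v0; apply: no; exists mu, v.
have [||||||w [[mu wmu] /eqP w0 sw]] := @engel_module _ _ _ _ act s (fun v => v = 0) (fun v => exists mu, Mw mu v)
    M_mod cs _ _ _ _ v0 _ _.
- by split=> // k p q -> ->; rewrite scaler0 addr0.
- move=> x /sS[->|[al [_ gx _ _]]] v [mu vmu].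
    by exists mu; rewrite linear0l; case: (weight_space_subspace act mu).
  by exists (al + mu); apply: (weight_space_act M_mod (eig gx)).
- by move=> x _ v ->; rewrite linear0r.
- move=> x /sS[->|[al [_ gx xn _]]] v _; last by apply/gen0P.
  by exists 1%N; rewrite expr1 /= linear0l.
- by exists mu0.
- exact/eqP.
exists (h + <<s>>)%VS, mu, w; split=> //.
- exact: parabolic_borel.
- exact: addvSl.
- move=> x xn; apply: sw; move: x xn; apply: bracket_ind; first exact: subspace_mem.
  by move=> x y; apply: parabolic_br.
move=> N sN wN; have [N0|//] := M_simple.2 N sN.
by move: w0; rewrite (N0 w) ?eqxx //; apply: wN; rewrite inE.
Qed.
End HighestWeight.

(** * Dirac cohomology *)

Section DiracCohomology.
Variables (F : numClosedFieldType) (g : vectType F) (br : {bilinear g -> g -> g}).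
Hypothesis g_lie : lie_bracket br.
Variable h : {vspace g}.
Hypothesis h_cartan : cartan br h.
Variables b b' : {vspace g}.
Hypothesis b_opp : opposite_borels br h b b'.
Local Notation B := (killing br).
Local Notation U := (nilradical br b).
Local Notation U' := (nilradical br b').
Variables (n : nat) (u us : n.-tuple g).
Hypotheses (u_basis : basis_of U u) (us_basis : basis_of U' us).
Hypothesis u_dual : forall i j : 'I_n, B u`_i us`_j = (i == j)%:R.
Variables (M : lmodType F) (act : {bilinear g -> M -> M}).
Hypothesis M_cat : category_M br h act.

Let b_borel : borel br b. Proof. by case: b_opp. Qed.
Let b'_borel : borel br b'. Proof. by case: b_opp. Qed.
Let hb : (h <= b)%VS. Proof. by case: b_opp => _ _ <-; apply: capvSl. Qed.
Let hb' : (h <= b')%VS. Proof. by case: b_opp => _ _ <-; apply: capvSr. Qed.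

Let us_dual (i j : 'I_n) : B us`_i u`_j = (i == j)%:R.
Proof. by rewrite killingC u_dual eq_sym. Qed.

Let UU' x : x \in U -> (forall z, z \in U' -> B x z = 0) -> x = 0.
Proof.
move=> xU x0; rewrite (dual_exp u_basis u_dual xU) big1 // => i _.
by rewrite x0 ?scale0r //; apply: (dual_mem us_basis).
Qed.

Let U'U z : z \in U' -> (forall x, x \in U -> B x z = 0) -> z = 0.
Proof.
move=> zU z0; rewrite (dual_exp us_basis us_dual zU) big1 // => i _.
by rewrite killingC z0 ?scale0r //; apply: (dual_mem u_basis).
Qed.

Let U_nd x : x \in U -> (forall z, B x z = 0) -> x = 0.
Proof. by move=> xU x0; apply: UU'. Qed.
Let U'_nd x : x \in U' -> (forall z, B x z = 0) -> x = 0.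
Proof. by move=> xU x0; apply: U'U => // z _; rewrite killingC. Qed.

(** [h, h] lies in U = [b, b], which meets the radical of the Killing form trivially thanks to the
    dual bases. *)
Let h_abel x y : x \in h -> y \in h -> br x y = 0.
Proof.
move: x y; apply: (cartan_abelian g_lie h_cartan) => t th; apply: U_nd.
exact: (subvP (bracketS _ hb hb)).
Qed.

Let Uiso := nilradical_isotropic g_lie h_cartan h_abel b_borel hb U_nd.
Let U'iso := nilradical_isotropic g_lie h_cartan h_abel b'_borel hb' U'_nd.
Let hU t x : t \in h -> x \in U -> B t x = 0.
Proof. by move=> th xU; rewrite killingC; apply: (nilradical_perp_h g_lie h_cartan h_abel b_borel hb). Qed.
Let hU' t x : t \in h -> x \in U' -> B t x = 0.
Proof. by move=> th xU; rewrite killingC; apply: (nilradical_perp_h g_lie h_cartan h_abel b'_borel hb'). Qed.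
Let Ubr x y : x \in U -> y \in U -> br x y \in U.
Proof. exact: (nilradical_subalgebra b_borel). Qed.
Let U'br x y : x \in U' -> y \in U' -> br x y \in U'.
Proof. exact: (nilradical_subalgebra b'_borel). Qed.
Let hUbr t x : t \in h -> x \in U -> br t x \in U.
Proof. exact: (nilradical_st b_borel hb). Qed.
Let hU'br t x : t \in h -> x \in U' -> br t x \in U'.
Proof. exact: (nilradical_st b'_borel hb'). Qed.
Let decomp := triangular_decomposition g_lie h_cartan h_abel b_borel hb U_nd b'_borel hb' UU'.
Let eig := gw_eigen g_lie h_cartan h_abel b_borel hb U_nd.

Let h_cap_s v : v \in h -> v \in (U + U')%VS -> v = 0.
Proof.
move=> vh /memv_addP[x xU [z zU' vE]].
have -> : v = x + z by [].
have -> : x = 0.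
  apply: UU' => // w wU'; have := hU' vh wU'.
  by rewrite vE killingDl // (U'iso zU' wU') addr0.
rewrite add0r; apply: U'U => // w wU; have := hU vh wU.
by rewrite vE killingDl // (Uiso xU wU) add0r killingC.
Qed.

Lemma root_in_s (al : weight h) x : al != 0 -> gw br al x -> x \in (U + U')%VS.
Proof.
move=> al0 gx; have [xU|xU] := root_cover g_lie h_cartan h_abel b_borel hb U_nd b'_borel hb' UU' al0 gx.
  exact: (subvP (addvSl _ _)).
exact: (subvP (addvSr _ _)).
Qed.

(** Supplies [s_ind]: root spaces are lines, so weight - al contributes only multiples of y', and
    weight zero contributes nothing since h meets U + U' trivially. *)
Lemma opposite_root_ind (al : weight h) y y' (P : g -> Prop) : al != 0 -> gw br al y -> gw br (- al) y' ->
  y' != 0 -> P 0 -> (forall w1 w2, P w1 -> P w2 -> P (w1 + w2)) -> (forall k, P (k *: y')) ->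
  (forall w t' k, w \in (U + U')%VS -> t' \in h -> br t' w = k *: w -> ev al t' + k != 0 ->
     B y w = 0 -> P w) ->
  forall w, w \in (U + U')%VS -> P w.
Proof.
move=> al0 gy gy' y'0 P0 PD Py' Pw; apply: (gw_ind g_lie h_abel) => //.
  by move=> t v th vs; apply: (hsbr hUbr hU'br).
move=> be v vs gv; have [be0|be0] := eqVneq be 0.
  rewrite be0 in gv; rewrite (h_cap_s _ vs) //.
  exact: (gw0_h g_lie h_cartan h_abel).
have [ab|ab] := eqVneq (al + be) 0.
  have bE : be = - al by rewrite (addr0_eq ab).
  rewrite bE in be0 gv.
  by have [k ->] := gw_dim1 g_lie h_cartan h_abel b_borel hb U_nd be0 gy' y'0 gv.
have [t' t'h t'0] := ev_neq0 ab; rewrite evD in t'0.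
apply: (Pw v t' (ev be t')) => //; first exact: eig.
by apply: (killing_gw_eq0 g_lie gy gv).
Qed.

Let M_mod : lie_module br act. Proof. by case: M_cat. Qed.
Let M_wt : weight_module h act. Proof. by case: M_cat. Qed.
Let M_adm : admissible h act. Proof. by case: M_cat. Qed.

Section BijectiveRootVector.
Variables (al : weight h) (y y' : g).
Hypotheses (al0 : al != 0) (gy : gw br al y) (gy' : gw br (- al) y') (yy' : B y y' = 1).
Hypothesis y_inj : forall v, act y v = 0 -> v = 0.
Hypothesis y_surj : forall v, exists w, act y w = v.

Local Notation T := (tensorS M n).
Local Notation m := (pointwise_act n act).
Local Notation c := (spin_c br u us M).
Local Notation D := (dirac_op br (fun i : 'I_n => u`_i) (fun i : 'I_n => us`_i) c m).

Lemma Ker_dirac_Im f : dirac br act u us f = 0 -> exists f', f = dirac br act u us f'.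
Proof.
have DE := dirac_opE u_basis us_basis u_dual Uiso U'iso act Ubr U'br.
have nal0 : - al != 0 by rewrite oppr_eq0.
have y'0 : y' != 0 by apply: killing1_neq0 yy'.
rewrite DE => Df; suff [f' ->] : exists f', f = D f' by exists f'; rewrite DE.
have m_surj (w : T) : exists w', m y w' = w.
  have /choice[w' wP] J : exists v, act y v = w J by exact: y_surj.
  by exists [ffun J => w' J]; apply/ffunP => J; rewrite !ffunE.
have m_inj (w : T) : m y w = 0 -> w = 0.
  by move=> /ffunP w0; apply/ffunP => J; have := w0 J; rewrite !ffunE => /y_inj.
apply: (@bijective_root_ker_im _ _ _ g_lie h U U' n (fun i : 'I_n => u`_i) (fun i : 'I_n => us`_i)
  _ _ _ _ Uiso U'iso Ubr U'br hU hU' hUbr hU'br decomp T c _ _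
  y y' (ev al) _ _ _ _ _ yy' _ _ h_abel _ m _ _ _ _ f m_surj m_inj Df).
- exact: (dual_mem u_basis).
- exact: (dual_mem us_basis).
- exact: (dual_exp u_basis u_dual).
- exact: (dual_exp us_basis us_dual).
- exact: (spin_c_exp u_basis us_basis u_dual Uiso U'iso).
- exact: (spin_c_cliff u_basis us_basis u_dual Uiso U'iso).
- exact: root_in_s gy.
- exact: root_in_s gy'.
- by apply: (gw0_h g_lie h_cartan h_abel); rewrite -(subrr al); apply: gw_br.
- exact: eig.
- by move=> t th; rewrite (eig gy') // evN.
- by move=> t th; rewrite (killing_coroot g_lie _ (eig gy)) // yy' mulr1.
- exact: ev_neq0.
- by move=> P P0 PD Py' Pw; apply: (@opposite_root_ind al y y').
- exact: pointwise_act_sub.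
- exact: pointwise_act_br.
- exact: pointwise_act_c.
- exact: spin_c_fin.
Qed.
End BijectiveRootVector.

Hypothesis M_simple : simple_module act.

Theorem dirac_cohomology_highest_weight :
  ~ highest_weight_module br h act -> dirac_cohomology_eq0 br act u us.
Proof.
move=> not_hw; have DE := dirac_opE u_basis us_basis u_dual Uiso U'iso act Ubr U'br.
have [al [x [y [al0 [gx gy] [x_inj y_inj] [x0 y0]]]]] : exists (al : weight h) x y,
    [/\ al != 0, gw br al x /\ gw br (- al) y,
      (forall v, act x v = 0 -> v = 0) /\ (forall v, act y v = 0 -> v = 0) & x <> 0 /\ y <> 0].
  apply: contrapT => no; apply: not_hw.
  apply: (simple_highest_weight g_lie h_cartan h_abel b_borel hb U_nd b'_borel hb' UU' U'U) => //.
  move=> al x y al0 gx gy x_inj y_inj; apply: contrapT => xy; apply: no.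
  by exists al, x, y; split=> //; split=> e; apply: xy; [left | right].
have x_surj := injective_pair_surjective M_mod M_wt M_adm (eig gx) (eig gy) x_inj y_inj.
have [z [gz xz]] := killing_gw_dual g_lie h_cartan h_abel b_borel hb U_nd al0 gx (introN eqP x0).
have ker_im := Ker_dirac_Im al0 gx gz xz x_inj x_surj.
rewrite /dirac_cohomology_eq0 /dirac_cohomology.
have zeroK : Ker_dirac br act u us 0 by rewrite /Ker_dirac DE apply0.
(* As Ker D lies in Im D, the subspace divided out is all of Ker D, and every class is that of 0. *)
have sub p q : Ker_dirac br act u us q ->
    (Ker_dirac br act u us `&` Im_dirac br act u us)%classic (p - q) <->
    (Ker_dirac br act u us `&` Im_dirac br act u us)%classic (p - 0).
  move=> qK; have KE r : (Ker_dirac br act u us `&` Im_dirac br act u us)%classic r <-> dirac br act u us r = 0.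
    by split=> [[]//|rK]; split=> //; apply: ker_im.
  rewrite !KE subr0 !DE applyB; move: qK; rewrite /Ker_dirac DE => ->.
  by rewrite subr0.
apply/seteqP; split=> [X [f fK <-]|X ->]; last by exists 0.
by apply/funext => p; apply/propext; apply: sub.
Qed.
End DiracCohomology.

Theorem theorem3p9 (R : realType) (g : vectType R[i])
  (br : {bilinear g -> g -> g}) (g_lie : lie_bracket br)
  (g_red : reductive br)
  (h : {vspace g}) (h_cartan : cartan br h)
  (b b' : {vspace g}) (b_opp : opposite_borels br h b b')
  (n : nat) (u us : n.-tuple g)
  (u_basis : basis_of (nilradical br b) u)
  (us_basis : basis_of (nilradical br b') us)
  (u_dual : forall i j : 'I_n, killing br u`_i us`_j = (i == j)%:R)
  (M : lmodType R[i]) (act : {bilinear g -> M -> M})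
  (M_cat : category_M br h act) (M_simple : simple_module act) :
  ~ highest_weight_module br h act -> dirac_cohomology_eq0 br act u us.
Proof.
exact: (dirac_cohomology_highest_weight g_lie h_cartan b_opp u_basis us_basis
  u_dual M_cat M_simple).
Qed.
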